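(* Let $G$ be a finite group and let $\mathcal F$ be a family of subgroups of $G$. Suppose that (1) $R$ is a principal ideal domain; (2) $\underline{n}\colon \mathcal S(G)\to\mathbb Z$ is a conjugation-invariant function supported on $\mathcal F$; and (3) $\mathbf C$ is a finite chain complex of free $R\Gamma_G$-modules which is an $R$-homology $\underline{n}$-sphere. Then $\mathbf C$ is chain homotopy equivalent to a finite free chain complex $\mathbf D$ of $R\Gamma_G$-modules satisfying $\underline{n}=\operatorname{Dim}\mathbf D$ if and only if $\mathbf C$ is an algebraic homotopy representation over $R$.
   Context: $G$ is a finite group, $\mathcal S(G)$ is the set of all subgroups of $G$. A family $\mathcal F$ is a nonempty set of subgroups of $G$ closed under conjugation and taking subgroups. $\Gamma_G=\operatorname{Or}_{\mathcal F}G$ is the orbit category: objects are the orbits $G/K$ with $K\in\mathcal F$, morphisms are $G$-maps. $R$ is a commutative ring with $1$. An $R\Gamma_G$-module is a contravariant functor $M$ from $\Gamma_G$ to $R$-modules; write $M(K)=M(G/K)$. Exactness is objectwise. For $H\in\mathcal F$, $R[G/H^{?}]$ is the module $K\mapsto R[(G/H)^K]$; a module is free if it is isomorphic to a direct sum of such modules, and projective modules are exactly the direct summands of free ones. Chain complexes $\mathbf C$ are non-negative ($\mathbf C_i=0$ for $i<0$); $\mathbf C$ is finite if $\mathbf C_i=0$ for all large $i$ and every $\mathbf C_i$ is finitely generated; it is free (projective) if every $\mathbf C_i$ is. $\operatorname{Dim}\mathbf C\colon\mathcal S(G)\to\mathbb Z$ is given by: for $H\in\mathcal F$, $(\operatorname{Dim}\mathbf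 C)(H)$ is the largest $d$ with $\mathbf C_d(H)\neq0$ (and $-1$ if $\mathbf C(H)=0$); for $H\notin\mathcal F$ it is $-1$. A function $\underline n\colon\mathcal S(G)\to\mathbb Z$ is supported on $\mathcal F$ if $\underline n(H)=-1$ for all $H\notin\mathcal F$. $\underline R$ is the constant functor with value $R$. An augmentation of $\mathbf C$ is a map $\varepsilon\colon\mathbf C_0\to\underline R$ with $\varepsilon\circ\partial_1=0$ such that $\varepsilon(H)$ is surjective whenever $\mathbf C(H)\ne0$; reduced homology is the homology of the augmented complex $\cdots\to\mathbf C_1\to\mathbf C_0\xrightarrow{\varepsilon}\underline R\to0$ with $\underline R$ in degree $-1$. For $\underline n$ supported on $\mathcal F$, $\mathbf C$ is an $R$-homology $\underline n$-sphere if it has an augmentation such that for every $K\in\mathcal F$ the reduced homology of $\mathbf C(K)$ is that of an $\underline n(K)$-sphere with coefficients in $R$ (i.e. $R$ in degree $\underline n(K)\ge-1$ and zero otherwise; $S^{-1}=\emptyset$). Write $(H)\le(K)$ if $g^{-1}Hg\le K$ for some $g\in G$. A finite projective chain complex $\mathbf C$ which is an $R$-homology $\underline n$-sphere is an algebraic homotopy representation (over $R$) if: (i) $\underline n$ is monotone, i.e. $\underline n(H)\ge\underline n(K)$ whenever $(H)\le(K)$; (ii) if $H,K\in\mathcal F$ satisfy $\underline n(K)=\underline n(H)$, then for every $G$-map $f\colon G/H\to G/K$ the induced map $\mathbf C(f)\colon\mathbf C(K)\to\mathbf C(H)$ is an $R$-homology isomorphism; (iii) if $H,K,L\in\mathcal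 F$ satisfy $H\le K$, $H\le L$ and $n=\underline n(H)=\underline n(K)=\underline n(L)>-1$, then $M=\langle K,L\rangle\in\mathcal F$ and $\underline n(M)=n$. *)

(* Defs.v *)
From HB Require Import structures.
From mathcomp Require Import all_boot all_order all_algebra.
From mathcomp Require Import generic_quotient ring_quotient all_fingroup.
From mathcomp Require Import boolp classical_sets functions cardinality.

(* The ambient finite group G is the whole finGroupType gT. *)

Set Implicit Arguments.
Unset Strict Implicit.
Unset Printing Implicit Defensive.

Import GRing.Theory.

Local Open Scope ring_scope.
Local Open Scope quotient_scope.

Section OrbitCategory.

Variable gT : finGroupType.
Implicit Types (H K L : {group gT}) (F : {set {group gT}}).

Definition is_family F : Prop :=
  [/\ F != finset.set0,
      forall H (g : gT), H \in F -> (H :^ g)%G \in F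
    & forall H L, H \in F -> L \subset H -> L \in F].

(* The left G-set G/H of left cosets of H. *)
Record orb H := Orb
  { coset_set :> {set gT}; _ : coset_set \in lcosets H [set: gT] }.

HB.instance Definition _ H := [isSub for @coset_set H].
HB.instance Definition _ H := [Finite of orb H by <:].

Lemma oact_subproof H (g : gT) (x : orb H) :
  lcoset (val x) g \in lcosets H [set: gT].
Proof.
case: x => A /= /lcosetsP[a _ ->].
by apply/lcosetsP; exists (g * a)%g; rewrite ?inE // !lcosetE -lcosetM.
Qed.

Definition oact H (g : gT) (x : orb H) : orb H := Orb (oact_subproof g x).

Lemma obase_subproof H : (H : {set gT}) \in lcosets H [set: gT].
Proof. by apply/lcosetsP; exists 1%g; rewrite ?inE // lcoset1. Qed.

Definition obase H : orb H := Orb (obase_subproof H).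

Lemma oact1 H (x : orb H) : oact 1%g x = x.
Proof. by apply: val_inj; rewrite /= lcosetE lcoset1. Qed.

Lemma oactM H (a b : gT) (x : orb H) : oact (a * b)%g x = oact a (oact b x).
Proof. by apply: val_inj; rewrite /= !lcosetE lcosetM. Qed.

Lemma oact_repr H (x : orb H) : oact (repr (val x)) (obase H) = x.
Proof.
apply: val_inj; case: x => A /= /lcosetsP[a _ ->].
have: repr (a *: H)%g \in (a *: H)%g by apply: (mem_repr a); exact: lcoset_refl.
by rewrite lcosetE => /lcoset_eqP ->.
Qed.

Lemma oact_base H (h : gT) : h \in H -> oact h (obase H) = obase H.
Proof. by move=> hH; apply: val_inj; rewrite /= lcosetE lcoset_id. Qed.

Lemma oact_base_in H (a b : gT) :
  oact a (obase H) = oact b (obase H) -> (a^-1 * b)%g \in H.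
Proof.
move/(congr1 val); rewrite /= !lcosetE => e.
by rewrite -mem_lcoset e lcoset_refl.
Qed.

Definition equivariant H K (f : {ffun orb H -> orb K}) : bool :=
  [forall g : gT, forall x : orb H, f (oact g x) == oact g (f x)].

Record gmap H K := GMap
  { gmap_ffun : {ffun orb H -> orb K}; _ : equivariant gmap_ffun }.

HB.instance Definition _ H K := [isSub for @gmap_ffun H K].
HB.instance Definition _ H K := [Finite of gmap H K by <:].

Definition gapp H K (f : gmap H K) : orb H -> orb K := val f.

Lemma gappE H K (f : gmap H K) (g : gT) (x : orb H) :
  gapp f (oact g x) = oact g (gapp f x).
Proof. by have /forallP/(_ g)/forallP/(_ x)/eqP := valP f. Qed.

Lemma gid_subproof H : @equivariant H H [ffun x => x].
Proof. by apply/forallP=> g; apply/forallP=> x; rewrite !ffunE. Qed.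

Definition gid H : gmap H H := GMap (gid_subproof H).

Lemma gcomp_subproof H K L (f : gmap H K) (g : gmap K L) :
  equivariant [ffun x => gapp g (gapp f x)].
Proof. by apply/forallP=> a; apply/forallP=> x; rewrite !ffunE !gappE. Qed.

(* Diagrammatic order: first f, then g. *)
Definition gcomp H K L (f : gmap H K) (g : gmap K L) : gmap H L :=
  GMap (gcomp_subproof f g).

(* (G/H)^K *)
Record fixpt H K := FixPt
  { fixpt_orb : orb H; _ : [forall k in K, oact k fixpt_orb == fixpt_orb] }.

HB.instance Definition _ H K := [isSub for @fixpt_orb H K].
HB.instance Definition _ H K := [Finite of fixpt H K by <:].

Lemma fixptP H K (x : fixpt H K) (k : gT) : k \in K -> oact k (val x) = val x.
Proof. by have /forall_inP fx := valP x; move=> /fx/eqP. Qed.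

Lemma fixmap_subproof H K L (f : gmap K L) (x : fixpt H L) :
  [forall k in K,
    oact k (oact (repr (val (gapp f (obase K)))) (val x))
      == oact (repr (val (gapp f (obase K)))) (val x)].
Proof.
apply/forall_inP => k kK; apply/eqP; set g := repr _.
have gE : oact g (obase L) = gapp f (obase K) by exact: oact_repr.
have /oact_base_in kL : oact g (obase L) = oact (k * g)%g (obase L).
  by rewrite oactM gE -gappE oact_base.
by rewrite -oactM -{2}(fixptP x kL) -oactM mulKVg.
Qed.

(* If f : G/K -> G/L sends K to gL, the induced map (G/H)^L -> (G/H)^K is
   x |-> gx; under (G/H)^K = Map_G(G/K, G/H) it is precomposition with f. *)
Definition fixmap H K L (f : gmap K L) (x : fixpt H L) : fixpt H K :=
  FixPt (fixmap_subproof f x).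

Lemma fixmapE H K L (f : gmap K L) (x : fixpt H L) (g : gT) :
  gapp f (obase K) = oact g (obase L) -> val (fixmap f x) = oact g (val x).
Proof.
move=> e /=; set a := repr _.
have /oact_base_in aL : oact a (obase L) = oact g (obase L).
  by rewrite -e; exact: oact_repr.
by rewrite -{1}(fixptP x aL) -oactM mulKVg.
Qed.

Lemma fixmap_id H K (x : fixpt H K) : fixmap (gid K) x = x.
Proof.
apply: val_inj; rewrite (@fixmapE _ _ _ _ _ 1%g) ?oact1 //.
by rewrite /gapp /= ffunE.
Qed.

Lemma fixmap_comp H K L M (f : gmap K L) (g : gmap L M) (x : fixpt H M) :
  fixmap (gcomp f g) x = fixmap f (fixmap g x).
Proof.
apply: val_inj.
pose a := repr (val (gapp f (obase K))); pose b := repr (val (gapp g (obase L))).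
rewrite (@fixmapE _ _ _ _ _ (a * b)%g); first by rewrite oactM.
rewrite {1}/gapp /= ffunE -[gapp f _]oact_repr -/a gappE oactM.
by rewrite -[gapp g _]oact_repr -/b.
Qed.

Definition conj_invariant (n : {group gT} -> int) : Prop :=
  forall H (g : gT), n (H :^ g)%G = n H.

Definition supported_on F (n : {group gT} -> int) : Prop :=
  forall H, H \notin F -> n H = -1.

(* (H) <= (K); note that H :^ g is g^-1 H g. *)
Definition subconj H K : Prop := exists g : gT, (H :^ g)%g \subset K.

Definition monotone (n : {group gT} -> int) : Prop :=
  forall H K, subconj H K -> n K <= n H.

End OrbitCategory.

Definition is_PID (R : idomainType) : Prop :=
  forall I : R -> Prop,
    I 0 -> (forall x y, I x -> I y -> I (x + y)) ->
    (forall a x, I x -> I (a * x)) ->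
  exists a, forall x, I x <-> exists r, x = r * a.

(* ker g / (im f \cap ker g) for A --f--> B --g--> C *)
Section Homology.

Variables (R : comNzRingType) (A B C : lmodType R).
Variables (f : {linear A -> B}) (g : {linear B -> C}).

Definition cycle_pred : {pred B} := fun x => g x == 0.

Lemma cycle_submod : submod_closed cycle_pred.
Proof.
split=> [|a x y]; rewrite !unfold_in ?linear0 // => /eqP gx /eqP gy.
by rewrite linearP gx gy scaler0 addr0.
Qed.

HB.instance Definition _ := GRing.isSubmodClosed.Build R B cycle_pred
  cycle_submod.

Record cycles := Cycle { cycle_val :> B; _ : cycle_val \in cycle_pred }.

HB.instance Definition _ := [isSub for cycle_val].
HB.instance Definition _ := [Choice of cycles by <:].
HB.instance Definition _ := [SubChoice_isSubLmodule of cycles by <:].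

Definition boundary : {pred cycles} := fun z => `[< exists a, f a = val z >].

Lemma boundary_zmod : zmod_closed boundary.
Proof.
split=> [|x y]; first by apply/asboolP; exists 0; rewrite !linear0.
move=> /asboolP[a ax] /asboolP[b bx]; apply/asboolP; exists (a - b).
by rewrite !linearB /= ax bx.
Qed.

HB.instance Definition _ := GRing.isZmodClosed.Build cycles boundary
  boundary_zmod.

Definition homology := Quotient.quot boundary.

HB.instance Definition _ := GRing.Zmodule.on homology.

Definition hclass (z : cycles) : homology := \pi_homology z.

Lemma hclass_eq (x y : cycles) :
  hclass x = hclass y <-> exists a, f a = val x - val y.
Proof.
split.
- by move=> /eqP; rewrite eqmodE => /asboolP[a]; exists a.
- by move=> [a e]; apply/eqP; rewrite eqmodE; apply/asboolP; exists a.
Qed.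

Lemma hclass_repr (u : homology) : hclass (generic_quotient.repr u) = u.
Proof. exact: reprK. Qed.

Lemma hclassD (x y : cycles) : hclass (x + y) = hclass x + hclass y.
Proof. exact: raddfD. Qed.

Definition hscale (r : R) (u : homology) : homology :=
  hclass (r *: generic_quotient.repr u).

Lemma hscaleE r z : hscale r (hclass z) = hclass (r *: z).
Proof.
have /hclass_eq[a e] := hclass_repr (hclass z).
by apply/hclass_eq; exists (r *: a); rewrite linearZ /= e scalerBr.
Qed.

Fact hscaleA a b u : hscale a (hscale b u) = hscale (a * b) u.
Proof. by rewrite -[u]hclass_repr !hscaleE scalerA. Qed.

Fact hscale1 : left_id 1 hscale.
Proof. by move=> u; rewrite -[u]hclass_repr hscaleE scale1r. Qed.

Fact hscaleDr : right_distributive hscale +%R.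
Proof.
move=> a u v; rewrite -[u]hclass_repr -[v]hclass_repr.
by rewrite -hclassD !hscaleE scalerDr hclassD.
Qed.

Fact hscaleDl u : {morph hscale^~ u : a b / a + b}.
Proof.
by move=> a b; rewrite -[u]hclass_repr !hscaleE scalerDl hclassD.
Qed.

HB.instance Definition _ := GRing.Zmodule_isLmodule.Build R homology
  hscaleA hscale1 hscaleDr hscaleDl.

End Homology.

Section Modules.

Variable R : comNzRingType.

Definition mod_zero (V : lmodType R) : Prop := forall v : V, v = 0.

Definition mod_iso (V W : lmodType R) : Prop :=
  exists f : {linear V -> W}, bijective f.

(* Non-negatively graded; cx_d i is the differential from degree i.+1 to
   degree i. *)
Record rcomplex := RComplex {
  cx :> nat -> lmodType R;
  cx_d : forall i, {linear cx i.+1 -> cx i};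
  cx_dd : forall i (x : cx i.+2), cx_d i (cx_d i.+1 x) = 0 }.

Definition cx_out (C : rcomplex) (i : nat) : {linear C i -> C i.-1} :=
  match i return {linear C i -> C i.-1} with
  | 0%N => \0
  | j.+1 => @cx_d C j
  end.

Definition hml (C : rcomplex) (i : nat) : lmodType R :=
  homology (@cx_d C i) (cx_out C i).

Record rcmap (C D : rcomplex) := RCMap {
  cm :> forall i, {linear C i -> D i};
  cm_d : forall i (x : C i.+1), cm i (cx_d C i x) = cx_d D i (cm i.+1 x) }.

Lemma hmap_subproof (C D : rcomplex) (f : rcmap C D) i
  (z : cycles (cx_out C i)) : f i (val z) \in cycle_pred (cx_out D i).
Proof.
case: i z => [|i] [z] /=; rewrite !unfold_in //= => /eqP e.
by rewrite -cm_d e linear0.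
Qed.

Definition cycle_map (C D : rcomplex) (f : rcmap C D) i
  (z : cycles (cx_out C i)) : cycles (cx_out D i) := Cycle (hmap_subproof f z).

Definition hmap (C D : rcomplex) (f : rcmap C D) i (u : hml C i) : hml D i :=
  hclass _ (cycle_map f (generic_quotient.repr u)).

Lemma hmapE (C D : rcomplex) (f : rcmap C D) i (z : cycles (cx_out C i)) :
  hmap f (hclass _ z : hml C i) = hclass _ (cycle_map f z).
Proof.
have /hclass_eq[a e] := hclass_repr (hclass (cx_d C i) z).
by apply/hclass_eq; exists (f i.+1 a); rewrite -cm_d e linearB.
Qed.

Definition homology_iso (C D : rcomplex) (f : rcmap C D) : Prop :=
  forall i, bijective (@hmap C D f i).

End Modules.

Section DirectSum.

Variables (R : comNzRingType) (I : Type) (N : I -> lmodType R).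

Record dsum := DSum {
  dsum_fun :> forall i, N i;
  dsum_finite : finite_set [set i | dsum_fun i != 0]%classic }.

HB.instance Definition _ := gen_eqMixin dsum.
HB.instance Definition _ := gen_choiceMixin dsum.

Lemma dsumP (x y : dsum) : (forall i, x i = y i) -> x = y.
Proof.
case: x y => x fx [y fy] /= e.
have {}e : x = y by apply: functional_extensionality_dep.
by subst y; rewrite (Prop_irrelevance fx fy).
Qed.

Lemma dsum0_subproof : finite_set [set i | (0 : N i) != 0]%classic.
Proof.
by apply: (@sub_finite_set _ _ set0) => // i /=; rewrite eqxx.
Qed.

Lemma dsumD_subproof (x y : dsum) :
  finite_set [set i | x i + y i != 0]%classic.
Proof.
apply: (@sub_finite_set _ _ ([set i | x i != 0] `|` [set i | y i != 0])%classic).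
- move=> i /=; case: (eqVneq (x i) 0) => [->|]; last by left.
  by rewrite add0r; right.
- by rewrite finite_setU; split; exact: dsum_finite.
Qed.

Lemma dsumN_subproof (x : dsum) : finite_set [set i | - x i != 0]%classic.
Proof.
by apply: sub_finite_set (dsum_finite x) => i /=; rewrite oppr_eq0.
Qed.

Lemma dsumZ_subproof (a : R) (x : dsum) :
  finite_set [set i | a *: x i != 0]%classic.
Proof.
apply: sub_finite_set (dsum_finite x) => i /=.
by apply: contra_neq => ->; rewrite scaler0.
Qed.

Definition dsum0 := DSum dsum0_subproof.
Definition dsumD (x y : dsum) := DSum (dsumD_subproof x y).
Definition dsumN (x : dsum) := DSum (dsumN_subproof x).
Definition dsumZ (a : R) (x : dsum) := DSum (dsumZ_subproof a x).

Fact dsumDA : associative dsumD.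
Proof. by move=> x y z; apply: dsumP => i /=; rewrite addrA. Qed.
Fact dsumDC : commutative dsumD.
Proof. by move=> x y; apply: dsumP => i /=; rewrite addrC. Qed.
Fact dsum0D : left_id dsum0 dsumD.
Proof. by move=> x; apply: dsumP => i /=; rewrite add0r. Qed.
Fact dsumND : left_inverse dsum0 dsumN dsumD.
Proof. by move=> x; apply: dsumP => i /=; rewrite addNr. Qed.

HB.instance Definition _ := GRing.isZmodule.Build dsum
  dsumDA dsumDC dsum0D dsumND.

Fact dsumZA a b x : dsumZ a (dsumZ b x) = dsumZ (a * b) x.
Proof. by apply: dsumP => i /=; rewrite scalerA. Qed.
Fact dsumZ1 : left_id 1 dsumZ.
Proof. by move=> x; apply: dsumP => i /=; rewrite scale1r. Qed.
Fact dsumZDr : right_distributive dsumZ +%R.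
Proof. by move=> a x y; apply: dsumP => i /=; rewrite scalerDr. Qed.
Fact dsumZDl x : {morph dsumZ^~ x : a b / a + b}.
Proof. by move=> a b; apply: dsumP => i /=; rewrite scalerDl. Qed.

HB.instance Definition _ := GRing.Zmodule_isLmodule.Build R dsum
  dsumZA dsumZ1 dsumZDr dsumZDl.

End DirectSum.

Section DirectSumMap.

Variables (R : comNzRingType) (I : Type) (N P : I -> lmodType R).
Variable f : forall i, {linear N i -> P i}.

Lemma dsum_map_subproof (x : dsum N) :
  finite_set [set i | f i (x i) != 0]%classic.
Proof.
apply: sub_finite_set (dsum_finite x) => i /=.
by apply: contra_neq => ->; rewrite linear0.
Qed.

Definition dsum_map (x : dsum N) : dsum P := DSum (dsum_map_subproof x).

Fact dsum_map_linear : linear dsum_map.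
Proof. by move=> a x y; apply: dsumP => i; rewrite /= linearP. Qed.

HB.instance Definition _ := GRing.isLinear.Build R (dsum N) (dsum P) _ dsum_map
  dsum_map_linear.

End DirectSumMap.

Section PairMap.

Variables (R : comNzRingType) (V1 V2 W1 W2 : lmodType R).
Variables (f1 : {linear V1 -> W1}) (f2 : {linear V2 -> W2}).

Definition pair_map (x : (V1 * V2)%type) : (W1 * W2)%type := (f1 x.1, f2 x.2).

Fact pair_map_linear : linear pair_map.
Proof. by move=> a x y; rewrite /pair_map /= !linearP. Qed.

HB.instance Definition _ := GRing.isLinear.Build R (V1 * V2)%type (W1 * W2)%type
  _ pair_map pair_map_linear.

End PairMap.

Section Pushforward.

Variables (R : comNzRingType) (X Y : finType) (h : X -> Y).

(* {ffun X -> R^o} is the free module R[X]; R[h] sends the basis element x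
   to the basis element h x. *)
Definition pushforward (a : {ffun X -> R^o}) : {ffun Y -> R^o} :=
  [ffun y => \sum_(x | h x == y) a x].

Fact pushforward_linear : linear pushforward.
Proof.
move=> r a b; apply/ffunP => y; rewrite !ffunE scaler_sumr -big_split /=.
by apply: eq_bigr => x _; rewrite !ffunE.
Qed.

HB.instance Definition _ := GRing.isLinear.Build R {ffun X -> R^o}
  {ffun Y -> R^o} _ pushforward pushforward_linear.

End Pushforward.

Lemma pushforward_id (R : comNzRingType) (X : finType) (h : X -> X)
  (a : {ffun X -> R^o}) : h =1 id -> pushforward h a = a.
Proof.
by move=> e; apply/ffunP => y; rewrite ffunE (big_pred1 y) // => x; rewrite e.
Qed.

Lemma pushforward_comp (R : comNzRingType) (X Y Z : finType)
  (h : X -> Y) (k : Y -> Z) (l : X -> Z) (a : {ffun X -> R^o}) :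
  l =1 k \o h -> pushforward l a = pushforward k (pushforward h a).
Proof.
move=> e; apply/ffunP => z; rewrite !ffunE.
rewrite (partition_big h (fun y => k y == z)) => [/=|x]; last by rewrite e.
apply: eq_bigr => y /eqP ky; rewrite ffunE; apply: eq_bigl => x.
by rewrite e /=; case: (h x =P y) => [->|]; rewrite ?andbF // ky eqxx.
Qed.

Section RGammaModules.

Variables (gT : finGroupType) (R : comNzRingType) (F : {set {group gT}}).

(* The object G/K of the orbit category is represented by K. *)
Record orbit_obj := OrbitObj { obj_grp :> {group gT}; _ : obj_grp \in F }.

HB.instance Definition _ := [isSub for obj_grp].
HB.instance Definition _ := [Finite of orbit_obj by <:].

Implicit Types K L : orbit_obj.

Record rgmod := RGMod {
  rg_ob :> orbit_obj -> lmodType R;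
  rg_res : forall K L, gmap K L -> {linear rg_ob L -> rg_ob K};
  rg_res_id : forall K (x : rg_ob K), rg_res (gid K) x = x;
  rg_res_comp : forall (K L M : orbit_obj) (f : gmap K L) (g : gmap L M) (x : rg_ob M),
    rg_res (gcomp f g : gmap K M) x = rg_res f (rg_res g x) }.

Record rghom (M N : rgmod) := RGHom {
  rg_map :> forall K, {linear M K -> N K};
  rg_nat : forall K L (f : gmap K L) (x : M L),
    rg_map K (rg_res M f x) = rg_res N f (rg_map L x) }.

Definition rg_iso (M N : rgmod) : Prop :=
  exists f : rghom M N, forall K, bijective (f K).

Definition rg_zero (M : rgmod) : Prop := forall K, mod_zero (M K).

Definition rg_const : rgmod.
Proof.
by apply: (@RGMod (fun=> R^o) (fun K L _ => idfun)).
Defined.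

(* R[G/H^?] *)
Definition rg_orb (H : orbit_obj) : rgmod.
Proof.
apply: (@RGMod (fun K => {ffun fixpt H K -> R^o})
  (fun K L (f : gmap K L) => @pushforward R (fixpt H L) (fixpt H K) (fixmap f))).
- by move=> K x; apply: pushforward_id => y; exact: fixmap_id.
- by move=> K L M f g x; apply: pushforward_comp => y; exact: fixmap_comp.
Defined.

Definition rg_dsum (I : Type) (N : I -> rgmod) : rgmod.
Proof.
apply: (@RGMod (fun K => dsum (fun i => N i K))
  (fun K L (f : gmap K L) => dsum_map (fun i => rg_res (N i) f))).
- by move=> K x; apply: dsumP => i; exact: rg_res_id.
- by move=> K L M f g x; apply: dsumP => i; exact: rg_res_comp.
Defined.

Definition rg_sum2 (M N : rgmod) : rgmod.
Proof.
apply: (@RGMod (fun K => (M K * N K)%type)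
  (fun K L (f : gmap K L) => pair_map (rg_res M f) (rg_res N f))).
- by move=> K [x y]; rewrite /= /pair_map /= !rg_res_id.
- by move=> K L P f g [x y]; rewrite /= /pair_map /= !rg_res_comp.
Defined.

Definition rg_free (M : rgmod) : Prop :=
  exists (I : Type) (h : I -> orbit_obj), rg_iso M (rg_dsum (rg_orb \o h)).

Definition rg_projective (M : rgmod) : Prop :=
  exists N P : rgmod, rg_free P /\ rg_iso P (rg_sum2 M N).

(* Finitely many elements x_j of M(K_j) such that M is the only submodule
   containing them. *)
Definition rg_fg (M : rgmod) : Prop :=
  exists (m : nat) (k : 'I_m -> orbit_obj) (x : forall j, M (k j)),
    forall K (y : M K), exists c : forall j, gmap K (k j) -> R,
      y = \sum_(j < m) \sum_(f : gmap K (k j)) c j f *: rg_res M f (x j).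

Record rgcx := RGCx {
  rgc :> nat -> rgmod;
  rgc_d : forall i, rghom (rgc i.+1) (rgc i);
  rgc_dd : forall i K (x : rgc i.+2 K), rgc_d i K (rgc_d i.+1 K x) = 0 }.

Definition rgcx_finite (C : rgcx) : Prop :=
  (exists N : nat, forall i, (N <= i)%N -> rg_zero (C i)) /\
  forall i, rg_fg (C i).

Definition rgcx_free (C : rgcx) : Prop := forall i, rg_free (C i).

Definition rgcx_projective (C : rgcx) : Prop := forall i, rg_projective (C i).

Definition rgcx_at (C : rgcx) K : rcomplex R :=
  @RComplex R (fun i => C i K) (fun i => rgc_d C i K) (fun i => @rgc_dd C i K).

(* C(f) : C(L) -> C(K) *)
Definition rgcx_res (C : rgcx) K L (f : gmap K L) :
  rcmap (rgcx_at C L) (rgcx_at C K) :=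
  @RCMap R (rgcx_at C L) (rgcx_at C K) (fun i => rg_res (C i) f)
    (fun i x => esym (rg_nat (rgc_d C i) f x)).

Record rgcx_map (C D : rgcx) := RGCxMap {
  rgcm :> forall i, rghom (C i) (D i);
  rgcm_d : forall i K (x : C i.+1 K),
    rgcm i K (rgc_d C i K x) = rgc_d D i K (rgcm i.+1 K x) }.

(* s is a chain homotopy from g \o f to the identity. *)
Definition homotopic_id (C D : rgcx) (f : rgcx_map C D) (g : rgcx_map D C) :
  Prop :=
  exists s : forall i, rghom (C i) (C i.+1), forall K,
    (forall x : C 0%N K, g 0%N K (f 0%N K x) - x = rgc_d C 0%N K (s 0%N K x)) /\
    (forall i (x : C i.+1 K), g i.+1 K (f i.+1 K x) - x =
       rgc_d C i.+1 K (s i.+1 K x) + s i K (rgc_d C i K x)).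

Definition homotopy_equivalent (C D : rgcx) : Prop :=
  exists (f : rgcx_map C D) (g : rgcx_map D C),
    homotopic_id f g /\ homotopic_id g f.

(* The value for a complex C(K) that is unbounded is junk (-1). *)
Definition dim_at (C : rgcx) K : int :=
  xget (-1) [set m | exists d : nat,
    [/\ m = d%:Z, ~ mod_zero (C d K)
      & forall e, (d < e)%N -> mod_zero (C e K)]]%classic.

Definition Dim (C : rgcx) (H : {group gT}) : int :=
  if insub H is Some K then dim_at C K else -1.

Definition is_augmentation (C : rgcx) (eps : rghom (C 0%N) rg_const) : Prop :=
  (forall K (x : C 1%N K), eps K (rgc_d C 0%N K x) = 0) /\
  (forall K, (exists i, ~ mod_zero (C i K)) -> forall r, exists x, eps K x = r).

Definition aug_ob (C : rgcx) K (i : nat) : lmodType R :=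
  match i with 0%N => R^o | j.+1 => C j K end.

Definition aug_d (C : rgcx) (eps : rghom (C 0%N) rg_const) K (i : nat) :
  {linear aug_ob C K i.+1 -> aug_ob C K i} :=
  match i with 0%N => eps K | j.+1 => rgc_d C j K end.

Lemma aug_dd (C : rgcx) (eps : rghom (C 0%N) rg_const)
  (epsP : is_augmentation eps) K i (x : aug_ob C K i.+2) :
  aug_d eps K i (aug_d eps K i.+1 x) = 0.
Proof.
by case: i x => [|i] x; [exact: (proj1 epsP) | exact: rgc_dd].
Qed.

(* The augmented complex, shifted up by one: R sits in degree 0 and C_i in
   degree i.+1, so hml (augmented K) i is reduced homology in degree i - 1. *)
Definition augmented (C : rgcx) (eps : rghom (C 0%N) rg_const)
  (epsP : is_augmentation eps) K : rcomplex R :=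
  RComplex (aug_dd epsP (K := K)).

Definition homology_sphere (n : {group gT} -> int) (C : rgcx) : Prop :=
  supported_on F n /\
  exists (eps : rghom (C 0%N) rg_const) (epsP : is_augmentation eps),
    forall K, -1 <= n K /\
      forall i : nat,
        (i%:Z - 1 = n K -> mod_iso (hml (augmented epsP K) i) R^o) /\
        (i%:Z - 1 <> n K -> mod_zero (hml (augmented epsP K) i)).

Definition algebraic_homotopy_representation (n : {group gT} -> int)
  (C : rgcx) : Prop :=
  [/\ rgcx_finite C /\ rgcx_projective C,
      homology_sphere n C,
      monotone n,
      forall (K L : orbit_obj) (f : gmap K L),
        n L = n K -> homology_iso (rgcx_res C f)
    & forall K L M : {group gT}, K \in F -> L \in F -> M \in F ->
        K \subset L -> K \subset M ->
        n K = n L -> n K = n M -> -1 < n K ->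
        (L <*> M)%G \in F /\ n (L <*> M)%G = n K].

End RGammaModules.

(* Main.v *)
(* Maps between free modules R[X^?], X a finite G-set, are the G-equivariant
   matrices that do not shrink isotropy groups, so up to isomorphism C is one
   such matrix d on a graded finite G-set of cells.

   If C is an algebraic homotopy representation, take a cell of degree larger
   than n(H), H its isotropy group, with H maximal and then the degree maximal.
   By (ii) and (iii) the values of C at the groups K > H with n(K) = n(H) form a
   Mayer-Vietoris system, so that the type-H part of d in this degree is
   injective with torsion-free cokernel.  As R is a PID it has an equivariant
   left inverse, and these cells can be moved two degrees down.  In degree 1,
   where n(H) = 0, there is no room below, and the complement of the image has
   to be free: it is zero if some K > H has n(K) = 0.  Otherwise a rank count
   gives |N(H)/H| <= 2, and over R[N(H)/H], which is R or R[C_2], the complement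
   is given by the basis of H_0 or is free by a determinant argument.

   Conversely, if n = Dim D, there are no boundaries in the top degree of D(K),
   so that the generators of top homology are honest vectors, which can be
   compared at different subgroups.  This makes D(L) -> D(K) an isomorphism on
   homology when n(L) = n(K), and a cell in the support of the generator at K is
   then fixed by L and M, hence by their join. *)
From HB Require Import structures.
Require Import Defs.
From mathcomp Require Import boolp classical_sets functions cardinality.
From mathcomp Require Import all_boot all_order all_algebra all_fingroup.
From mathcomp Require Import ring zify.

Set Implicit Arguments.
Unset Strict Implicit.
Unset Printing Implicit Defensive.

Import Order.TTheory GRing.Theory Num.Theory.

Local Open Scope ring_scope.

(** * Linear algebra *)

(** The complement of the image of the offending cells is in general only stably free over
    R[N(H)/H], so these cells cannot simply be cancelled. Moving them is the substitute: a split
    injection A -> B with complement Q has the same homotopy type as a split surjection B -> A with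
    kernel Q, where B keeps its degree. This needs a splitting over the group ring, and R-linear
    splittings cannot be averaged; it exists because R[N(H)/H] is coinduced. Throughout the
    tightening the G-set stays the same: a move alters only the matrix and the grading, and grade 0
    marks discarded points. Chain maps and homotopies are then square matrices of one size, and each
    move reduces to identities in a noncommutative ring. Degrees only go down, so the total excess
    of the cells over n drops with each move. The homological input is not carried along the moves:
    at each stage it is read off the original complex through the homotopy equivalence. *)

Section LinearAlgebra.

(* With bordered determinants t_i = det [M; e_i] and c_j = det [N, e_j], the
   product of the bordered matrices gives (1 - N M)_ij = t_i c_j. *)
Lemma rank_one_complement (K : comNzRingType) a b (M : 'M[K]_(a, b))
  (N : 'M_(b, a)) :
  b = (a + 1)%N -> M *m N = 1%:M ->
  exists (t : 'cV_b) (c : 'rV_b),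
    1%:M - N *m M = t *m c /\ c *m t = 1%:M.
Proof.
move=> ab; subst b; move=> MN.
pose t i := \det (col_mx M (delta_mx 0 i : 'rV_(a + 1))).
pose c j := \det (row_mx N (delta_mx j 0 : 'cV_(a + 1))).
have tc i j : (1%:M - N *m M) i j = t i * c j.
  rewrite /t /c -det_mulmx mul_col_row MN.
  set u := M *m delta_mx j 0; set v := 'e_i *m N; set w := 'e_i *m delta_mx j 0.
  have -> : block_mx 1%:M u v w
      = block_mx 1%:M 0 v 1%:M *m block_mx 1%:M u 0 (w - v *m u).
    rewrite mulmx_block !mulmx0 !mul0mx !mulmx1 !mul1mx !addr0.
    by rewrite addrC subrK.
  rewrite det_mulmx det_lblock det_ublock !det1 !mul1r det_mx11.
  rewrite /u /v /w mulmxA -(mulmxA _ N) -mulmxBl -colE -rowE !mxE eqxx /=.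
  by rewrite eq_sym.
exists (\col_i t i), (\row_j c j); split.
  by apply/matrixP=> i j; rewrite tc !mxE big_ord1 !mxE.
apply/matrixP=> i j; rewrite !ord1 !mxE eqxx /=.
under eq_bigr => k _ do rewrite !mxE mulrC -tc.
(* [c *m t] is the trace of [1 - N M]; since [N M] has the same trace as [M N = 1], this is b - a =
   1. *)
have -> : \sum_k (1%:M - N *m M) k k = \tr (1%:M - N *m M) by [].
by rewrite raddfB /= mxtrace_mulC MN !mxtrace1 natrD addrAC subrr add0r.
Qed.

(** The values [v *m w] form an ideal, generated by some [g], and [v] is [g] times a vector [f].
    Purity makes [f] a multiple of [v], say by [c], and cancelling a nonzero entry of [v] gives
    [g * c = 1]. *)
Lemma PID_unimodular (R : idomainType) b (v : 'rV[R]_b) :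
  is_PID R -> v != 0 ->
  (forall (r : R) (x : 'rV_b) c, r != 0 -> r *: x = c *: v ->
     exists c', x = c' *: v) ->
  exists w : 'cV_b, v *m w = 1%:M.
Proof.
move=> pid v0 pure.
have [|||g gP] := pid (fun r => exists w : 'cV_b, v *m w = r%:M).
- by exists 0; rewrite mulmx0 raddf0.
- by move=> x y [w wP] [z zP]; exists (w + z); rewrite mulmxDr wP zP raddfD.
- by move=> a x [w wP]; exists (a *: w); rewrite -scalemxAr wP scale_scalar_mx.
have gv j : exists r, v 0 j = r * g.
  apply/gP; exists (delta_mx j 0); rewrite -colE.
  by apply/matrixP => i k; rewrite !ord1 !mxE eqxx.
have [f fP] := choice gv.
have g0 : g != 0.
  apply: contra_neq v0 => g0; apply/rowP => j.
  by rewrite fP g0 mulr0 mxE.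
have [|c cP] := pure g (\row_j f j) 1 g0.
  by rewrite scale1r; apply/rowP => j; rewrite !mxE fP mulrC.
have [w wP] : exists w : 'cV_b, v *m w = g%:M by apply/gP; exists 1; rewrite mul1r.
have cg : g * c = 1.
  have [k vk] : exists k, v 0 k != 0.
    by apply/existsP; apply: contra_neqT v0 => /existsPn n; apply/rowP => j;
       rewrite mxE; apply/eqP; rewrite -[_ == _]negbK n.
  apply: (mulIf vk); rewrite mul1r {2}fP -mulrA.
  by move/rowP/(_ k): cP; rewrite !mxE => <-; rewrite mulrC.
exists (c *: w); rewrite -scalemxAr wP scale_scalar_mx.
by rewrite mulrC cg.
Qed.

(** Induction on the number of rows. The first row [v] takes the value 1 at some [w]; subtracting
    multiples of [v] from the other rows makes them vanish at [w], and the new rows are again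
    injective and pure. *)
Lemma PID_left_inverse (R : idomainType) a b (M : 'M[R]_(a, b)) :
  is_PID R ->
  (forall u : 'rV_a, u *m M = 0 -> u = 0) ->
  (forall (c : R) (v : 'rV_b) (u : 'rV_a), c != 0 -> c *: v = u *m M ->
     exists u' : 'rV_a, v = u' *m M) ->
  exists N : 'M_(b, a), M *m N = 1%:M.
Proof.
move=> pid; elim: a M => [|a IH] M inj pure.
  by exists 0; apply/matrixP; case.
rewrite -[a.+1]/(1 + a)%N in M inj pure *.
pose v := usubmx M; pose T := dsubmx M.
have MvT : M = col_mx v T by rewrite vsubmxK.
have v0 : v != 0.
  apply/eqP => v0; have := inj (row_mx 1%:M 0).
  rewrite MvT mul_row_col v0 mulmx0 mul0mx addr0 => /(_ erefl).
  rewrite -[RHS](@row_mx0 _ 1 1 a) => /eq_row_mx [] /matrixP/(_ 0 0).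
  by rewrite !mxE => /eqP; rewrite oner_eq0.
have [|w wP] := PID_unimodular pid v0.
  move=> r x c r0 e.
  have [|u' xE] := pure r x (row_mx c%:M 0) r0.
    by rewrite e MvT mul_row_col mul0mx addr0 mul_scalar_mx.
  have /inj : (r *: u' - row_mx c%:M 0) *m M = 0.
    rewrite mulmxBl -scalemxAl -xE e MvT mul_row_col mul0mx addr0.
    by rewrite mul_scalar_mx subrr.
  rewrite -[u']hsubmxK scale_row_mx opp_row_mx add_row_mx.
  rewrite -[RHS](@row_mx0 _ 1 1 a) => /eq_row_mx [_].
  rewrite subr0 => /eqP; rewrite scalemx_eq0 (negPf r0) /= => /eqP u0.
  exists (lsubmx u' 0 0).
  rewrite xE -[u' in LHS]hsubmxK u0 MvT mul_row_col mul0mx addr0.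
  by rewrite [lsubmx _]mx11_scalar mul_scalar_mx !mxE.
pose T' := T - T *m w *m v.
have T'w : T' *m w = 0 by rewrite mulmxBl -(mulmxA _ v) wP mulmx1 subrr.
have T'E (u : 'rV_a) : u *m T' = row_mx (- (u *m T *m w)) u *m M.
  by rewrite MvT mul_row_col mulmxBr mulNmx !mulmxA addrC.
have [||N NP] := IH T'.
- move=> u; rewrite T'E => /inj.
  by rewrite -[RHS](@row_mx0 _ 1 1 a) => /eq_row_mx [].
- move=> c x u c0 e; rewrite T'E in e.
  have [u' xE] := pure _ _ _ c0 e.
  have xw : x *m w = 0.
    apply/eqP; have /eqP : c *: (x *m w) = 0.
      by rewrite scalemxAl e -T'E -mulmxA T'w mulmx0.
    by rewrite scalemx_eq0 (negPf c0).
  exists (rsubmx u'); rewrite T'E [in LHS]xE; congr (_ *m _).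
  rewrite -[LHS]hsubmxK; congr row_mx.
  move: xw; rewrite xE -[u']hsubmxK MvT mul_row_col mulmxDl -mulmxA wP mulmx1.
  by rewrite row_mxKr row_mxKl => /eqP; rewrite addr_eq0 => /eqP.
(* [N] inverts only the corrected rows [T']. This change makes [v] vanish on [Q], and then
   [T *m Q = T' *m N = 1]. *)
pose Q := N - w *m v *m N.
have vQ : v *m Q = 0 by rewrite mulmxBr !mulmxA wP mul1mx subrr.
have TQ : T *m Q = 1%:M by rewrite mulmxBr !mulmxA -mulmxBl.
exists (row_mx (w - Q *m (T *m w)) Q).
rewrite {1}MvT mul_col_row !mulmxBr !mulmxA vQ TQ mul0mx mul0mx subr0 wP.
by rewrite !mul1mx !subrr -mulmxBl NP -scalar_mx_block.
Qed.

End LinearAlgebra.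

(* The group ring R[C_2]: the pair (a, b) stands for a + b s with s ^ 2 = 1. *)
Section GroupRingC2.

Variable R : comNzRingType.

(** A new name for the pairs, which already carry the componentwise product as a ring. *)
Definition gring2 : Type := (R * R)%type.

HB.instance Definition _ := GRing.Zmodule.on gring2.

Definition gring2_mul (x y : gring2) : gring2 :=
  (x.1 * y.1 + x.2 * y.2, x.1 * y.2 + x.2 * y.1).

Fact gring2_mulA : associative gring2_mul.
Proof. by move=> [a b] [c d] [e f]; rewrite /gring2_mul /=; congr pair; ring. Qed.
Fact gring2_mulC : commutative gring2_mul.
Proof. by move=> [a b] [c d]; rewrite /gring2_mul /=; congr pair; ring. Qed.
Fact gring2_mul1 : left_id ((1, 0) : gring2) gring2_mul.
Proof. by move=> [a b]; rewrite /gring2_mul /=; congr pair; ring. Qed.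
Fact gring2_mulD : left_distributive gring2_mul +%R.
Proof.
by move=> [a b] [c d] [e f]; rewrite /gring2_mul /=; congr pair => /=; ring.
Qed.
Fact gring2_1neq0 : ((1, 0) : gring2) != 0.
Proof. by apply/eqP => -[/eqP]; rewrite oner_eq0. Qed.

HB.instance Definition _ := GRing.Zmodule_isComNzRing.Build gring2
  gring2_mulA gring2_mulC gring2_mul1 gring2_mulD gring2_1neq0.

End GroupRingC2.

(** * Homology and homotopy equivalences *)

Section Hom.

Variables (gT : finGroupType) (R : comNzRingType) (F : {set {group gT}}).
Implicit Types (M N P : rgmod R F).

Definition rg_comp M N P (f : rghom M N) (g : rghom N P) : rghom M P.
Proof.
by exists (fun K => g K \o f K) => K L h x /=; rewrite !rg_nat.
Defined.

Definition rg_add M N (f g : rghom M N) : rghom M N.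
Proof.
by exists (fun K => f K \+ g K) => K L h x /=; rewrite !rg_nat linearD.
Defined.

Lemma rg_inverse M N (f : rghom M N) : (forall K, bijective (f K)) ->
  exists g : rghom N M, (forall K, cancel (f K) (g K)) /\
                        (forall K, cancel (g K) (f K)).
Proof.
move=> fb.
have gP K : exists g : {linear N K -> M K}, cancel (f K) g /\ cancel g (f K).
  have [g fK gK] := fb K.
  have lin : linear g.
    by move=> a x y; apply: (can_inj fK); rewrite linearP !gK.
  pose gl : {linear N K -> M K} :=
    HB.pack g (GRing.isLinear.Build R (N K) (M K) _ g lin).
  by exists gl.
pose g K := sval (cid (gP K)).
have gK K : cancel (f K) (g K) /\ cancel (g K) (f K) := svalP (cid (gP K)).
have nat (K L : orbit_obj F) (h : gmap K L) (x : N L) :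
    g K (rg_res N h x) = rg_res M h (g L x).
  apply: (can_inj (proj1 (gK K))).
  by rewrite rg_nat !(proj2 (gK _)).
exists (RGHom nat); split=> K; [exact: (gK K).1|exact: (gK K).2].
Qed.

Lemma rg_iso_sym M N : rg_iso M N -> rg_iso N M.
Proof.
case=> f /rg_inverse[g [fK gK]]; exists g => K.
exact: Bijective (gK K) (fK K).
Qed.

Lemma rg_iso_trans M N P : rg_iso M N -> rg_iso N P -> rg_iso M P.
Proof.
move=> [f fb] [g gb]; exists (rg_comp f g) => K /=.
exact: bij_comp (gb K) (fb K).
Qed.

End Hom.

Section HomotopyEquivalence.

Variables (gT : finGroupType) (R : comNzRingType) (F : {set {group gT}}).
Implicit Types (C D E : rgcx R F).

Lemma homotopy_equivalent_sym C D :
  homotopy_equivalent C D -> homotopy_equivalent D C.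
Proof. by move=> [f [g [fg gf]]]; exists g, f. Qed.

Definition cx_comp C D E (f : rgcx_map C D) (g : rgcx_map D E) : rgcx_map C E.
Proof.
exists (fun i => rg_comp (f i) (g i)) => i K x /=.
by rewrite !rgcm_d.
Defined.

Lemma homotopic_id_comp C D E (f : rgcx_map C D) (g : rgcx_map D C)
  (f' : rgcx_map D E) (g' : rgcx_map E D) :
  homotopic_id f g -> homotopic_id f' g' ->
  homotopic_id (cx_comp f f') (cx_comp g' g).
Proof.
move=> [s sP] [t tP].
exists (fun i => rg_add (rg_comp (f i) (rg_comp (t i) (g i.+1))) (s i)) => K.
have [s0 s1] := sP K; have [t0 t1] := tP K.
split=> [x|i x] /=.
  rewrite -[_ (g' _ _ _)](subrK (g 0%N K (f 0%N K x))) -linearB /= t0.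
  by rewrite rgcm_d -addrA s0 linearD.
rewrite -[_ (g' _ _ _)](subrK (g i.+1 K (f i.+1 K x))) -linearB /= t1.
rewrite linearD /= -!rgcm_d -addrA s1 linearD /= !addrA.
by congr (_ + _); rewrite !rgcm_d addrAC.
Qed.

Lemma homotopy_equivalent_trans C D E : homotopy_equivalent C D ->
  homotopy_equivalent D E -> homotopy_equivalent C E.
Proof.
move=> [f [g [fg gf]]] [f' [g' [fg' gf']]].
exists (cx_comp f f'), (cx_comp g' g).
by split; apply: homotopic_id_comp.
Qed.

Definition is_cycle C i K (x : C i K) : Prop :=
  cx_out (rgcx_at C K) i x = 0.

Lemma cycleD C i K (x y : C i K) :
  is_cycle x -> is_cycle y -> is_cycle (x + y).
Proof. by rewrite /is_cycle linearD => -> ->; rewrite addr0. Qed.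

Lemma cycleZ C i K a (x : C i K) : is_cycle x -> is_cycle (a *: x).
Proof. by rewrite /is_cycle linearZ => -> /=; rewrite scaler0. Qed.

Lemma cycle_cm C D (f : rgcx_map C D) i K (x : C i K) :
  is_cycle x -> is_cycle (f i K x).
Proof.
rewrite /is_cycle; case: i x => [|i] x //= e.
by rewrite -rgcm_d e linear0.
Qed.

Lemma cycle_res C i (K L : orbit_obj F) (h : gmap K L) (x : C i L) :
  is_cycle x -> is_cycle (rg_res (C i) h x).
Proof.
rewrite /is_cycle; case: i x => [|i] x //= e.
by rewrite rg_nat e linear0.
Qed.

Lemma homotopic_cycle C D (f : rgcx_map C D) (g : rgcx_map D C) i K (x : C i K) :
  homotopic_id f g -> is_cycle x ->
  exists w : C i.+1 K, g i K (f i K x) = x + rgc_d C i K w.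
Proof.
move=> [s sP]; have [s0 s1] := sP K.
rewrite /is_cycle; case: i x => [|i] x /= e.
  by exists (s 0%N K x); rewrite -s0 addrC subrK.
by exists (s i.+1 K x); rewrite -[rgc_d C _ K _]addr0 -(linear0 (s i K)) -e
  -s1 addrC subrK.
Qed.

(** Injectivity in homology, and below surjectivity, in terms of chains: in this form they pass
    along homotopy equivalences, and later to row vectors, without quotients. *)
Definition res_homology_inj C (K L : orbit_obj F) (h : gmap K L) i : Prop :=
  forall x : C i L, is_cycle x ->
  forall w : C i.+1 K, rg_res (C i) h x = rgc_d C i K w ->
  exists w' : C i.+1 L, x = rgc_d C i L w'.

Definition res_homology_surj C (K L : orbit_obj F) (h : gmap K L) i : Prop :=
  forall y : C i K, is_cycle y ->
  exists (x : C i L) (w : C i.+1 K),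
    is_cycle x /\ y = rg_res (C i) h x + rgc_d C i K w.

Lemma homology_iso_res C (K L : orbit_obj F) (h : gmap K L) :
  homology_iso (rgcx_res C h) <->
  (forall i, res_homology_inj C h i /\ res_homology_surj C h i).
Proof.
have cycP i M (z : cycles (cx_out (rgcx_at C M) i)) : is_cycle (val z).
  by case: z => z zP; apply/eqP.
have mkc i M (x : C i M) : is_cycle x ->
    exists z : cycles (cx_out (rgcx_at C M) i), val z = x.
  by move=> /eqP xc; exists (Cycle xc).
split=> [iso i|H i].
  have [inv hK invK] := iso i.
  split=> [x xc w e|y yc].
    have [z zx] := mkc _ _ _ xc.
    have : hmap (rgcx_res C h) (hclass _ z : hml (rgcx_at C L) i) =
           hmap (rgcx_res C h) (hclass _ 0 : hml (rgcx_at C L) i).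
      rewrite !hmapE; apply/hclass_eq; exists w.
      by rewrite /= zx linear0 subr0 -e.
    move=> /(can_inj hK)/hclass_eq[w']; rewrite zx /= subr0 => <-.
    by exists w'.
  have [z zy] := mkc _ _ _ yc.
  pose u := inv (hclass _ z).
  have := invK (hclass _ z).
  rewrite -/u -[u]hclass_repr hmapE => /hclass_eq[w].
  move: (generic_quotient.repr u) => t /= e.
  exists (val t), (- w); split; first exact: cycP.
  by rewrite linearN /= e zy opprB addrC subrK.
have [inj surj] := H i.
suff [f fK] : exists f : hml (rgcx_at C K) i -> hml (rgcx_at C L) i,
    cancel f (@hmap _ _ _ (rgcx_res C h) i).
  exists f => //; move=> u.
  have : injective (@hmap _ _ _ (rgcx_res C h) i).
    move=> {}u v; rewrite -[u]hclass_repr -[v]hclass_repr !hmapE.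
    move=> /hclass_eq[w]; rewrite /= -linearB /= => e.
    apply/hclass_eq.
    have [|w' e'] := inj _ _ w (esym e); last by exists w'.
    apply: cycleD; first exact: cycP.
    by rewrite -scaleN1r; apply: cycleZ; exact: cycP.
  by apply; rewrite fK.
suff H' (u : hml (rgcx_at C K) i) : exists v, hmap (rgcx_res C h) v = u.
  by have [f] := choice H'; exists f.
have [x [w [xc e]]] := surj _ (cycP _ _ (generic_quotient.repr u)).
have [z zx] := mkc _ _ _ xc.
exists (hclass _ z : hml (rgcx_at C L) i); rewrite hmapE -[u]hclass_repr.
apply/hclass_eq; exists (- w).
by rewrite /= zx linearN /= e opprD addNKr.
Qed.

Lemma res_homology_inj_he C D (K L : orbit_obj F) (h : gmap K L) i :
  homotopy_equivalent C D -> res_homology_inj C h i -> res_homology_inj D h i.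
Proof.
move=> [f [g [fg gf]]] inj x xc w e.
have [|w' e'] := inj _ (cycle_cm g xc) (g i.+1 K w).
  by rewrite -rg_nat e rgcm_d.
have [t tP] := homotopic_cycle gf xc.
exists (f i.+1 L w' - t); rewrite linearB /= -rgcm_d -e' tP.
by rewrite addrK.
Qed.

Lemma res_homology_surj_he C D (K L : orbit_obj F) (h : gmap K L) i :
  homotopy_equivalent C D -> res_homology_surj C h i -> res_homology_surj D h i.
Proof.
move=> [f [g [fg gf]]] surj y yc.
have [x [w [xc e]]] := surj _ (cycle_cm g yc).
have [t tP] := homotopic_cycle gf yc.
exists (f i L x), (f i.+1 K w - t); split; first exact: cycle_cm.
rewrite linearB /= -rgcm_d -rg_nat addrA -linearD -e tP.
by rewrite addrK.
Qed.

End HomotopyEquivalence.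

Section HomologyClasses.

Variables (R : comNzRingType) (A B C : lmodType R).
Variables (f : {linear A -> B}) (g : {linear B -> C}).

Lemma homology_zeroP : mod_zero (homology f g) ->
  forall z, g z = 0 -> exists a, f a = z.
Proof.
move=> H z /eqP gz.
have : hclass f (Cycle (gz : z \in cycle_pred g)) = hclass f 0.
  by rewrite [LHS]H [RHS]H.
by move=> /hclass_eq[a]; rewrite subr0; exists a.
Qed.

Lemma homology_freeP : mod_iso (homology f g) R^o ->
  exists u, [/\ g u = 0, forall z, g z = 0 -> exists r a, z = r *: u + f a
                & forall r a, r *: u = f a -> r = 0].
Proof.
move=> [p [q pK qK]].
pose t : cycles g := generic_quotient.repr (q 1).
have pt : p (hclass f t) = 1 by rewrite hclass_repr qK.
have ptr r : p (hclass f (r *: t)) = r.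
  have -> : hclass f (r *: t) = r *: (hclass f t : homology f g).
    by rewrite -[RHS]/(hscale _ _) hscaleE.
  by rewrite linearZ /= pt; exact: mulr1.
exists (val t); split.
- by apply/eqP; case: (t).
- move=> z /eqP gz; pose c := Cycle (gz : z \in cycle_pred g).
  exists (p (hclass f c)).
  have : hclass f c = hclass f ((p (hclass f c) : R) *: t) by apply: (can_inj pK); rewrite ptr.
  by move=> /hclass_eq[a e]; exists a; rewrite e addrC subrK.
- move=> r a e; rewrite -[r]ptr -[RHS]ptr; congr (p _); apply/hclass_eq.
  by exists a; rewrite -e scale0r subr0.
Qed.

End HomologyClasses.

Section Spheres.

Variables (gT : finGroupType) (R : idomainType) (F : {set {group gT}}).
Variable n : {group gT} -> int.
Implicit Types (C D : rgcx R F) (K L : orbit_obj F).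

Definition aug_cycle C (eps : rghom (C 0%N) (rg_const R F)) K i (x : C i K) :=
  aug_d eps K i x = 0.

(** The first clause is the vanishing of reduced homology in degree -1, that is, surjectivity of the
    augmentation for [n K >= 0]; the other two treat the degrees from 0 on. *)
Definition sphere_at C (eps : rghom (C 0%N) (rg_const R F)) K : Prop :=
  [/\ 0 <= n K -> exists b : C 0%N K, eps K b = 1,
      forall i (x : C i K), aug_cycle eps x -> i%:Z <> n K ->
        exists w, rgc_d C i K w = x
    & forall i, i%:Z = n K -> exists u : C i K,
        [/\ aug_cycle eps u,
            forall x : C i K, aug_cycle eps x ->
              exists a w, x = a *: u + rgc_d C i K w
          & forall a w, a *: u = rgc_d C i K w -> a = 0]].

(** This form is invariant under homotopy equivalence. Surjectivity of the augmentation wherever the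
    complex is nonzero is not: where [n K = -1], an equivalent complex can be nonzero and
    acyclic. *)
Definition sphere_like C (eps : rghom (C 0%N) (rg_const R F)) : Prop :=
  (forall K (x : C 1%N K), eps K (rgc_d C 0%N K x) = 0) /\
  forall K, sphere_at eps K.

(** If [n K = -1], reduced homology in degree -1 is R, so the augmentation is not onto at [K]; by
    the definition of an augmentation the complex then vanishes at [K]. *)
Lemma homology_sphere_like C : homology_sphere n C ->
  exists2 eps : rghom (C 0%N) (rg_const R F), sphere_like eps &
    forall K, -1 <= n K /\ (n K = -1 -> forall i, mod_zero (C i K)).
Proof.
move=> [_ [eps [epsP H]]]; exists eps; last first.
  move=> K; have [nK HK] := H K; split=> // n1 i x.
  apply: contrapT => x0.
  have Cx : exists i, ~ mod_zero (C i K) by exists i => /(_ x).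
  have [u [_ _ u0]] := homology_freeP ((HK 0%N).1 (esym n1)).
  have [b bP] := epsP.2 K Cx u.
  have /eqP : (1 : R) = 0 by apply: (u0 1 b); rewrite scale1r.
  by rewrite oner_eq0.
split; first exact: epsP.1.
move=> K; have [nK HK] := H K; split.
- move=> n0; have n1 : 0%:Z - 1 <> n K by move=> e; rewrite -e in n0.
  exact: homology_zeroP ((HK 0%N).2 n1) 1 erefl.
- move=> i x xc ni; apply: homology_zeroP ((HK i.+1).2 _) x xc.
  by rewrite -addn1 PoszD addrK.
- move=> i ni; apply: homology_freeP ((HK i.+1).1 _).
  by rewrite -addn1 PoszD addrK.
Qed.

Lemma aug_cycleP C (eps : rghom (C 0%N) (rg_const R F)) K i (x : C i K) :
  (forall K (x : C 1%N K), eps K (rgc_d C 0%N K x) = 0) ->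
  aug_cycle eps x -> is_cycle x.
Proof. by case: i x. Qed.

Lemma aug_cycleS C (eps : rghom (C 0%N) (rg_const R F)) K i (x : C i K) :
  (0 < i)%N -> is_cycle x -> aug_cycle eps x.
Proof. by case: i x. Qed.

Lemma sphere_like_he C D (f : rgcx_map C D) (g : rgcx_map D C)
  (eps : rghom (C 0%N) (rg_const R F)) :
  homotopic_id f g -> homotopic_id g f -> sphere_like eps ->
  sphere_like (rg_comp (g 0%N) eps : rghom (D 0%N) (rg_const R F)).
Proof.
move=> fg gf [epsd S].
set eps' := rg_comp _ _.
have eps'd K (x : D 1%N K) : eps' K (rgc_d D 0%N K x) = 0.
  by rewrite /eps' /= rgcm_d epsd.
have gc K i (x : D i K) : aug_cycle eps' x -> aug_cycle eps (g i K x).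
  rewrite /aug_cycle; case: i x => [|i] x //= e.
  by rewrite -rgcm_d e linear0.
have epsgf K (x : C 0%N K) : eps K (g 0%N K (f 0%N K x)) = eps K x.
  have [w ->] := homotopic_cycle fg (erefl : is_cycle x).
  by rewrite linearD /= epsd addr0.
have fc K i (x : C i K) : aug_cycle eps x -> aug_cycle eps' (f i K x).
  rewrite /aug_cycle; case: i x => [|i] x /= e.
    by rewrite epsgf.
  by rewrite -rgcm_d e linear0.
split=> // K; have [S1 S2 S3] := S K; split.
- by move=> /S1[b bP]; exists (f 0%N K b); rewrite /eps' /= epsgf.
- move=> i x xc ni; have [w wP] := S2 _ _ (gc _ _ _ xc) ni.
  have [t tP] := homotopic_cycle gf (aug_cycleP eps'd xc).
  exists (f _ K w - t); rewrite linearB /= -rgcm_d wP tP.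
  by rewrite addrK.
- move=> i ni; have [u [uc u1 u2]] := S3 _ ni.
  exists (f i K u); split; first exact: fc.
    move=> x xc; have [a [w e]] := u1 _ (gc _ _ _ xc).
    have [t tP] := homotopic_cycle gf (aug_cycleP eps'd xc).
    exists a, (f _ K w - t).
    apply: (addIr (rgc_d D i K t)); rewrite -tP e.
    by rewrite linearD linearZ linearB /= -rgcm_d -addrA subrK.
  move=> a w e.
  have [t tP] := homotopic_cycle fg (aug_cycleP epsd uc).
  apply: (u2 _ (g i.+1 K w - a *: t)).
  rewrite linearB linearZ /= -rgcm_d -e linearZ /= tP scalerDr.
  by rewrite addrK.
Qed.

Section Facts.

Variables (C : rgcx R F) (eps : rghom (C 0%N) (rg_const R F)).
Hypothesis S : sphere_like eps.

Lemma sphere_boundary K i (x : C i K) : (0 < i)%N -> i%:Z <> n K ->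
  is_cycle x -> exists w, x = rgc_d C i K w.
Proof.
move=> i0 ni xc; have [_ S2 _] := S.2 K.
by have [|w <-] := S2 i x _ ni; [exact: aug_cycleS|exists w].
Qed.

(** Each homology module is free over the domain [R]. In degree 0, where homology is unreduced, [x]
    first has to be of augmentation 0, which follows since its multiple by [a] is. *)
Lemma sphere_torsion_free K i (x : C i K) a w : a != 0 -> is_cycle x ->
  a *: x = rgc_d C i K w -> exists w', x = rgc_d C i K w'.
Proof.
move=> a0 xc e; have [_ S2 S3] := S.2 K.
have xa : aug_cycle eps x.
  case: i x w xc e => [|i] x w xc e; last exact: aug_cycleS.
  have /eqP : a * eps K x = 0 by rewrite -[LHS]/(a *: _) -linearZ /= e S.1.
  by rewrite mulf_eq0 (negPf a0) => /eqP.
have [ni|ni] := pselect (i%:Z = n K); last first.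
  by have [w' <-] := S2 _ _ xa ni; exists w'.
have [u [_ u1 u2]] := S3 _ ni.
have [b [w' xE]] := u1 _ xa.
have /u2/eqP : (a * b) *: u = rgc_d C i K (w - a *: w').
  by rewrite linearB linearZ /= -e xE scalerDr scalerA addrK.
rewrite mulf_eq0 (negPf a0) /= => /eqP b0.
by exists w'; rewrite xE b0 scale0r add0r.
Qed.

(** A chain [b] of augmentation 1 splits the unreduced H_0 of a 0-sphere into R and the reduced
    part, generated by [u]. This rank two is the origin of the bound 2 on the index of [H] in its
    normalizer. *)
Lemma sphere0_basis K : n K = 0 -> exists b u : C 0%N K,
  (forall x, exists c a w, x = c *: b + a *: u + rgc_d C 0%N K w) /\
  (forall c a w, c *: b + a *: u = rgc_d C 0%N K w -> c = 0 /\ a = 0).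
Proof.
move=> n0; have [S1 _ S3] := S.2 K.
have [b bP] : exists b, eps K b = 1 by apply: S1; rewrite n0.
have [u [uc u1 u2]] := S3 0%N (esym n0).
exists b, u; split=> [x|c a w e].
  pose c : R := eps K x.
  have [|a [w xE]] := u1 (x - c *: b).
    rewrite /aug_cycle /= linearB linearZ /= bP.
    by rewrite -[_ *: _]/(c * 1) mulr1 subrr.
  by exists c, a, w; rewrite -addrA -xE addrC subrK.
have c0 : c = 0.
  have := congr1 (eps K) e.
  rewrite linearD !linearZ /= S.1 bP uc scaler0 addr0.
  by rewrite -[_ *: _]/(c * 1) mulr1.
by split=> //; apply: (u2 a w); rewrite -e c0 scale0r add0r.
Qed.

Lemma sphere_nonzero K i : i%:Z = n K -> exists x : C i K, x <> 0.
Proof.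
have [_ _ S3] := S.2 K; move=> /S3[u [_ _ u2]]; exists u => u0.
have /eqP : 1 = 0 :> R by apply: (u2 1 0); rewrite u0 scaler0 linear0.
by rewrite oner_eq0.
Qed.

End Facts.

End Spheres.

(** * Modules of row vectors on a G-set *)

Section GSetModules.

Variables (gT : finGroupType) (R : idomainType) (F : {set {group gT}}).
Variables (N : nat) (to : {action gT &-> 'I_N}).
Implicit Types (H K L : {group gT}) (x y z : 'I_N).

(* Degree [i] is encoded as [i.+1]; the points of grade [0] are discarded. *)
Record grading := Grading
  { grade :> 'I_N -> nat; gradeJ : forall x g, grade (to x g) = grade x }.

Implicit Types (dg : grading).

(** A left action obtained from the right action [to]: the basis vector at [x] goes to the one at
    [to x g^-1]. *)
Definition vact (g : gT) (v : 'rV[R]_N) : 'rV[R]_N := \row_y v 0 (to y g).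

Lemma vact_linear g : linear (vact g).
Proof. by move=> a u v; apply/rowP => y; rewrite !mxE. Qed.

HB.instance Definition _ g :=
  GRing.isLinear.Build R 'rV[R]_N 'rV[R]_N _ (vact g) (vact_linear g).

Lemma vactM g h v : vact (g * h)%g v = vact g (vact h v).
Proof. by apply/rowP => y; rewrite !mxE actM. Qed.

Lemma vact1 v : vact 1%g v = v.
Proof. by apply/rowP => y; rewrite !mxE act1. Qed.

Section Space.

Variables (dg : grading) (i : nat) (K : {group gT}).

(** This is R[X^K], where X is the G-set of the points of degree [i]. *)
Definition xsupp : {pred 'rV[R]_N} :=
  fun v => [forall x, (v 0 x != 0) ==> (dg x == i.+1) && (K \subset 'C[x | to]%g)].

Lemma xsuppP (v : 'rV[R]_N) :
  reflect (forall x, v 0 x != 0 -> dg x = i.+1 /\ K \subset 'C[x | to]%g)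
          (v \in xsupp).
Proof.
apply: (iffP forallP) => [H x v0|H x].
  by have /implyP/(_ v0)/andP[/eqP] := H x.
by apply/implyP => /H[-> ->]; rewrite eqxx.
Qed.

Lemma xsupp0 (v : 'rV[R]_N) x : v \in xsupp ->
  ~~ ((dg x == i.+1) && (K \subset 'C[x | to]%g)) -> v 0 x = 0.
Proof.
move=> /forallP/(_ x)/implyP vP.
by apply: contraNeq.
Qed.

Lemma xsupp_submod : submod_closed xsupp.
Proof.
split=> [|a u v uP vP]; first by apply/xsuppP => x; rewrite mxE eqxx.
apply/xsuppP => x; rewrite !mxE.
have [/xsuppP uP' /xsuppP vP'] := (uP, vP).
case: (eqVneq (v 0 x) 0) => [->|/vP' //].
case: (eqVneq (u 0 x) 0) => [->|/uP' //].
by rewrite mulr0 addr0 eqxx.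
Qed.

HB.instance Definition _ := GRing.isSubmodClosed.Build R 'rV[R]_N xsupp
  xsupp_submod.

Record xsp := XSp { xval :> 'rV[R]_N; _ : xval \in xsupp }.

HB.instance Definition _ := [isSub for xval].
HB.instance Definition _ := [Choice of xsp by <:].
HB.instance Definition _ := [SubChoice_isSubLmodule of xsp by <:].

Lemma xspP (v : xsp) : xval v \in xsupp.
Proof. exact: valP v. Qed.

Lemma xval_inj : injective xval.
Proof. exact: val_inj. Qed.

End Space.

Lemma gmap_base (K L : {group gT}) (f : gmap K L) :
  exists g : gT, gapp f (obase K) = oact g (obase L).
Proof. by exists (repr (val (gapp f (obase K)))); rewrite oact_repr. Qed.

Lemma gmap_conj (K L : {group gT}) (f : gmap K L) g k :
  gapp f (obase K) = oact g (obase L) -> k \in K -> (k ^ g)%g \in L.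
Proof.
move=> e kK.
have : oact g (obase L) = oact (k * g)%g (obase L).
  by rewrite oactM -e -gappE oact_base.
by move=> /oact_base_in; rewrite conjgE.
Qed.

Lemma vact_xsupp dg i (K L : {group gT}) g v :
  (forall k, k \in K -> (k ^ g)%g \in L) ->
  v \in xsupp dg i L -> vact g v \in xsupp dg i K.
Proof.
move=> KL /xsuppP vP; apply/xsuppP => x; rewrite mxE => /vP[].
rewrite gradeJ => -> /subsetP Lx; split=> //.
apply/subsetP => k kK; have /Lx/astab1P := KL k kK.
rewrite -actM -conjgC actM => /act_inj kx.
exact/astab1P.
Qed.

Section Res.

Variables (dg : grading) (i : nat) (K L : {group gT}) (f : gmap K L).

Lemma xres_subproof (v : xsp dg i L) :
  vact (repr (val (gapp f (obase K)))) (xval v) \in xsupp dg i K.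
Proof.
apply: vact_xsupp (xspP v) => k; apply: gmap_conj.
by rewrite oact_repr.
Qed.

Definition xres (v : xsp dg i L) : xsp dg i K := XSp (xres_subproof v).

Lemma xres_linear : linear xres.
Proof. by move=> a u v; apply: val_inj; rewrite /= linearP. Qed.

HB.instance Definition _ :=
  GRing.isLinear.Build R (xsp dg i L) (xsp dg i K) _ xres xres_linear.

(** The choice of representative is immaterial, because a vector supported on [L]-fixed points is
    itself fixed by [L]. *)
Lemma xresE (v : xsp dg i L) g :
  gapp f (obase K) = oact g (obase L) -> xval (xres v) = vact g (xval v).
Proof.
move=> e /=; set a := repr _.
have /oact_base_in agL : oact a (obase L) = oact g (obase L).
  by rewrite -e; exact: oact_repr.
have -> : g = (a * (a^-1 * g))%g by rewrite mulKVg.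
rewrite vactM; congr (vact a _).
apply/rowP => x; rewrite mxE.
have [Lx|Lx] := boolP (L \subset 'C[x | to]%g).
  by have /(subsetP Lx)/astab1P -> := agL.
rewrite !(xsupp0 (xspP v)) // ?(negPf Lx) ?andbF //.
apply: contra Lx => /andP[_].
by rewrite astab1_act -sub_conjgV conjGid // groupV.
Qed.

End Res.

Definition xmod (dg : grading) (i : nat) : rgmod R F.
Proof.
apply: (@RGMod _ _ F (fun K : orbit_obj F => xsp dg i K)
  (fun (K L : orbit_obj F) (f : gmap K L) => @xres dg i K L f)).
- move=> K v; apply: val_inj; apply: (etrans (y := vact 1%g (xval v))).
    by apply: xresE; rewrite oact1 /gapp ffunE.
  exact: vact1.
- move=> K L M f g v; apply: val_inj.
  have [a fE] := gmap_base f; have [b gE] := gmap_base g.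
  apply: (etrans (y := vact (a * b)%g (xval v))).
    by apply: xresE; rewrite {1}/gapp /= ffunE fE gappE gE oactM.
  by rewrite vactM -(xresE _ gE) -(xresE _ fE).
Defined.

End GSetModules.

Section Matrices.

Variables (gT : finGroupType) (R : idomainType) (F : {set {group gT}}).
Variables (N : nat) (to : {action gT &-> 'I_N}).
Implicit Types (H K L : {group gT}) (x y z : 'I_N) (M : 'M[R]_N).
Implicit Types (dg : grading to) (A B : {set 'I_N}).

Definition prj A : 'M[R]_N := diag_mx (\row_x (x \in A)%:R).

Lemma prj_mull A M x y : (prj A *m M) x y = (x \in A)%:R * M x y.
Proof. by rewrite mul_diag_mx !mxE. Qed.

Lemma prj_mulr (k : nat) A (M : 'M[R]_(k, N)) (x : 'I_k) y :
  (M *m prj A) x y = M x y * (y \in A)%:R.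
Proof. by rewrite mul_mx_diag !mxE. Qed.

Lemma prjE A x y : prj A x y = ((x == y) && (x \in A))%:R.
Proof. by rewrite !mxE; case: eqP => [->|]; rewrite ?mulr1n ?mulr0n. Qed.

Lemma prjI A B : prj A *m prj B = prj (A :&: B).
Proof.
apply/matrixP => x y; rewrite prj_mull !prjE inE.
by case: (x \in A); case: eqP => //= _; rewrite ?mul1r ?mul0r.
Qed.

Lemma prj_id A : prj A *m prj A = prj A.
Proof. by rewrite prjI finset.setIid. Qed.

Lemma prj0 : prj finset.set0 = 0.
Proof. by apply/matrixP => x y; rewrite prjE inE andbF mxE. Qed.

Lemma prjD A B : prj (A :\: B) = prj A - prj (A :&: B).
Proof.
apply/matrixP => x y; rewrite [RHS]mxE [X in _ + X]mxE !prjE !inE.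
by case: eqP => _; case: (x \in A); case: (x \in B); rewrite ?subr0 ?subrr.
Qed.

Lemma neq0_prjl A M x y : (prj A *m M) x y != 0 -> x \in A /\ M x y != 0.
Proof. by rewrite prj_mull; case: (x \in A); rewrite ?mul1r ?mul0r ?eqxx. Qed.

Lemma neq0_prjr (k : nat) A (M : 'M[R]_(k, N)) (x : 'I_k) y :
  (M *m prj A) x y != 0 -> y \in A /\ M x y != 0.
Proof. by rewrite prj_mulr; case: (y \in A); rewrite ?mulr1 ?mulr0 ?eqxx. Qed.

Lemma prj_mull_id A M : (forall x y, M x y != 0 -> x \in A) -> prj A *m M = M.
Proof.
move=> H; apply/matrixP => x y; rewrite prj_mull.
case: (eqVneq (M x y) 0) => [->|/H ->]; first by rewrite mulr0.
by rewrite mul1r.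
Qed.

Lemma prj_mulr_id A M : (forall x y, M x y != 0 -> y \in A) -> M *m prj A = M.
Proof.
move=> H; apply/matrixP => x y; rewrite prj_mulr.
case: (eqVneq (M x y) 0) => [->|/H ->]; first by rewrite mul0r.
by rewrite mulr1.
Qed.

Lemma neq0_mul (m n k : nat) (M1 : 'M[R]_(m, n)) (M2 : 'M[R]_(n, k)) i (y : 'I_k) :
  (M1 *m M2) i y != 0 ->
  exists x : 'I_n, M1 i x != 0 /\ M2 x y != 0.
Proof.
move=> h; apply: contrapT => no; move: h; rewrite mxE big1 ?eqxx // => x _.
have [->|m1] := eqVneq (M1 i x) 0; first by rewrite mul0r.
have [->|m2] := eqVneq (M2 x y) 0; first by rewrite mulr0.
by case: no; exists x.
Qed.

Lemma neq0_add (m : nat) (M1 M2 : 'M[R]_(m, N)) i y : (M1 + M2) i y != 0 ->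
  M1 i y != 0 \/ M2 i y != 0.
Proof.
rewrite mxE; have [->|] := eqVneq (M1 i y) 0; last by left.
by rewrite add0r; right.
Qed.

Definition stable A := forall x g, (to x g \in A) = (x \in A).

Definition equivariant_mx M := forall g x y, M (to x g) (to y g) = M x y.

Definition admissible M := equivariant_mx M /\
  forall x y, M x y != 0 -> 'C[x | to]%g \subset 'C[y | to]%g.

(** [k] is the drop in degree: 1 for differentials, 0 for chain maps, -1 for homotopies. Rows and
    columns at discarded points vanish. *)
Definition mor dg dg' (k : int) M := admissible M /\
  forall x y, M x y != 0 ->
    [/\ (0 < dg x)%N, (0 < dg' y)%N & (dg x)%:Z = (dg' y)%:Z + k].

Lemma stableD A B : stable A -> stable B -> stable (A :\: B).
Proof. by move=> sA sB x g; rewrite !inE sA sB. Qed.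

Lemma stableU A B : stable A -> stable B -> stable (A :|: B).
Proof. by move=> sA sB x g; rewrite !inE sA sB. Qed.

Lemma admissible_mul M1 M2 : admissible M1 -> admissible M2 ->
  admissible (M1 *m M2).
Proof.
move=> [e1 s1] [e2 s2]; split=> [g x y|x y].
  rewrite !mxE (reindex_inj (act_inj to g)) /=.
  by apply: eq_bigr => z _; rewrite e1 e2.
by move/neq0_mul => [z [/s1 xz /s2]]; exact: subset_trans.
Qed.

Lemma admissible_add M1 M2 : admissible M1 -> admissible M2 ->
  admissible (M1 + M2).
Proof.
move=> [e1 s1] [e2 s2]; split=> [g x y|x y].
  by rewrite !mxE e1 e2.
by move/neq0_add => [/s1|/s2].
Qed.

Lemma admissible_opp M : admissible M -> admissible (- M).
Proof.
move=> [e s]; split=> [g x y|x y]; first by rewrite !mxE e.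
by rewrite mxE oppr_eq0 => /s.
Qed.

Lemma admissible_prj A : stable A -> admissible (prj A).
Proof.
move=> sA; split=> [g x y|x y]; first by rewrite !prjE sA (inj_eq (act_inj to g)).
by rewrite prjE; case: (x =P y) => [->|_] /=; rewrite ?eqxx.
Qed.

Lemma admissible0 : admissible 0.
Proof. by split=> [g x y|x y]; rewrite !mxE ?eqxx. Qed.

Lemma mor_mul dg1 dg2 dg3 k1 k2 M1 M2 :
  mor dg1 dg2 k1 M1 -> mor dg2 dg3 k2 M2 -> mor dg1 dg3 (k1 + k2) (M1 *m M2).
Proof.
move=> [a1 s1] [a2 s2]; split; first exact: admissible_mul.
move=> x y /neq0_mul [z [/s1[x0 z0 e] /s2[_ y0 e']]]; split=> //.
by rewrite e e' -addrA (addrC k2).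
Qed.

Lemma mor_add dg dg' k M1 M2 :
  mor dg dg' k M1 -> mor dg dg' k M2 -> mor dg dg' k (M1 + M2).
Proof.
move=> [a1 s1] [a2 s2]; split; first exact: admissible_add.
by move=> x y /neq0_add [/s1|/s2].
Qed.

Lemma mor_opp dg dg' k M : mor dg dg' k M -> mor dg dg' k (- M).
Proof.
move=> [a s]; split; first exact: admissible_opp.
by move=> x y; rewrite mxE oppr_eq0 => /s.
Qed.

Lemma mor_sub dg dg' k M1 M2 :
  mor dg dg' k M1 -> mor dg dg' k M2 -> mor dg dg' k (M1 - M2).
Proof. by move=> h1 h2; apply: mor_add => //; apply: mor_opp. Qed.

Lemma mor0 dg dg' k : mor dg dg' k 0.
Proof. by split; [exact: admissible0 | move=> x y; rewrite mxE eqxx]. Qed.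

Lemma mor_prj dg dg' A : stable A ->
  (forall x, x \in A -> (0 < dg x)%N /\ dg x = dg' x) -> mor dg dg' 0 (prj A).
Proof.
move=> sA H; split; first exact: admissible_prj.
move=> x y; rewrite prjE; case: (x =P y) => [<-|_] /=; rewrite ?eqxx //.
case xA: (x \in A); rewrite ?eqxx // => _; have [x0 e] := H x xA.
by rewrite -e addr0.
Qed.

(* Regrading does not affect a matrix supported away from the regraded points. *)
Lemma mor_regrade dg1 dg2 dg1' dg2' k M : mor dg1 dg2 k M ->
  (forall x y, M x y != 0 -> dg1' x = dg1 x /\ dg2' y = dg2 y) ->
  mor dg1' dg2' k M.
Proof.
move=> [a s] H; split=> // x y Mxy; have [-> ->] := H x y Mxy.
exact: s.
Qed.

Definition alive dg : {set 'I_N} := [set x | 0 < dg x]%N.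

Lemma alive_stable dg : stable (alive dg).
Proof. by move=> x g; rewrite !inE gradeJ. Qed.

Lemma mor_alivel dg dg' k M : mor dg dg' k M -> prj (alive dg) *m M = M.
Proof. by move=> [_ s]; apply: prj_mull_id => x y /s[]; rewrite inE. Qed.

Lemma mor_aliver dg dg' k M : mor dg dg' k M -> M *m prj (alive dg') = M.
Proof. by move=> [_ s]; apply: prj_mulr_id => x y /s[]; rewrite inE. Qed.

Lemma mor_prj0 dg dg' k M A B : mor dg dg' k M ->
  (forall x y, x \in A -> y \in B -> (dg x)%:Z = (dg' y)%:Z + k -> False) ->
  prj A *m M *m prj B = 0.
Proof.
move=> [_ s] H; apply/matrixP => x y; rewrite [RHS]mxE; apply/eqP/negPn/negP.
by move=> /neq0_prjr[yB /neq0_prjl[xA /s[_ _ /H]]]; apply.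
Qed.

Section Xhom.

Variables (dg dg' : grading to) (k : int) (M : 'M[R]_N) (i j : nat).
Hypotheses (Mm : mor dg dg' k M) (ij : i%:Z = j%:Z + k).

Lemma xhom_subproof K (v : xsp R dg i K) : xval v *m M \in xsupp dg' j K.
Proof.
have /xsuppP vP := xspP v; have [[_ s1] s2] := Mm.
apply/xsuppP => y /neq0_mul [x [/vP[dx Kx] Mxy]].
split; last exact: subset_trans (s1 _ _ Mxy).
have [_ y0 e] := s2 _ _ Mxy.
apply/eqP; rewrite -eqz_nat; apply/eqP/(addIr k).
by rewrite -e dx -addn1 -[j.+1]addn1 !PoszD addrAC -ij.
Qed.

Definition xhom_fun K (v : xsp R dg i K) : xsp R dg' j K := XSp (xhom_subproof v).

Lemma xhom_linear K : linear (@xhom_fun K).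
Proof. by move=> a u v; apply: val_inj; rewrite /= mulmxDl scalemxAl. Qed.

HB.instance Definition _ K :=
  GRing.isLinear.Build R (xsp R dg i K) (xsp R dg' j K) _ (@xhom_fun K)
    (@xhom_linear K).

Lemma vact_mul g (v : 'rV[R]_N) : vact to g (v *m M) = vact to g v *m M.
Proof.
apply/rowP => y; rewrite !mxE (reindex_inj (act_inj to g)) /=.
by apply: eq_bigr => x _; rewrite mxE Mm.1.1.
Qed.

Definition xhom : rghom (xmod R F dg i) (xmod R F dg' j).
Proof.
apply: (@RGHom _ _ _ (xmod R F dg i) (xmod R F dg' j)
  (fun K : orbit_obj F =>
     @xhom_fun K : {linear xsp R dg i K -> xsp R dg' j K})) => K L f v.
by apply: val_inj; rewrite /= vact_mul.
Defined.

End Xhom.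

Record bcx := BCx { bdg :> grading to; bd : 'M[R]_N;
  bd_mor : mor bdg bdg 1 bd; bd_sq : bd *m bd = 0 }.

Implicit Types (C D : bcx).

Fact bd_degree i : i.+1%:Z = i%:Z + 1.
Proof. by rewrite -addn1. Qed.

Definition real C : rgcx R F.
Proof.
apply: (@RGCx _ _ _ (xmod R F C) (fun i => xhom (bd_mor C) (bd_degree i))).
by move=> i K v; apply: val_inj; rewrite /= -mulmxA bd_sq mulmx0.
Defined.

Lemma bd_alivel C : prj (alive C) *m bd C = bd C.
Proof. exact: mor_alivel (bd_mor C). Qed.

Lemma bd_aliver C : bd C *m prj (alive C) = bd C.
Proof. exact: mor_aliver (bd_mor C). Qed.

Definition chain_mx C D f := mor C D 0 f /\ f *m bd D = bd C *m f.

Fact degree0 (i : nat) : i%:Z = i%:Z + 0.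
Proof. by rewrite addr0. Qed.

Lemma xsupp_alive dg i K (v : xsp R dg i K) : xval v *m prj (alive dg) = xval v.
Proof.
have /xsuppP vP := xspP v; apply/rowP => x; rewrite mul_mx_diag !mxE inE.
have [->|/vP[-> _]] := eqVneq (xval v 0 x) 0; first by rewrite mul0r.
by rewrite mulr1.
Qed.

Lemma homotopic_id_mx C D f g s (fm : chain_mx C D f) (gm : chain_mx D C g) :
  mor C C (-1) s ->
  f *m g = prj (alive C) + s *m bd C + bd C *m s ->
  exists (f' : rgcx_map (real C) (real D)) (g' : rgcx_map (real D) (real C)),
   [/\ homotopic_id f' g',
       forall i (K : orbit_obj F) (v : real C i K), xval (f' i K v) = xval v *m f
     & forall i (K : orbit_obj F) (v : real D i K), xval (g' i K v) = xval v *m g].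
Proof.
move=> sm e.
have fc : forall i (K : orbit_obj F) (x : real C i.+1 K),
    xhom fm.1 (degree0 i) K (rgc_d (real C) i K x) =
    rgc_d (real D) i K (xhom fm.1 (degree0 i.+1) K x).
  by move=> i K v; apply: val_inj; rewrite /= -!mulmxA fm.2.
have gc : forall i (K : orbit_obj F) (x : real D i.+1 K),
    xhom gm.1 (degree0 i) K (rgc_d (real D) i K x) =
    rgc_d (real C) i K (xhom gm.1 (degree0 i.+1) K x).
  by move=> i K v; apply: val_inj; rewrite /= -!mulmxA gm.2.
exists (@RGCxMap _ _ _ (real C) (real D) (fun i => xhom fm.1 (degree0 i)) fc).
exists (@RGCxMap _ _ _ (real D) (real C) (fun i => xhom gm.1 (degree0 i)) gc).
split=> //.
have sd i : i%:Z = i.+1%:Z + -1 by rewrite -addn1 PoszD addrK.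
exists (fun i => xhom sm (sd i)) => K.
have H i (v : real C i K) : xval v *m f *m g - xval v =
    xval v *m s *m bd C + xval v *m bd C *m s.
  by rewrite -mulmxA e !mulmxDr xsupp_alive !mulmxA -(addrA (xval v)) addrAC subrr add0r.
split=> [v|i v]; apply: val_inj; rewrite /= H //.
(* Degree 0 is grade 1, so the boundary would lie in grade 0, where the matrix has no entries. *)
suff -> : xval v *m bd C = 0 by rewrite mul0mx addr0.
have /xsuppP vP := xspP v.
apply/rowP => y; rewrite [RHS]mxE; apply/eqP/negPn/negP.
move=> /neq0_mul[x [/vP[dx _] /(bd_mor C).2]]; rewrite dx => -[_ y0 /eqP].
by rewrite -[X in _ + X]/(1%N%:Z) -PoszD eqz_nat addn1 eqSS => /eqP y1; rewrite -y1 in y0.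
Qed.

Lemma homotopy_equivalent_mx C D f g s t :
  chain_mx C D f -> chain_mx D C g ->
  mor C C (-1) s -> mor D D (-1) t ->
  f *m g = prj (alive C) + s *m bd C + bd C *m s ->
  g *m f = prj (alive D) + t *m bd D + bd D *m t ->
  homotopy_equivalent (real C) (real D).
Proof.
move=> fm gm sm tm e1 e2.
have [f' [g' [H fE gE]]] := homotopic_id_mx fm gm sm e1.
have [g2 [f2 [H2 gE2 fE2]]] := homotopic_id_mx gm fm tm e2.
exists f', g'; split=> //.
have [u uP] := H2; exists u => K; have [u0 u1] := uP K.
(* The lemma was applied once in each direction; the two pairs of chain maps coincide, both being
   multiplication by [f] and [g]. *)
have E i (v : real D i K) : f' i K (g' i K v) = f2 i K (g2 i K v).
  by apply: xval_inj; rewrite fE gE fE2 gE2.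
by split=> [v|i v]; rewrite E ?u0 ?u1.
Qed.

End Matrices.

(** * Moving and cancelling cells *)

Section RingIdentities.

Variable S : pzRingType.

(* The image of A (projection p) splits off one degree below, by the left
   inverse r. Its complement need not be free; instead of cancelling A, a copy of
   A is added two degrees lower, with r as differential onto it. *)
Section FoldIdentities.

Variables a d p q r : S.
Hypotheses (aE : a = p + q) (pp : p * p = p) (qq : q * q = q) (pq : p * q = 0)
  (qp : q * p = 0) (dd : d * d = 0) (ad : a * d = d) (da : d * a = d)
  (ar : a * r = r) (rp : r * p = r) (pr : p * r = 0) (pdp : p * d * p = 0)
  (pdr : p * d * r = p).

(** Vectors are rows, so products are read from left to right. [f] subtracts boundaries of cells of
    A, which gives [p d f = 0]; [g] subtracts cells of A, which gives [g d r = 0]. Apart from the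
    new term [r], the differential [d'] is [q d f]. *)
Let d' := q * d * q - q * d * r * d + r.
Let f := q - r * d.
Let g := q - q * d * r.

Let rr : r * r = 0. Proof. by rewrite -{1}rp -mulrA pr mulr0. Qed.
Let rdp : r * d * p = 0. Proof. by rewrite -rp -!mulrA (mulrA p) pdp mulr0. Qed.
Let rdr : r * d * r = r. Proof. by rewrite -{1}rp -!mulrA (mulrA p) pdr rp. Qed.
Let qr : q * r = r. Proof. by rewrite -{2}ar aE mulrDl pr add0r. Qed.
Let rq : r * q = 0. Proof. by rewrite -rp -mulrA pq mulr0. Qed.
Let qd : q * d = d - p * d. Proof. by rewrite -{2}ad aE mulrDl addrC addKr. Qed.
Let dq : d * q = d - d * p. Proof. by rewrite -{2}da aE mulrDr addrC addKr. Qed.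

(** Products are kept associated to the left, so each relation is also needed behind an arbitrary
    factor [w]; together they form the rewriting system [rels]. *)
Let w2 (x y z : S) : x * y = z -> forall w, w * x * y = w * z.
Proof. by move=> e w; rewrite -mulrA e. Qed.

Let w3 (x y z v : S) : x * y * z = v -> forall w, w * x * y * z = w * v.
Proof. by move=> e w; rewrite -e !mulrA. Qed.

Let rels := (w2 dd, w2 rr, w2 qq, w2 pp, w2 pq, w2 qp, w2 pr, w2 rp, w2 qr,
  w2 rq, w3 rdp, w3 pdp, w3 rdr, w3 pdr, w2 dq, w2 qd, qd,
  dd, rr, qq, pp, pq, qp, pr, rp,
  qr, rq, rdp, pdp, rdr, pdr, dq, mul0r, mulr0, subr0, addr0, sub0r, add0r,
  oppr0,
  @mulrDr S, @mulrDl S, @mulNr S, @mulrN S, @mulrA S, @opprD S, @opprK S).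

Lemma fold_sq : d' * d' = 0.
Proof.
rewrite /d' !rels.
rewrite ?addNr ?subrr ?sub0r ?add0r addrK subrK addNr add0r.
by rewrite [- _ + p]addrC addrA subrK subrr.
Qed.

Lemma fold_f : f * d' = d * f.
Proof.
rewrite /f /d' !rels.
by rewrite subrr addr0 [- _ + p * d]addrC addrA [d - _ - _]addrAC subrK.
Qed.

Lemma fold_g : g * d = d' * g.
Proof.
rewrite /g /d' !rels.
by rewrite subrr add0r subrK [RHS]addrAC [d - _ - _]addrAC subrK.
Qed.

Lemma fold_fg : f * g = a + (- r) * d + d * (- r).
Proof.
rewrite /f /g !rels.
by rewrite [LHS]addrA addrC !addrA aE.
Qed.

Lemma fold_gf : g * f = a + (- (p * d)) * d' + d' * (- (p * d)).
Proof.
rewrite /f /g !rels.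
by rewrite addNr sub0r aE [p + q]addrC addrK.
Qed.

End FoldIdentities.

(* Here the complement of the image of p in b is free on e, via th and ta, and
   replaces p and b altogether. *)
Section DeleteIdentities.

Variables a d p q b e r th ta : S.
Hypotheses (aE : a = p + q + b) (pp : p * p = p) (qq : q * q = q)
  (bb : b * b = b) (pq : p * q = 0) (qp : q * p = 0) (pb : p * b = 0)
  (bp : b * p = 0) (qb : q * b = 0) (bq : b * q = 0) (be : b * e = e)
  (eb : e * b = e) (dd : d * d = 0) (ad : a * d = d) (da : d * a = d)
  (bd : b * d = 0) (pdp : p * d * p = 0) (pdqd : p * d * q * d = 0)
  (br : b * r = r) (rp : r * p = r) (eth : e * th = th) (thb : th * b = th)
  (bta : b * ta = ta) (tae : ta * e = ta) (pdr : p * d * r = p)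
  (thr : th * r = 0) (thta : th * ta = e) (pdta : p * d * ta = 0)
  (split_b : r * d * b + ta * th = b).

(** By [split_b], B is the sum of the image of A and of a free module on E, with projections [r d b]
    and [ta th]. The last terms of [f] and [g] play the same role as in the previous section. *)
Let f := q + ta - r * d * q.
Let g := q + th - q * d * r.
Let d' := g * d * f.

Let rr : r * r = 0. Proof. by rewrite -{2}br -{1}rp -mulrA (mulrA p) pb mul0r mulr0. Qed.
Let rdp : r * d * p = 0. Proof. by rewrite -rp -!mulrA (mulrA p) pdp mulr0. Qed.
Let rdr : r * d * r = r. Proof. by rewrite -{1}rp -!mulrA (mulrA p) pdr rp. Qed.
Let rdta : r * d * ta = 0.
Proof. by rewrite -rp -!mulrA (mulrA p) pdta mulr0. Qed.
Let rdqd : r * d * q * d = 0.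
Proof. by rewrite -(mulr0 r) -pdqd !mulrA rp. Qed.
Let qr : q * r = 0. Proof. by rewrite -br mulrA qb mul0r. Qed.
Let rq : r * q = 0. Proof. by rewrite -rp -mulrA pq mulr0. Qed.
Let qta : q * ta = 0. Proof. by rewrite -bta mulrA qb mul0r. Qed.
Let qe : q * e = 0. Proof. by rewrite -be mulrA qb mul0r. Qed.
Let eq : e * q = 0. Proof. by rewrite -eb -mulrA bq mulr0. Qed.
Let qth : q * th = 0. Proof. by rewrite -eth mulrA qe mul0r. Qed.
Let taq : ta * q = 0. Proof. by rewrite -tae -mulrA eq mulr0. Qed.
Let thq : th * q = 0. Proof. by rewrite -thb -mulrA bq mulr0. Qed.
Let thd : th * d = 0. Proof. by rewrite -thb -mulrA bd mulr0. Qed.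
Let rta : r * ta = 0. Proof. by rewrite -rp -bta -mulrA (mulrA p) pb mul0r mulr0. Qed.

Let w2 (x y z : S) : x * y = z -> forall w, w * x * y = w * z.
Proof. by move=> h w; rewrite -mulrA h. Qed.

Let w3 (x y z v : S) : x * y * z = v -> forall w, w * x * y * z = w * v.
Proof. by move=> h w; rewrite -h !mulrA. Qed.

Let rels := (w2 dd, w2 rr, w2 qq, w3 rdr, w3 rdta, w2 qr, w2 rq, w2 qta, w2 qth,
  w2 taq, w2 thq, w2 thd, w2 thr, w2 thta, w2 rta, dd, rr, qq, rdr, rdta, rdqd,
  qr, rq, qta, qth, taq, thq, thd, thr, thta, rta, mul0r, mulr0, subr0, addr0,
  sub0r, add0r, oppr0, @mulrDr S, @mulrDl S, @mulNr S, @mulrN S, @mulrA S,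
  @opprD S, @opprK S).

Lemma delete_gf : g * f = q + e.
Proof. by rewrite /f /g !rels. Qed.

Let qdr : q * d * r = d * r - p.
Proof.
have <- : a * d * r = d * r by rewrite ad.
by rewrite aE !mulrDl pdr bd mul0r addr0 addrC addKr.
Qed.

Let rdq : r * d * q = r * d - r * d * b.
Proof.
have h : r * d * a = r * d by rewrite -mulrA da.
by rewrite -[X in _ = X - _]h aE !mulrDr rdp add0r addrK.
Qed.

Lemma delete_fg : f * g = a + (- r) * d + d * (- r).
Proof.
have tt : ta * th = b - r * d * b by apply/eqP; rewrite eq_sym subr_eq addrC split_b.
rewrite /f /g !rels qdr rdq tt !opprB (addrC (r * d * b)) !addrA.
rewrite [_ + r * d * b + b]addrAC addrK aE; congr (_ - _).
by rewrite addrC !addrA [p + q - _ + b]addrAC.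
Qed.

(** [d'] is [d] transported by [g] and [f]. Since [f * g] is [a - r d - d r], the two correction
    terms disappear by [d d = 0] and [r d f = 0]. *)
Lemma delete_f : f * d' = d * f.
Proof.
have rdf : r * d * f = 0 by rewrite /f !rels subrr.
rewrite /d' !mulrA delete_fg !mulrDl !(mulNr, mulrN) ad.
by rewrite -(mulrA r) dd -!(mulrA d) rdf !(mulr0, mul0r) !subr0.
Qed.

Lemma delete_g : g * d = d' * g.
Proof.
have gdr : g * d * r = 0 by rewrite /g !rels subrr.
rewrite /d' -!mulrA delete_fg !mulrDr !(mulNr, mulrN) da !mulrA.
by rewrite gdr -(mulrA g) dd !(mulr0, mul0r) !subr0.
Qed.

Lemma delete_sq : d' * d' = 0.
Proof. by rewrite {1}/d' -!mulrA delete_f (mulrA d) dd mul0r mulr0. Qed.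

End DeleteIdentities.

End RingIdentities.

Section Moves.

Variables (gT : finGroupType) (R : idomainType) (F : {set {group gT}}).
Variables (N : nat) (to : {action gT &-> 'I_N}).
Implicit Types (x y z : 'I_N) (M : 'M[R]_N) (A B : {set 'I_N}).

Definition regrade (C : bcx R to) A (sA : stable to A) (m : nat) : grading to.
Proof.
exists (fun x => if x \in A then m else bdg C x) => x g.
by rewrite sA gradeJ.
Defined.

Section Fold.

Variables (C : bcx R to) (A : {set 'I_N}) (sA : stable to A) (e : nat).
Variable r : 'M[R]_N.
Hypotheses (AP : forall x, x \in A -> C x = e.+3) (rm : mor C C (-1) r).
Hypotheses (rA : r *m prj R A = r) (dr : prj R A *m bd C *m r = prj R A).

Let d := bd C.
Let p := prj R A.
Let al := prj R (alive C).
Let q := prj R (alive C :\: A).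
Let dg := regrade C sA e.+1.

Let subA : A \subset alive C.
Proof. by apply/subsetP => x /AP; rewrite inE => ->. Qed.

Let aE : al = p + q.
Proof.
rewrite /q prjD finset.setIC (finset.setIidPl subA).
by rewrite addrC subrK.
Qed.

Let pp : p *m p = p. Proof. exact: prj_id. Qed.
Let qq : q *m q = q. Proof. exact: prj_id. Qed.
Let pq : p *m q = 0.
Proof.
rewrite prjI -(prj0 R N); congr prj; apply/setP => x; rewrite !inE.
by case: (x \in A).
Qed.
Let qp : q *m p = 0.
Proof. by rewrite prjI finset.setIC -prjI pq. Qed.
Let dd : d *m d = 0. Proof. exact: bd_sq. Qed.
Let ad : al *m d = d. Proof. exact: bd_alivel. Qed.
Let da : d *m al = d. Proof. exact: bd_aliver. Qed.
Let ar : al *m r = r. Proof. exact: mor_alivel rm. Qed.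

Let pr : p *m r = 0.
Proof.
rewrite -rA mulmxA; apply: mor_prj0 rm _ => x y /AP -> /AP ->; lia.
Qed.

Let pdp : p *m d *m p = 0.
Proof. by apply: mor_prj0 (bd_mor C) _ => x y /AP -> /AP ->; lia. Qed.

Let sq : stable to (alive C :\: A).
Proof. by apply: stableD => //; apply: alive_stable. Qed.

Let qm : mor C C 0 q.
Proof. by apply: mor_prj => // x; rewrite !inE => /andP[_ ->]. Qed.

Let pm : mor C C 0 p.
Proof. by apply: mor_prj => // x /AP ->. Qed.

Let notq x : x \in alive C :\: A -> dg x = C x.
Proof. by rewrite !inE /= => /andP[/negPf -> _]. Qed.

Let d' := q *m d *m q - q *m d *m r *m d + r.
Let f := q - r *m d.
Let g := q - q *m d *m r.

Let dm := bd_mor C.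

Let rnz x y : r x y != 0 -> x \in alive C :\: A /\ y \in A.
Proof.
move=> rxy; have /neq0_prjr[yA _] : (r *m prj R A) x y != 0 by rewrite rA.
have [x0 _ e1] := rm.2 _ _ rxy; rewrite !inE x0; split=> //.
rewrite andbT; apply/negP => /AP xe.
move: e1; rewrite xe (AP yA); lia.
Qed.

Let rdnz x y : (r *m d) x y != 0 -> y \in alive C :\: A.
Proof.
move=> /neq0_mul[z [/rnz[_ /AP ze] /dm.2[_ y0 e1]]]; rewrite !inE y0 andbT.
by apply/negP => /AP ye; move: e1; rewrite ze ye; lia.
Qed.

Let d'm : mor dg dg 1 d'.
Proof.
apply: mor_add; last first.
  (* [r] raises the old degree by one; once A has moved down by two, it lowers the degree by one and
     can be part of a differential. *)
  split; first exact: rm.1.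
  move=> x y rxy; have [xq yA] := rnz rxy.
  rewrite (notq xq); have [x0 _ e1] := rm.2 _ _ rxy.
  rewrite /dg /= yA; split=> //; move: e1; rewrite (AP yA); lia.
apply: (@mor_regrade _ _ _ _ C C).
  apply: mor_sub.
    by rewrite -[1]addr0 -[1]add0r; apply: mor_mul qm; apply: mor_mul qm dm.
  rewrite (_ : 1 = 0 + 1 + -1 + 1) //.
  apply: mor_mul dm; apply: mor_mul rm; exact: mor_mul qm dm.
move=> x y h; suff [xq yq] : x \in alive C :\: A /\ y \in alive C :\: A.
  by rewrite !notq.
case/neq0_add: h => [/neq0_prjr[yq /neq0_prjl[]] //|].
rewrite mxE oppr_eq0 => h.
split.
  by move: h; rewrite -!mulmxA => /neq0_prjl[].
by move: h; rewrite -mulmxA => /neq0_mul[z [_ /rdnz]].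
Qed.

Let fm : mor C dg 0 f.
Proof.
apply: (@mor_regrade _ _ _ _ C C).
  apply: mor_sub => //; rewrite (_ : 0 = -1 + 1) //; exact: mor_mul rm dm.
move=> x y h; split=> //; apply: notq.
case/neq0_add: h => [|]; last by rewrite mxE oppr_eq0 => /rdnz.
by rewrite -qq => /neq0_prjr[].
Qed.

Let gm : mor dg C 0 g.
Proof.
apply: (@mor_regrade _ _ _ _ C C).
  apply: mor_sub => //; rewrite (_ : 0 = 0 + 1 + -1) //.
  by apply: mor_mul rm; apply: mor_mul qm dm.
move=> x y h; split=> //; apply: notq.
have gq : q *m g = g by rewrite mulmxBr !mulmxA qq.
by move: h; rewrite -gq => /neq0_prjl[].
Qed.

Let tm : mor dg dg (-1) (- (p *m d)).
Proof.
apply: mor_opp; split; first by case: (mor_mul pm dm).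
move=> x y /neq0_prjl[xA /dm.2[x0 y0 e1]].
have yA : y \in A = false by apply/negP => /AP ye; move: e1; rewrite AP // ye; lia.
by rewrite /dg /= xA yA; split=> //; move: e1; rewrite (AP xA); lia.
Qed.

Let d'2 : d' *m d' = 0.
Proof. by apply: (@fold_sq 'M[R]_N al d p q r). Qed.

(** Grades are degrees plus one: [A] leaves degree [e + 2], and the same points, regraded, serve as
    its copy in degree [e]. *)
Lemma fold_step : exists D : bcx R to,
  homotopy_equivalent (real F C) (real F D) /\
  forall x, D x = if x \in A then e.+1 else C x.
Proof.
exists (BCx d'm d'2); split=> //.
have alE : prj R (alive (BCx d'm d'2)) = al.
  congr prj; apply/setP => x; rewrite !inE /=.
  by case: ifP => // /AP ->.
apply: (@homotopy_equivalent_mx _ _ _ _ _ _ _ f g (- r) (- (p *m d))) => //.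
- split=> //=; by apply: (@fold_f 'M[R]_N al d p q r).
- split=> //=; by apply: (@fold_g 'M[R]_N al d p q r).
- exact: mor_opp.
- by apply: (@fold_fg 'M[R]_N al d p q r).
- rewrite alE; by apply: (@fold_gf 'M[R]_N al d p q r).
Qed.

End Fold.

Section Delete.

Variables (C : bcx R to) (A B E : {set 'I_N}).
Variables (sA : stable to A) (sB : stable to B) (sE : stable to E).
Variables r th ta : 'M[R]_N.
Hypotheses (AP : forall x, x \in A -> C x = 2%N)
  (BP : forall x, x \in B -> C x = 1%N) (EB : E \subset B).
Hypotheses (ra : admissible to r) (tha : admissible to th)
  (taa : admissible to ta).

Let d := bd C.
Let p := prj R A.
Let b := prj R B.
Let e := prj R E.
Let al := prj R (alive C).
Let Q := alive C :\: (A :|: B).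
Let q := prj R Q.

Hypotheses (br : b *m r = r) (rp : r *m p = r) (eth : e *m th = th)
  (thb : th *m b = th) (bta : b *m ta = ta) (tae : ta *m e = ta)
  (pdr : p *m d *m r = p) (thr : th *m r = 0) (thta : th *m ta = e)
  (pdta : p *m d *m ta = 0) (split_b : r *m d *m b + ta *m th = b).

Let dead : {set 'I_N} := A :|: (B :\: E).

Let sdead : stable to dead.
Proof. by apply: stableU => //; apply: stableD. Qed.

Let dg := regrade C sdead 0%N.

Let AB x : x \in A -> x \in B = false.
Proof. by move=> /AP xA; apply/negP => /BP; rewrite xA. Qed.

Let aE : al = p + q + b.
Proof.
apply/matrixP => x y; rewrite [RHS]mxE [X in _ = X + _]mxE !prjE !inE.
have [->|_] := eqVneq x y; last by rewrite !addr0.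
have [yA|yA] := boolP (y \in A).
  by rewrite (AB yA) AP // !addr0.
have [yB|yB] := boolP (y \in B); first by rewrite BP // !add0r.
by rewrite /= add0r addr0.
Qed.

Let prj_disj (U V : {set 'I_N}) : (forall x, x \in U -> x \in V -> False) ->
  prj R U *m prj R V = 0.
Proof.
move=> H; rewrite prjI -(prj0 R N); congr prj; apply/setP => x; rewrite !inE.
by apply/negP => /andP[/H].
Qed.

Let pp : p *m p = p. Proof. exact: prj_id. Qed.
Let qq : q *m q = q. Proof. exact: prj_id. Qed.
Let bb : b *m b = b. Proof. exact: prj_id. Qed.
Let pq : p *m q = 0.
Proof. by apply: prj_disj => x xA; rewrite !inE xA. Qed.
Let qp : q *m p = 0.
Proof. by apply: prj_disj => x + xA; rewrite !inE xA. Qed.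
Let pb : p *m b = 0.
Proof. by apply: prj_disj => x /AB ->. Qed.
Let bp : b *m p = 0.
Proof. by apply: prj_disj => x + /AB => ->. Qed.
Let qb : q *m b = 0.
Proof. by apply: prj_disj => x + xB; rewrite !inE xB orbT. Qed.
Let bq : b *m q = 0.
Proof. by apply: prj_disj => x xB; rewrite !inE xB orbT. Qed.
Let be : b *m e = e. Proof. by rewrite prjI (finset.setIidPr EB). Qed.
Let eb : e *m b = e. Proof. by rewrite prjI (finset.setIidPl EB). Qed.
Let dd : d *m d = 0. Proof. exact: bd_sq. Qed.
Let ad : al *m d = d. Proof. exact: bd_alivel. Qed.
Let da : d *m al = d. Proof. exact: bd_aliver. Qed.

Let dm := bd_mor C.

Let bd0 : b *m d = 0.
Proof.
apply/matrixP => x y; rewrite [RHS]mxE; apply/eqP/negPn/negP.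
move=> /neq0_prjl[/BP x1 /dm.2[_ y0]]; rewrite x1; lia.
Qed.

Let pdp : p *m d *m p = 0.
Proof. by apply: mor_prj0 (bd_mor C) _ => x y /AP -> /AP ->; lia. Qed.

Let pdqd : p *m d *m q *m d = 0.
Proof.
apply/matrixP => x y; rewrite [RHS]mxE; apply/eqP/negPn/negP.
move=> /neq0_mul[z [/neq0_prjr[_ /neq0_prjl[/AP x2 /dm.2[_ _ e1]]] /dm.2[_ y0 e2]]].
by move: e1 e2; rewrite x2; lia.
Qed.

Let sQ : stable to Q.
Proof. by apply: stableD; [exact: alive_stable|exact: stableU]. Qed.

Let QP x : x \in Q -> dg x = C x /\ (0 < C x)%N.
Proof.
rewrite !inE negb_or => /andP[/andP[/negPf xA /negPf xB] ->].
by rewrite /= !inE xA xB andbF.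
Qed.

Let EP x : x \in E -> dg x = 1%N.
Proof.
move=> xE; have xB := subsetP EB x xE.
have xA : x \in A = false by apply/negP => /AB; rewrite xB.
by rewrite /= !inE xA xE BP.
Qed.

Let rP x y : r x y != 0 -> x \in B /\ y \in A.
Proof.
rewrite -br => /neq0_prjl[xB].
by rewrite -rp => /neq0_prjr[].
Qed.

Let rm : mor C C (-1) r.
Proof.
by split=> // x y /rP[/BP -> /AP ->].
Qed.

Let f := q + ta - r *m d *m q.
Let g := q + th - q *m d *m r.
Let d' := g *m d *m f.

Let qmC : mor C C 0 q.
Proof. by apply: mor_prj => // x /QP[]. Qed.

Let fm : mor C dg 0 f.
Proof.
apply: mor_sub.
  apply: mor_add; first by apply: mor_prj => // x /QP[-> ->].
  split=> // x y; rewrite -bta => /neq0_prjl[/BP ->].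
  by rewrite -tae => /neq0_prjr[/EP ->].
apply: (@mor_regrade _ _ _ _ C C).
  by rewrite (_ : 0 = -1 + 1 + 0) //; apply: mor_mul qmC; apply: mor_mul rm dm.
by move=> x y /neq0_prjr[/QP[]].
Qed.

Let gm : mor dg C 0 g.
Proof.
apply: mor_sub.
  apply: mor_add; first by apply: mor_prj => // x /QP[-> ->].
  split=> // x y; rewrite -eth => /neq0_prjl[/EP ->].
  by rewrite -thb => /neq0_prjr[/BP ->].
apply: (@mor_regrade _ _ _ _ C C).
  by rewrite (_ : 0 = 0 + 1 + -1) //; apply: mor_mul rm; apply: mor_mul qmC dm.
by move=> x y; rewrite -mulmxA => /neq0_prjl[/QP[]].
Qed.

Let d'm : mor dg dg 1 d'.
Proof.
by rewrite (_ : 1 = 0 + 1 + 0) //; apply: mor_mul fm; apply: mor_mul gm dm.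
Qed.

Let d'2 : d' *m d' = 0.
Proof. by apply: (@delete_sq 'M[R]_N al d p q b e r th ta). Qed.

(** The points of [E], which is a part of [B], carry the free complement; the other points of [A]
    and [B] go to grade 0. *)
Lemma delete_step : exists D : bcx R to,
  homotopy_equivalent (real F C) (real F D) /\
  forall x, D x = if x \in A :|: (B :\: E) then 0%N else C x.
Proof.
exists (BCx d'm d'2); split=> //.
have alE : prj R (alive (BCx d'm d'2)) = q + e.
  apply/matrixP => x y; rewrite [RHS]mxE !prjE !inE /= /dead !inE.
  have [->|_] := eqVneq x y; last by rewrite addr0.
  have [yA|yA] := boolP (y \in A).
    case yE : (y \in E); last by rewrite addr0.
    by have := subsetP EB y yE; rewrite AB.
  have [yB|yB] := boolP (y \in B); first by case: (y \in E); rewrite /= ?BP // add0r.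
  have yE : y \in E = false by apply/negP => /(subsetP EB); rewrite (negPf yB).
  by rewrite yE /= addr0.
apply: (@homotopy_equivalent_mx _ _ _ _ _ _ _ f g (- r) 0) => //.
- by split=> //=; apply: (@delete_f 'M[R]_N al d p q b e r th ta).
- by split=> //=; apply: (@delete_g 'M[R]_N al d p q b e r th ta).
- exact: mor_opp.
- exact: mor0.
- by apply: (@delete_fg 'M[R]_N al d p q b e r th ta).
- rewrite alE mul0mx mulmx0 !addr0.
  by apply: (@delete_gf 'M[R]_N d p q b e r th ta).
Qed.

End Delete.

End Moves.

Section LeftInverse.

Variables (gT : finGroupType) (R : idomainType).
Variables (N : nat) (to : {action gT &-> 'I_N}) (H : {group gT}).
Implicit Types (x y z : 'I_N) (M : 'M[R]_N) (A B E : {set 'I_N}).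

Definition isotropy_type A :=
  stable to A /\ forall x, x \in A -> exists g, 'C[to x g | to]%g = H.

Lemma astab1_to x g : 'C[to x g | to]%g = ('C[x | to] :^ g)%g.
Proof. by rewrite astab1_act. Qed.

Lemma isotropy_card A x : isotropy_type A -> x \in A -> #|'C[x | to]%g| = #|H|.
Proof.
by move=> [_ tA] /tA[g e]; rewrite -(cardJg _ g) -astab1_to e.
Qed.

(** In each orbit a point of isotropy exactly [H] is picked. The predicate given to [pick] is the
    same along an orbit, hence so is the outcome. *)
Lemma isotropy_base A : isotropy_type A ->
  exists (base : 'I_N -> 'I_N) (gam : 'I_N -> gT), forall x, x \in A ->
    [/\ base x \in A, 'C[base x | to]%g = H, to (base x) (gam x) = x
      & forall g, base (to x g) = base x].
Proof.
move=> [sA tA].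
pose P x z := [exists g, z == to x g] && (('C[z | to])%g == H :> {set gT}).
pose base x := odflt x [pick z | P x z].
have PE x g : P (to x g) =1 P x.
  move=> z; rewrite /P; congr (_ && _); apply/existsP/existsP => -[a /eqP ->].
    by exists (g * a)%g; rewrite actM.
  by exists (g^-1 * a)%g; rewrite actM actK.
have P0 x : x \in A -> P x =1 xpred0 -> False.
  move=> /tA[g e] /(_ (to x g)).
  by rewrite /P e eqxx andbT => /existsP[]; exists g.
have bP x : x \in A -> P x (base x).
  by move=> xA; rewrite /base; case: pickP => [//|/(P0 x xA)].
pose gam x := odflt 1%g [pick g | to (base x) g == x].
exists base, gam => x xA; have /andP[/existsP[g /eqP bx] /eqP Cb] := bP x xA.
split=> //; first by rewrite bx sA.
  rewrite /gam; case: pickP => [h /eqP //|/(_ g^-1%g)].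
  by rewrite bx actK eqxx.
move=> h; rewrite /base (eq_pick (PE x h)).
by case: pickP => [//|/(P0 x xA)].
Qed.

Lemma act_conj_base x g z : 'C[z | to]%g = H -> to z g = x ->
  forall a g', to z g' = to x a ->
    exists2 h, h \in H & forall y, to y (a * g'^-1)%g = to y (g^-1 * h)%g.
Proof.
move=> zH zx a g' e; exists (g * a * g'^-1)%g; last first.
  by move=> y; rewrite !mulgA mulVg mul1g.
by rewrite -zH; apply/astab1P; rewrite !actM zx -e actK.
Qed.

(** Frobenius reciprocity: an equivariant matrix is determined by its rows at the base points, and
    these can be any rows invariant under [H]. *)
Lemma extend_rows A (w : 'M[R]_N) : isotropy_type A ->
  (forall z y h, z \in A -> 'C[z | to]%g = H -> h \in H ->
     w z (to y h) = w z y) ->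
  exists th : 'M[R]_N, equivariant_mx to th /\
    exists (base : 'I_N -> 'I_N) (gam : 'I_N -> gT),
    (forall x, x \in A ->
      [/\ base x \in A, 'C[base x | to]%g = H & to (base x) (gam x) = x]) /\
    forall x y,
      th x y = if x \in A then w (base x) (to y (gam x)^-1%g) else 0.
Proof.
move=> tA wH; have [base [gam bg]] := isotropy_base tA.
exists (\matrix_(x, y) if x \in A then w (base x) (to y (gam x)^-1%g) else 0).
split; last first.
  exists base, gam; split=> [x /bg[]|x y] //.
  by rewrite mxE.
move=> g x y; rewrite !mxE tA.1; case: ifP => // xA.
have [bA bH bx bi] := bg x xA.
have xgA : to x g \in A by rewrite tA.1.
have [_ _ bxg _] := bg _ xgA.
rewrite bi in bxg *.
have [h hH hE] := act_conj_base bH bx bxg.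
by rewrite -actM hE actM; apply: wH.
Qed.

(** Coinduction replaces averaging. Over the PID there is an R-linear left inverse [rho] on the
    vectors of isotropy exactly [H]. Only its columns at the base points, which are linear
    functionals, are kept; the other columns are defined from them by equivariance. That the result
    is still a left inverse can be tested at base points. *)
Lemma equivariant_left_inverse A M : is_PID R -> isotropy_type A ->
  equivariant_mx to M ->
  (forall x y, M x y != 0 -> x \in A /\ 'C[y | to]%g = 'C[x | to]%g) ->
  (forall u : 'rV_N,
     (forall x, u 0 x != 0 -> x \in A /\ 'C[x | to]%g = H) ->
     u *m M = 0 -> u = 0) ->
  (forall (c : R) (v u : 'rV_N), c != 0 ->
     (forall x, u 0 x != 0 -> x \in A /\ 'C[x | to]%g = H) ->
     c *: v = u *m M ->
     exists2 u' : 'rV_N, (forall x, u' 0 x != 0 -> x \in A /\ 'C[x | to]%g = H) &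
       v = u' *m M) ->
  exists r : 'M[R]_N, [/\ equivariant_mx to r,
    forall x y, r y x != 0 -> x \in A /\ 'C[y | to]%g = 'C[x | to]%g
    & M *m r = prj R A].
Proof.
move=> pid tA eM MA inj pure.
pose S := [set x in A | 'C[x | to]%g == H :> {set gT}].
have SP x : x \in S <-> x \in A /\ 'C[x | to]%g = H.
  by rewrite inE; split=> [/andP[xA /eqP]|[-> ->]]; last rewrite eqxx.
pose I := \matrix_(i < #|S|, x < N) ((enum_val i == x)%:R : R).
have Isupp (u : 'rV_#|S|) x : (u *m I) 0 x != 0 -> x \in A /\ 'C[x | to]%g = H.
  move=> /neq0_mul[i [_]]; rewrite mxE.
  by case: (enum_val i =P x) => [<- _|_]; [apply/SP/enum_valP | rewrite eqxx].
have Isurj (u : 'rV_N) : (forall x, u 0 x != 0 -> x \in A /\ 'C[x | to]%g = H) ->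
    exists u', u = u' *m I.
  move=> uS; exists (\row_i u 0 (enum_val i)); apply/rowP => x; rewrite !mxE.
  have [xS|xS] := boolP (x \in S).
    rewrite (bigD1 (enum_rank_in xS x)) //= !mxE enum_rankK_in // eqxx mulr1.
    rewrite big1 ?addr0 // => i ni; rewrite !mxE; case: eqP => [e|]; last by rewrite mulr0.
    by case/eqP: ni; apply: enum_val_inj; rewrite enum_rankK_in.
  rewrite big1 => [|i _].
    by apply/eqP/negPn/negP => /uS/SP; rewrite (negPf xS).
  rewrite !mxE; case: eqP => [e|]; last by rewrite mulr0.
  by move: xS; rewrite -e enum_valP.
have Iinj (u : 'rV_#|S|) : u *m I = 0 -> u = 0.
  move=> /rowP u0; apply/rowP => i; have := u0 (enum_val i).
  rewrite !mxE (bigD1 i) //= mxE eqxx mulr1 big1 ?addr0 // => j ji.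
  by rewrite mxE (inj_eq enum_val_inj) (negPf ji) mulr0.
have [||rho rhoP] := @PID_left_inverse R _ _ (I *m M) pid.
- by move=> u; rewrite mulmxA => /inj u0; apply/Iinj/u0/Isupp.
- move=> c v u c0; rewrite mulmxA => e.
  have [u' /Isurj[u'' ->] ->] := pure c v _ c0 (@Isupp u) e.
  by exists u''; rewrite mulmxA.
pose rh := rho *m I.
have Mrh x z : x \in A -> 'C[x | to]%g = H -> (M *m rh) x z = (x == z)%:R.
  move=> xA xH; have xS : x \in S by apply/SP.
  have : (I *m M *m rho *m I) (enum_rank_in xS x) z = (x == z)%:R.
    by rewrite rhoP mul1mx mxE enum_rankK_in.
  rewrite -!mulmxA mulmxA -mulmxA -/rh => <-.
  rewrite [in RHS]mxE (bigD1 x) //= !mxE enum_rankK_in // eqxx mul1r.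
  rewrite [X in _ + X]big1 ?addr0 // => y yx.
  by rewrite !mxE enum_rankK_in // eq_sym (negPf yx) mul0r.
(* Transposed, since [extend_rows] propagates rows and here the columns of [rh] are to be
   propagated. *)
pose w := \matrix_(z, y) (if 'C[y | to]%g == H :> {set gT} then rh y z else 0).
have [|th [thJ [base [gam [bg thE]]]]] := @extend_rows A w tA.
  move=> z y h _ _ hH; rewrite !mxE astab1_to.
  have -> : ('C[y | to] :^ h == H :> {set gT})%g = ('C[y | to]%g == H :> {set gT}).
    by rewrite -{1}(conjGid hH) (inj_eq (@conjsg_inj _ h)).
  case: eqP => // yH.
  by have -> : to y h = y by apply/astab1P; rewrite yH.
exists th^T; split.
- by move=> g x y; rewrite !mxE thJ.
- move=> x y; rewrite mxE thE; case: ifP => [xA|]; last by rewrite eqxx.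
  rewrite mxE; case: ifP; last by rewrite eqxx.
  have [_ bH bx] := bg x xA.
  rewrite astab1_to => /eqP e _; split=> //.
  have := astab1_to (base x) (gam x).
  by rewrite bx bH => ->; rewrite -e -conjsgM mulVg conjsg1.
apply/matrixP => x x'; rewrite prjE mxE.
have -> : (x == x') && (x \in A) = (x == x') && (x' \in A) by case: eqP => // ->.
under eq_bigr => y _ do rewrite mxE thE.
have [xA'|xA'] := boolP (x' \in A); last first.
  by rewrite big1 ?andbF // => y _; rewrite mulr0.
have [bA bH bx] := bg x' xA'; set z := base x' in bA bH bx *.
rewrite (reindex_inj (act_inj to (gam x'))) /=.
under eq_bigr => y _ do rewrite actK mxE.
pose x1 := to x (gam x')^-1%g.
have Mx y : M x (to y (gam x')) = M x1 y.
  by rewrite -[x in LHS](actKV to (gam x')) eM.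
under eq_bigr => y _ do rewrite Mx.
have xx : (x == x') = (x1 == z).
  by rewrite -bx -(inj_eq (act_inj to (gam x')) x1) /x1 actKV.
rewrite andbT xx.
have [x1A|x1A] := boolP (x1 \in A); last first.
  rewrite big1 => [|y _]; last first.
    by have [->|/MA[]] := eqVneq (M x1 y) 0; [rewrite mul0r|rewrite (negPf x1A)].
  by case: eqP x1A => [->|//]; rewrite bA.
have [x1H|x1H] := pselect ('C[x1 | to]%g = H).
  rewrite -Mrh // mxE; apply: eq_bigr => y _.
  have [->|/MA[_ ->]] := eqVneq (M x1 y) 0; first by rewrite !mul0r.
  by rewrite x1H eqxx.
rewrite big1 => [|y _].
  by case: eqP x1H => [->|//]; rewrite bH.
have [->|/MA[_ ->]] := eqVneq (M x1 y) 0; first by rewrite !mul0r.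
by case: eqP; rewrite ?mulr0.
Qed.

End LeftInverse.

(** * Cells of one isotropy type *)

Lemma gmap_exists (gT : finGroupType) (K L : {group gT}) g :
  (forall k, k \in K -> (k ^ g)%g \in L) ->
  exists f : gmap K L, gapp f (obase K) = oact g (obase L).
Proof.
move=> KL.
pose f : {ffun orb K -> orb L} := [ffun x => oact (repr (val x) * g)%g (obase L)].
have fE a : f (oact a (obase K)) = oact (a * g)%g (obase L).
  rewrite ffunE; set b := repr _.
  have /oact_base_in abK : oact a (obase K) = oact b (obase K).
    by rewrite oact_repr.
  have -> : (b * g)%g = (a * g * (a^-1 * b) ^ g)%g.
    by rewrite -mulgA -conjgC mulgA mulKVg.
  by rewrite [LHS]oactM (oact_base (KL _ abK)).
have fP : equivariant f.
  apply/forallP => a; apply/forallP => x; apply/eqP.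
  by rewrite -[x]oact_repr -oactM !fE -[in LHS]mulgA [LHS]oactM.
by exists (GMap fP); rewrite /gapp /= -[obase K]oact1 fE mul1g.
Qed.

Section Facts.

Variables (gT : finGroupType) (R : idomainType) (F : {set {group gT}}).
Variables (N : nat) (to : {action gT &-> 'I_N}) (n : {group gT} -> int).
Implicit Types (H K L : {group gT}) (x y z : 'I_N) (C : bcx R to).

(** Restriction along an inclusion of subgroups leaves the row vector unchanged, so condition (ii),
    contained in [sf_inj] and [sf_surj], becomes a statement about supports and the single matrix
    [bd C]. *)
Record sphere_facts C : Prop := SphereFacts {
  sf_bd : forall K i (v : 'rV_N), K \in F -> (0 < i)%N -> i%:Z <> n K ->
    v \in xsupp C i K -> v *m bd C = 0 ->
    exists2 w : 'rV_N, w \in xsupp C i.+1 K & v = w *m bd C;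
  sf_tf : forall K i (a : R) (v w : 'rV_N), K \in F -> a != 0 ->
    v \in xsupp C i K -> v *m bd C = 0 ->
    w \in xsupp C i.+1 K -> a *: v = w *m bd C ->
    exists2 w' : 'rV_N, w' \in xsupp C i.+1 K & v = w' *m bd C;
  sf_basis0 : forall K, K \in F -> n K = 0 -> exists b u : 'rV_N,
    [/\ b \in xsupp C 0 K, u \in xsupp C 0 K,
        forall v : 'rV_N, v \in xsupp C 0 K -> exists (c a : R) (w : 'rV_N),
          w \in xsupp C 1 K /\ v = c *: b + a *: u + w *m bd C
      & forall (c a : R) (w : 'rV_N), w \in xsupp C 1 K ->
          c *: b + a *: u = w *m bd C -> c = 0 /\ a = 0];
  sf_inj : forall K L i (v w : 'rV_N), K \in F -> L \in F -> K \subset L ->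
    n K = n L -> v \in xsupp C i L -> v *m bd C = 0 ->
    w \in xsupp C i.+1 K -> v = w *m bd C ->
    exists2 w' : 'rV_N, w' \in xsupp C i.+1 L & v = w' *m bd C;
  sf_surj : forall K L i (v : 'rV_N), K \in F -> L \in F -> K \subset L ->
    n K = n L -> v \in xsupp C i K -> v *m bd C = 0 ->
    exists z w : 'rV_N, [/\ z \in xsupp C i L, w \in xsupp C i.+1 K
      & v = z + w *m bd C] }.

Lemma xsupp_bd C i K (v : 'rV_N) : v \in xsupp C i.+1 K ->
  v *m bd C \in xsupp C i K.
Proof.
by move=> vP; exact: (xhom_subproof (bd_mor C) (bd_degree i) (XSp vP)).
Qed.

Lemma xsupp_bd0 C K (v : 'rV_N) : v \in xsupp C 0 K -> v *m bd C = 0.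
Proof.
move=> /xsuppP vP.
apply/rowP => y; rewrite [RHS]mxE; apply/eqP/negPn/negP.
move=> /neq0_mul[x [/vP[dx _] /(bd_mor C).2[_ y0]]]; rewrite dx; lia.
Qed.

Lemma is_cycle_real C i (K : orbit_obj F) (v : real F C i K) :
  is_cycle v <-> xval v *m bd C = 0.
Proof.
case: i v => [|i] v; first by split=> // _; apply: (xsupp_bd0 (xspP v)).
by split=> [/(congr1 (@xval _ _ _ _ _ _ _))//|e]; apply: xval_inj.
Qed.

Lemma sphere_facts_real C (eps : rghom (real F C 0%N) (rg_const R F)) :
  sphere_like n eps ->
  (forall (K L : orbit_obj F) (f : gmap K L), n L = n K -> forall i,
     res_homology_inj (real F C) f i /\ res_homology_surj (real F C) f i) ->
  sphere_facts C.
Proof.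
move=> S Q; split.
- move=> K i v KF i0 ni vP vd; pose K' := OrbitObj KF.
  have [|w /(congr1 (@xval _ _ _ _ _ _ _)) e] :=
    @sphere_boundary _ _ _ _ _ _ S K' i (XSp vP) i0 ni.
    exact/is_cycle_real.
  by exists (xval w) => //; exact: xspP.
- move=> K i a v w KF a0 vP vd wP e; pose K' := OrbitObj KF.
  have [||w' /(congr1 (@xval _ _ _ _ _ _ _)) e'] :=
    @sphere_torsion_free _ _ _ _ _ _ S K' i (XSp vP) a (XSp wP) a0.
  + exact/is_cycle_real.
  + exact: xval_inj.
  by exists (xval w') => //; exact: xspP.
- move=> K KF n0; pose K' := OrbitObj KF.
  have [b [u [bu bu0]]] := @sphere0_basis _ _ _ _ _ _ S K' n0.
  exists (xval b), (xval u); split; try exact: xspP.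
  + move=> v vP; have [c [a [w /(congr1 (@xval _ _ _ _ _ _ _)) e]]] := bu (XSp vP).
    by exists c, a, (xval w); split; first exact: xspP.
  + move=> c a w wP e; apply: (bu0 c a (XSp wP)); exact: xval_inj.
- move=> K L i v w KF LF KL nKL vP vd wP e.
  pose K' := OrbitObj KF; pose L' := OrbitObj LF.
  have [|f fE] := @gmap_exists _ K L 1%g.
    by move=> k kK; rewrite conjg1 (subsetP KL).
  have [inj _] := Q K' L' f (esym nKL) i.
  have [||w' /(congr1 (@xval _ _ _ _ _ _ _)) e'] := inj (XSp vP) _ (XSp wP).
  + exact/is_cycle_real.
  + by apply: xval_inj; rewrite (xresE _ fE) vact1.
  by exists (xval w') => //; exact: xspP.
- move=> K L i v KF LF KL nKL vP vd.
  pose K' := OrbitObj KF; pose L' := OrbitObj LF.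
  have [|f fE] := @gmap_exists _ K L 1%g.
    by move=> k kK; rewrite conjg1 (subsetP KL).
  have [_ surj] := Q K' L' f (esym nKL) i.
  have [|z [w [zc /(congr1 (@xval _ _ _ _ _ _ _)) e]]] := surj (XSp vP).
    exact/is_cycle_real.
  exists (xval z), (xval w); split; try exact: xspP.
  by move: e => /=; rewrite -[vact _ _ _]/(xval (xres f z)) (xresE _ fE) vact1.
Qed.

Definition type_vec C H i (u : 'rV[R]_N) :=
  forall x, u 0 x != 0 -> C x = i.+1 /\ 'C[x | to]%g = H.

Definition same_dim_overgroups H :=
  [set K in F | (H \proper K) && (n K == n H)].

(** * Offending cells: isotropy group H, degree t + 1 > n(H) = m, with larger isotropy groups
    already tight *)

Section Tightness.

Variables (C : bcx R to) (facts : sphere_facts C).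
Hypothesis stabF : forall x, ('C[x | to])%G \in F.
Hypothesis mono : monotone n.
Hypothesis join : forall K L M, K \in F -> L \in F -> M \in F ->
  K \subset L -> K \subset M -> n K = n L -> n K = n M -> -1 < n K ->
  (L <*> M)%G \in F /\ n (L <*> M)%G = n K.

Variables (H : {group gT}) (m t : nat).
Hypotheses (HF : H \in F) (nH : n H = m%:Z) (mt : (m <= t)%N).
Hypothesis tight : forall x, H \proper 'C[x | to]%g -> (0 < C x)%N ->
  (C x)%:Z <= n ('C[x | to])%G + 1.
Hypothesis top : forall x, 'C[x | to]%g = H -> C x <> t.+3.

Local Notation P := (same_dim_overgroups H).
Local Notation typeH := (type_vec C H).

Let PP K : reflect [/\ K \in F, H \proper K & n K = n H] (K \in P).
Proof.
by rewrite inE; apply: (iffP and3P) => -[-> -> /eqP].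
Qed.

Let PJ K L : K \in P -> L \in P -> (K <*> L)%G \in P.
Proof.
move=> /PP[KF HK nK] /PP[LF HL nL].
have [|JF nJ] := join HF KF LF (proper_sub HK) (proper_sub HL) (esym nK) (esym nL).
  by rewrite nH.
apply/PP; split=> //.
by apply: proper_sub_trans HK _; exact: joing_subl.
Qed.

(** A member of largest order absorbs its join with any other, as [P] is closed under joins. *)
Let top_P : P != finset.set0 -> exists2 K0, K0 \in P & forall K, K \in P -> K \subset K0.
Proof.
move=> /set0Pn[K1 K1P].
case: (arg_maxnP (fun K : {group gT} => #|K|) K1P) => K0 K0P K0max.
exists K0 => // K KP.
have JP := PJ KP K0P.
have /eqP -> : K0 == (K <*> K0)%G :> {set gT}.
  by rewrite eqEcard joing_subr; exact: K0max JP.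
exact: joing_subl.
Qed.

(** Tightness and monotonicity give [C x <= n + 1 <= m + 1 <= t + 1], where [n] is taken at the
    isotropy group of [x]. So a cell of larger isotropy in degree at least [t] forces equality
    everywhere: only groups in [P] matter above [H], and only in degree [t]. *)
Let upper x : H \proper 'C[x | to]%g -> (t < C x)%N ->
  C x = t.+1 /\ ('C[x | to])%G \in P.
Proof.
move=> Hx tx.
have := tight Hx (leq_ltn_trans (leq0n _) tx).
have : n ('C[x | to])%G <= n H.
  by apply: mono; exists 1%g; rewrite conjsg1; exact: proper_sub Hx.
rewrite nH => h1 h2.
have e : C x = t.+1 by lia.
split=> //; apply/PP; split=> //.
by rewrite nH; lia.
Qed.

(** The degree [i] part of the sum of the subcomplexes C(K), K in [S]: the chains on the union of
    the fixed point sets. *)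
Let fixU (S : seq {group gT}) i (v : 'rV[R]_N) :=
  forall x, v 0 x != 0 ->
    C x = i.+1 /\ has (fun K : {group gT} => K \subset 'C[x | to]%g) S.

Let xsuppB i K (v w : 'rV[R]_N) :
  v \in xsupp C i K -> w \in xsupp C i K -> v - w \in xsupp C i K.
Proof. by move=> vP wP; have /= := valP (XSp vP - XSp wP). Qed.

Let xsuppD i K (v w : 'rV[R]_N) :
  v \in xsupp C i K -> w \in xsupp C i K -> v + w \in xsupp C i K.
Proof. by move=> vP wP; have /= := valP (XSp vP + XSp wP). Qed.

Let xsuppS i K L (v : 'rV[R]_N) : K \subset L ->
  v \in xsupp C i L -> v \in xsupp C i K.
Proof.
move=> KL /xsuppP vP; apply/xsuppP => x /vP[-> ?]; split=> //.
exact: subset_trans KL _.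
Qed.

Let dsq (v : 'rV[R]_N) : v *m bd C *m bd C = 0.
Proof. by rewrite -mulmxA bd_sq mulmx0. Qed.

Let fixU_bd S i v : fixU S i.+1 v -> fixU S i (v *m bd C).
Proof.
move=> vU y /neq0_mul[x [/vU[xi xS] xy]].
have [[_ s1] s2] := bd_mor C; have [_ y0 e] := s2 _ _ xy.
split; first by move: e; rewrite xi; lia.
by apply: sub_has xS => K /= Kx; apply: subset_trans Kx (s1 _ _ xy).
Qed.

(* A Mayer-Vietoris argument: P is closed under joins, so the intersection of
   two of the subcomplexes C(K), K in P, is again of this form. *)
Let fixU_acyclic K0 : K0 \in P -> (forall K, K \in P -> K \subset K0) ->
  forall S i v, all [in P] S -> S <> [::] -> fixU S i v ->
  (forall x, (v *m bd C) 0 x != 0 -> K0 \subset 'C[x | to]%g) ->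
  exists z w : 'rV[R]_N, [/\ z \in xsupp C i K0, fixU S i.+1 w
    & v = z + w *m bd C].
Proof.
move=> K0P K0max.
(* A single group: C(K) relative to C(K0) is acyclic by condition (ii), the two dimensions being
   equal. *)
have base K i (v : 'rV[R]_N) : K \in P -> v \in xsupp C i K ->
    (forall x, (v *m bd C) 0 x != 0 -> K0 \subset 'C[x | to]%g) ->
    exists z w : 'rV[R]_N, [/\ z \in xsupp C i K0, w \in xsupp C i.+1 K
      & v = z + w *m bd C].
  move=> KP vP vK0; have KK0 := K0max K KP.
  have [/PP[KF _ nK] /PP[K0F _ nK0]] := (KP, K0P).
  have nKK0 : n K = n K0 by rewrite nK nK0.
  have [z' z'P z'E] : exists2 z', z' \in xsupp C i K0 & v *m bd C = z' *m bd C.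
    case: i vP => [|i] vP.
      exists 0; first by apply/xsuppP => x; rewrite mxE eqxx.
      by rewrite (xsupp_bd0 vP) mul0mx.
    apply: (sf_inj facts KF K0F KK0 nKK0 _ (dsq v) vP erefl).
    apply/xsuppP => x vx; split; last exact: vK0.
    by have /xsuppP/(_ x vx)[] := xsupp_bd vP.
  have [|z [w [zP wP e]]] := sf_surj facts KF K0F KK0 nKK0 (xsuppB vP (xsuppS KK0 z'P)).
    by rewrite mulmxBl z'E subrr.
  exists (z' + z), w; split=> //; first exact: xsuppD.
  by rewrite -addrA -e addrC subrK.
move=> S; have [k] := ubnP (size S); elim: k S => // k IH [//|K S] /=.
rewrite ltnS => Sk i v /andP[KP SP] _ vU vK0.
case: (eqVneq S [::]) => [S0|/eqP S0].
  have [|z [w [zP wP e]]] := base K i v KP _ vK0.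
    by apply/xsuppP => x /vU[-> /=]; rewrite S0 orbF.
  exists z, w; split=> // x; have /xsuppP wP' := wP.
  by move=> /wP'[-> Kx]; rewrite /= Kx.
(* [b] is the part of [v] on [K]-fixed cells and [a] the rest. Up to C(K0), the boundary of [a] lies
   in both subcomplexes, hence on the joins [J]. Induction on the length turns it into the boundary
   of some [c] there, and then [a - c] and [b + c] can be treated separately. *)
pose b : 'rV[R]_N := \row_x if K \subset 'C[x | to]%g then v 0 x else 0.
pose a := v - b.
have bP : b \in xsupp C i K.
  apply/xsuppP => x; rewrite mxE; case: ifP => [Kx /vU[]//|]; by rewrite eqxx.
have aU : fixU S i a.
  move=> x; rewrite !mxE; case: ifP => [_|Kx]; first by rewrite subrr eqxx.
  by rewrite subr0 => /vU[-> /=]; rewrite Kx.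
pose J := [seq (K <*> L)%G | L <- S].
have JP : all [in P] J.
  by apply/allP => _ /mapP[L LS ->]; apply: PJ => //; exact: (allP SP).
have JS : (size J < k)%N by rewrite size_map.
have J0 : J <> [::] by rewrite /J; case: (S) S0.
have hasJ x : has (fun L : {group gT} => L \subset 'C[x | to]%g) S ->
    K \subset 'C[x | to]%g -> has (fun L : {group gT} => L \subset 'C[x | to]%g) J.
  move=> /hasP[L LS Lx] Kx; apply/hasP; exists (K <*> L)%G; first exact: map_f.
  by rewrite join_subG Kx.
have JU (w : 'rV[R]_N) i' : fixU J i' w -> fixU S i' w /\ w \in xsupp C i' K.
  move=> wJ; split=> [x /wJ[-> /hasP[_ /mapP[L LS ->]]]|].
    rewrite join_subG => /andP[_ Lx]; split=> //; by apply/hasP; exists L.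
  apply/xsuppP => x /wJ[-> /hasP[_ /mapP[L LS ->]]].
  by rewrite join_subG => /andP[].
have [z' [c [z'E cJ adE]]] : exists z' c : 'rV[R]_N,
    [/\ forall x, z' 0 x != 0 -> K0 \subset 'C[x | to]%g, fixU J i c
      & a *m bd C = z' + c *m bd C].
  case: i vU bP aU => [|i] vU bP aU.
    exists 0, 0; split; try by move=> x; rewrite mxE eqxx.
    rewrite mul0mx addr0 mulmxBl (xsupp_bd0 bP) subr0.
    by apply: (@xsupp_bd0 _ 1%G); apply/xsuppP => x /vU[-> _]; rewrite sub1G.
  have [||z' [c [z'P cJ e]]] := IH J JS i (a *m bd C) JP J0.
  - move=> x ax; have [xi xS] := fixU_bd aU ax; split=> //; apply: hasJ => //.
    move: ax; rewrite mulmxBl => /neq0_add[/vK0|].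
      exact: subset_trans (K0max K KP).
    rewrite mxE oppr_eq0.
    by have /xsuppP bdP := xsupp_bd bP; move=> /bdP[].
  - by move=> x; rewrite dsq mxE eqxx.
  exists z', c; split=> // x; have /xsuppP z'K := z'P.
  by move=> /z'K[].
have [cS cK] := JU _ _ cJ.
have [||z1 [w1 [z1P w1S e1]]] := IH S Sk i (a - c) SP S0.
- by move=> x /neq0_add[/aU //|]; rewrite mxE oppr_eq0 => /cS.
- by rewrite mulmxBl adE addrK.
have [|z2 [w2 [z2P w2K e2]]] := base K i (b + c) KP (xsuppD bP cK).
  have -> : (b + c) *m bd C = v *m bd C - z'.
    have -> : v = a + b by rewrite /a subrK.
    clearbody a; rewrite !mulmxDl adE addrAC (addrC z') addrK addrC //.
  by move=> x /neq0_add[/vK0 //|]; rewrite mxE oppr_eq0 => /z'E.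
exists (z1 + z2), (w1 + w2); split; first exact: xsuppD.
- move=> x /neq0_add[/w1S[-> w1x]|]; first by rewrite /= w1x orbT.
  by have /xsuppP w2P := w2K; move=> /w2P[-> Kx]; rewrite /= Kx.
- have -> : v = (a - c) + (b + c) by rewrite addrA addrAC subrK addrC addrC subrK.
  by rewrite e1 e2 mulmxDl addrACA.
Qed.

Let eq_or_proper x : H \subset 'C[x | to]%g ->
  'C[x | to]%g = H \/ H \proper 'C[x | to]%g.
Proof.
move=> Hx; have [/eqP e|nH'] := boolP (H == 'C[x | to]%g :> {set gT}).
  by left; rewrite -e.
by right; rewrite properEneq nH'.
Qed.

Let typeH_xsupp i u : typeH i u -> u \in xsupp C i H.
Proof. by move=> uH; apply/xsuppP => x /uH[-> ->]. Qed.

Let xsupp_typeH u : u \in xsupp C t.+1 H -> typeH t.+1 u.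
Proof.
move=> /xsuppP uP x /uP[xt /eq_or_proper[//|Hx]].
by have [] := upper Hx; rewrite xt // => -[] /eqP; rewrite eqn_leq ltnn.
Qed.

Let xsupp_top (u : 'rV[R]_N) : u \in xsupp C t.+2 H -> u = 0.
Proof.
move=> /xsuppP uP; apply/rowP => x; rewrite mxE; apply/eqP/negPn/negP.
move=> /uP[xt /eq_or_proper[/top //|Hx]].
by have [] := upper Hx; rewrite xt //; lia.
Qed.

Let upperP (v : 'rV[R]_N) : v \in xsupp C t H ->
  (forall x, 'C[x | to]%g = H -> v 0 x = 0) -> fixU (enum P) t v.
Proof.
move=> /xsuppP vP v0 x vx; have [xt Hx] := vP x vx; split=> //.
case: (eq_or_proper Hx) => [/v0 e|{}Hx]; first by rewrite e eqxx in vx.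
have [|_ xP] := upper Hx; first by rewrite xt.
by apply/hasP; exists ('C[x | to])%G; rewrite ?mem_enum.
Qed.

Let above_t K0 (w : 'rV[R]_N) : K0 \in P -> w \in xsupp C t.+1 K0 -> w = 0.
Proof.
move=> /PP[_ HK0 _] /xsuppP wP; apply/rowP => x; rewrite mxE; apply/eqP/negPn/negP.
move=> /wP[xt Kx]; have [] := upper (proper_sub_trans HK0 Kx); rewrite xt //; lia.
Qed.

Let Penum : all [in P] (enum P).
Proof. by apply/allP => K; rewrite mem_enum. Qed.

Let Penum0 : P != finset.set0 -> enum P <> [::].
Proof. by move=> /set0Pn[K KP]; have := mem_enum P K; rewrite KP; case: (enum P). Qed.

Let fixU_above (w : 'rV[R]_N) : fixU (enum P) t.+1 w -> w = 0.
Proof.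
move=> wU; apply/rowP => x; rewrite mxE; apply/eqP/negPn/negP.
move=> /wU[xt /hasP[K]]; rewrite mem_enum => /PP[_ HK _] Kx.
have [] := upper (proper_sub_trans HK Kx); rewrite xt //; lia.
Qed.

Let fixU_empty i (v : 'rV[R]_N) : P = finset.set0 -> fixU (enum P) i v -> v = 0.
Proof.
move=> P0 vU; apply/rowP => x; rewrite mxE; apply/eqP/negPn/negP.
by move=> /vU[_ /hasP[K]]; rewrite mem_enum P0 inE.
Qed.

(** If [u d] has no type-H part, it lies in the sum of the C(K), K in [P], and by relative
    acyclicity in C(K0), since that sum has no chains in degree [t + 1]. Being a boundary over [H],
    it is one over [K0], hence zero. So [u] is a cycle above the dimension of the sphere, hence a
    boundary, and there are no chains in degree [t + 2]. *)
Lemma top_cells_inj (u : 'rV[R]_N) : typeH t.+1 u ->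
  (forall y, 'C[y | to]%g = H -> (u *m bd C) 0 y = 0) -> u = 0.
Proof.
move=> uH u0; have uP := typeH_xsupp uH.
have udU := upperP (xsupp_bd uP) u0.
suff ud : u *m bd C = 0.
  have [||w /xsupp_top -> ->] := sf_bd facts HF _ _ uP ud => //.
    by rewrite nH; lia.
  by rewrite mul0mx.
have [P0|P0] := eqVneq P finset.set0; first exact: fixU_empty udU.
have [K0 K0P K0max] := top_P P0; have /PP[K0F HK0 nK0] := K0P.
have [|z [w [zP /fixU_above -> ]]] := fixU_acyclic K0P K0max Penum (Penum0 P0) udU.
  by move=> x; rewrite dsq mxE eqxx.
rewrite mul0mx addr0 => e; rewrite -e in zP.
have [w' /(above_t K0P) ->] := sf_inj facts HF K0F (proper_sub HK0) (esym nK0) zP (dsq u) uP erefl.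
by rewrite mul0mx.
Qed.

Let fixU_typeH i (v : 'rV[R]_N) y : fixU (enum P) i v -> 'C[y | to]%g = H -> v 0 y = 0.
Proof.
move=> vU yH; apply/eqP/negPn/negP => /vU[_ /hasP[K]].
by rewrite mem_enum yH => /PP[_ HK _]; rewrite (negPf (proper_subn HK)).
Qed.

Let xsupp_above0 K0 i (v : 'rV[R]_N) y : K0 \in P -> v \in xsupp C i K0 ->
  'C[y | to]%g = H -> v 0 y = 0.
Proof.
move=> /PP[_ HK0 _] /xsuppP vP yH; apply/eqP/negPn/negP => /vP[_].
by rewrite yH (negPf (proper_subn HK0)).
Qed.

(** If [P] is empty, [v] is a cycle and torsion-freeness of homology applies. Otherwise [v] is
    corrected by a chain without type-H part to a cycle over [H], which is homologous to a cycle
    over [K0]; the type-H part of this relation is the claim. *)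
Lemma top_cells_pure (a : R) (v u : 'rV[R]_N) : a != 0 -> typeH t v ->
  typeH t.+1 u ->
  (forall y, 'C[y | to]%g = H -> a * v 0 y = (u *m bd C) 0 y) ->
  exists2 u' : 'rV[R]_N, typeH t.+1 u' &
    forall y, 'C[y | to]%g = H -> v 0 y = (u' *m bd C) 0 y.
Proof.
move=> a0 vH uH e; have vP := typeH_xsupp vH; have uP := typeH_xsupp uH.
pose y := u *m bd C - a *: v.
have yU : fixU (enum P) t y.
  apply: upperP => [|x /e ex]; last by rewrite [LHS]mxE -ex [X in _ + X]mxE [X in _ - X]mxE subrr.
  apply: xsuppB; first exact: xsupp_bd.
  by have /= := valP (a *: XSp vP).
have avd : a *: (v *m bd C) = - (y *m bd C).
  by rewrite /y mulmxBl dsq sub0r opprK scalemxAl.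
have [P0|P0] := eqVneq P finset.set0.
  have y0 := fixU_empty P0 yU.
  have vd : v *m bd C = 0.
    have /eqP := avd; rewrite y0 mul0mx oppr0 scalemx_eq0 (negPf a0) /=.
    by move/eqP.
  have [|w' w'P ->] := sf_tf facts HF a0 vP vd uP.
    by apply/eqP; rewrite eq_sym -subr_eq0 -/y y0.
  by exists w' => //; exact: xsupp_typeH.
have [K0 K0P K0max] := top_P P0; have /PP[K0F HK0 nK0] := K0P.
have HK0' := proper_sub HK0.
(* The hypothesis on [u] enters only through [v d]: a nonzero multiple of it lies in the sum of the
   C(K), hence so does [v d], as [R] is a domain. Relative acyclicity and injectivity of restriction
   from [K0] to [H] then produce [v1]. *)
suff [v1 [v1H v1P v1d]] : exists v1 : 'rV[R]_N,
    [/\ forall x, 'C[x | to]%g = H -> v1 0 x = 0, v1 \in xsupp C t H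
      & v *m bd C = v1 *m bd C].
  have [|z [w [zP wP e1]]] :=
    sf_surj facts HF K0F HK0' (esym nK0) (xsuppB vP v1P).
    by rewrite mulmxBl v1d subrr.
  exists w; first exact: xsupp_typeH.
  move=> x xH; have := congr1 (fun r : 'rV_N => r 0 x) e1.
  rewrite ![in LHS]mxE v1H // subr0 => ->.
  by rewrite mxE (xsupp_above0 K0P zP xH) add0r.
have [t0|[t' tE]] : t = 0%N \/ exists t', t = t'.+1.
- by case: (t) => [|t']; [left|right; exists t'].
- exists 0; split=> [x _||]; first by rewrite mxE.
    by apply/xsuppP => x; rewrite mxE eqxx.
  by rewrite mul0mx; apply: (@xsupp_bd0 C H); move: vP; rewrite t0.
have vdP : v *m bd C \in xsupp C t' H by apply: xsupp_bd; rewrite -tE.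
have vdU : fixU (enum P) t' (v *m bd C).
  move=> x vx; have /xsuppP/(_ x vx)[xt _] := vdP; split=> //.
  have : (- (y *m bd C)) 0 x != 0.
    by rewrite -avd mxE mulf_neq0.
  rewrite mxE oppr_eq0 => yx; rewrite tE in yU.
  by have [] := fixU_bd yU yx.
have [|z0 [y' [z0P y'U e0]]] := fixU_acyclic K0P K0max Penum (Penum0 P0) vdU.
  by move=> x; rewrite dsq mxE eqxx.
rewrite -tE in y'U.
have y'P : y' \in xsupp C t H.
  apply/xsuppP => x /y'U[-> /hasP[K]]; rewrite mem_enum => /PP[_ HK _] Kx.
  by split=> //; apply: subset_trans (proper_sub HK) Kx.
have vyP : v - y' \in xsupp C t'.+1 H by rewrite -tE; exact: xsuppB.
have z0E : z0 = (v - y') *m bd C by rewrite mulmxBl e0 addrK.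
have z0d : z0 *m bd C = 0 by rewrite z0E dsq.
have [z1] := sf_inj facts HF K0F HK0' (esym nK0) z0P z0d vyP z0E.
rewrite -tE => z1P z1E.
exists (y' + z1); split.
- move=> x xH; rewrite mxE (fixU_typeH y'U xH) (xsupp_above0 K0P z1P xH).
  by rewrite addr0.
- exact: xsuppD y'P (xsuppS HK0' z1P).
- by rewrite e0 z1E mulmxDl addrC.
Qed.

(** In degree 0 every vector is a cycle, so over [H] it is a boundary up to a chain of C(K0), and
    such chains have no type-H part. *)
Lemma top_cells_surj : t = 0%N -> P != finset.set0 ->
  forall v : 'rV[R]_N, typeH t v -> exists2 u' : 'rV[R]_N, typeH t.+1 u' &
    forall y, 'C[y | to]%g = H -> v 0 y = (u' *m bd C) 0 y.
Proof.
move=> t0 P0 v vH; have vP := typeH_xsupp vH.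
have [K0 K0P K0max] := top_P P0; have /PP[K0F HK0 nK0] := K0P.
have vd : v *m bd C = 0 by apply: (@xsupp_bd0 C H); move: vP; rewrite t0.
have [z [w [zP wP e]]] := sf_surj facts HF K0F (proper_sub HK0) (esym nK0) vP vd.
exists w; first exact: xsupp_typeH.
by move=> x xH; rewrite e mxE (xsupp_above0 K0P zP xH) add0r.
Qed.

Lemma no_upper_typeH i (v : 'rV[R]_N) : P = finset.set0 -> (t <= i)%N ->
  v \in xsupp C i H -> typeH i v.
Proof.
move=> P0 ti /xsuppP vP x /vP[xi /eq_or_proper[//|Hx]].
by have [] := upper Hx; rewrite ?xi // P0 inE.
Qed.

End Tightness.

End Facts.

Section Step.

Variables (gT : finGroupType) (R : idomainType) (F : {set {group gT}}).
Variables (N : nat) (to : {action gT &-> 'I_N}) (n : {group gT} -> int).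
Implicit Types (K L : {group gT}) (x y z : 'I_N).

Variables (C : bcx R to) (facts : sphere_facts F n C).
Hypothesis pid : is_PID R.
Hypothesis stabF : forall x, ('C[x | to])%G \in F.
Hypothesis mono : monotone n.
Hypothesis join : forall K L M, K \in F -> L \in F -> M \in F ->
  K \subset L -> K \subset M -> n K = n L -> n K = n M -> -1 < n K ->
  (L <*> M)%G \in F /\ n (L <*> M)%G = n K.

Variables (H : {group gT}) (m t : nat).
Hypotheses (HF : H \in F) (nH : n H = m%:Z) (mt : (m <= t)%N).
Hypothesis tight : forall x, H \proper 'C[x | to]%g -> (0 < C x)%N ->
  (C x)%:Z <= n ('C[x | to])%G + 1.
Hypothesis top : forall x, 'C[x | to]%g = H -> C x <> t.+3.

Definition type_cells i : {set 'I_N} :=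
  [set x | (C x == i.+1) && [exists g, 'C[to x g | to]%g == H :> {set gT}]].

Lemma type_cellsP i x : reflect (C x = i.+1 /\ exists g, 'C[to x g | to]%g = H)
  (x \in type_cells i).
Proof.
rewrite inE; apply: (iffP andP) => -[/eqP xi].
  by move=> /existsP[g /eqP]; split=> //; exists g.
by case=> g xg; split=> //; apply/existsP; exists g; apply/eqP.
Qed.

Lemma type_cells_isotropy i : isotropy_type to H (type_cells i).
Proof.
split=> [x g|x /type_cellsP[] //].
apply/type_cellsP/type_cellsP; rewrite gradeJ => -[xi [h xh]]; split=> //.
  by exists (g * h)%g; rewrite actM.
by exists (g^-1 * h)%g; rewrite actM actK.
Qed.

Lemma mem_type_cells i x : C x = i.+1 -> 'C[x | to]%g = H -> x \in type_cells i.
Proof.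
by move=> xi xH; apply/type_cellsP; split=> //; exists 1%g; rewrite act1.
Qed.

Local Notation A := (type_cells t.+1).
Local Notation B := (type_cells t).
Local Notation p := (prj R A).
Local Notation b := (prj R B).
Local Notation d := (bd C).

Definition incidence : 'M[R]_N := p *m d *m b.
Local Notation M := incidence.

Let AB x : x \in A -> x \in B -> False.
Proof. by move=> /type_cellsP[x1 _] /type_cellsP[x2 _]; move: x1; rewrite x2; lia. Qed.

(** Admissibility gives one inclusion of isotropy groups, and both have the order of [H]. *)
Lemma incidence_neq0 x y : M x y != 0 ->
  [/\ x \in A, y \in B & 'C[y | to]%g = 'C[x | to]%g].
Proof.
move=> /neq0_prjr[yB /neq0_prjl[xA /(bd_mor C).1.2 xy]]; split=> //.
apply/esym/eqP; rewrite eqEcard xy.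
rewrite (isotropy_card (type_cells_isotropy _) xA).
by rewrite (isotropy_card (type_cells_isotropy _) yB) leqnn.
Qed.

Lemma incidence_equivariant : equivariant_mx to M.
Proof.
have [sA _] := type_cells_isotropy t.+1; have [sB _] := type_cells_isotropy t.
have [dJ _] := (bd_mor C).1.
by move=> g x y; rewrite !prj_mulr !prj_mull sA sB dJ.
Qed.

Lemma incidenceE (u : 'rV[R]_N) : type_vec C H t.+1 u ->
  forall y, (u *m M) 0 y = if 'C[y | to]%g == H :> {set gT} then (u *m d) 0 y else 0.
Proof.
move=> uH y.
have up : u *m p = u.
  apply/rowP => x; rewrite mul_mx_diag !mxE.
  have [->|/uH[xi xH]] := eqVneq (u 0 x) 0; first by rewrite mul0r.
  by rewrite (mem_type_cells xi xH) mulr1.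
case: ifP => [/eqP yH|yH]; last first.
  apply/eqP/negPn/negP => /neq0_mul[x [/uH[_ xH] /incidence_neq0[_ _]]].
  by rewrite xH => e; rewrite e eqxx in yH.
rewrite !mulmxA up mul_mx_diag [LHS]mxE [(\row__ _) _ _]mxE.
have [->|] := eqVneq ((u *m d) 0 y) 0; first by rewrite mul0r.
move=> /neq0_mul[x [/uH[xi _] /(bd_mor C).2[_ _]]]; rewrite xi => e.
by rewrite mem_type_cells ?mulr1 //; move: e; lia.
Qed.

Let A_vec (u : 'rV[R]_N) : (forall x, u 0 x != 0 -> x \in A /\ 'C[x | to]%g = H) <->
  type_vec C H t.+1 u.
Proof.
split=> uH x /uH[xA xH]; split=> //; last exact: mem_type_cells.
by case/type_cellsP: xA.
Qed.

Lemma incidence_inj (u : 'rV[R]_N) : type_vec C H t.+1 u -> u *m M = 0 -> u = 0.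
Proof.
move=> uH uM0; apply: (top_cells_inj facts stabF mono join HF nH mt tight top uH).
by move=> y yH; have := incidenceE uH y; rewrite yH eqxx uM0 => <-; rewrite mxE.
Qed.

Lemma incidence_vec (u : 'rV[R]_N) : type_vec C H t.+1 u -> type_vec C H t (u *m M).
Proof.
move=> uH y /neq0_mul[x [/uH[_ xH] /incidence_neq0[_ /type_cellsP[yt _] ->]]].
by split.
Qed.

Lemma incidence_pure (c : R) (v u : 'rV[R]_N) : c != 0 -> type_vec C H t.+1 u ->
  c *: v = u *m M -> exists2 u', type_vec C H t.+1 u' & v = u' *m M.
Proof.
move=> c0 uH e.
have vH : type_vec C H t v.
  move=> y vy; apply: (incidence_vec uH); rewrite -e mxE.
  exact: mulf_neq0.
have [|u' u'H u'E] := top_cells_pure facts stabF mono join HF nH mt tight c0 vH uH.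
  by move=> y yH; have := incidenceE uH y; rewrite yH eqxx -e mxE.
exists u' => //; apply/rowP => y; rewrite incidenceE //.
case: eqP => [/u'E //|yH].
by apply/eqP/negPn/negP => /vH[_].
Qed.

Lemma incidence_left_inverse : exists r : 'M[R]_N,
  [/\ equivariant_mx to r,
      forall x y, r y x != 0 -> [/\ x \in A, y \in B & 'C[y | to]%g = 'C[x | to]%g]
    & M *m r = p].
Proof.
have [|||r [rJ rP Mr]] :=
  equivariant_left_inverse pid (type_cells_isotropy t.+1) incidence_equivariant.
- by move=> x y /incidence_neq0[].
- by move=> u /A_vec; exact: incidence_inj.
- move=> c v u c0 /A_vec uH e; have [u' /A_vec u'H ->] := incidence_pure c0 uH e.
  by exists u'.
have [sB _] := type_cells_isotropy t.
exists (b *m r); split.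
- by move=> g x y; rewrite !prj_mull sB rJ.
- by move=> x y /neq0_prjl[yB /rP[]].
- by rewrite mulmxA /incidence -(mulmxA (p *m d)) prj_id.
Qed.

Lemma fold_top e : t = e.+1 -> exists D : bcx R to,
  homotopy_equivalent (real F C) (real F D) /\
  forall x, D x = if x \in A then e.+1 else C x.
Proof.
move=> te; have [r [rJ rP Mr]] := incidence_left_inverse.
have [sA _] := type_cells_isotropy t.+1.
apply: (@fold_step _ _ _ _ _ _ _ sA e r).
- by move=> x /type_cellsP[->]; rewrite te.
- split; first by split=> // y x /rP[_ _ ->].
  by move=> y x /rP[/type_cellsP[-> _] /type_cellsP[-> _] _]; split=> //; lia.
- by apply: prj_mulr_id => y x /rP[].
- have br : b *m r = r by apply: prj_mull_id => y x /rP[].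
  by rewrite -{2}Mr /incidence -[RHS]mulmxA br.
Qed.

Let rows_eq (X Y : 'M[R]_N) : equivariant_mx to X -> equivariant_mx to Y ->
  (forall y z, y \in B -> 'C[y | to]%g = H -> X y z = Y y z) ->
  b *m X = b *m Y.
Proof.
move=> XJ YJ e; apply/matrixP => y z; rewrite !prj_mull.
case yB: (y \in B); last by rewrite !mul0r.
have [sB tB] := type_cells_isotropy t; have [g yg] := tB y yB.
by rewrite -(XJ g) -(YJ g) e // sB.
Qed.

(** By surjectivity the left inverse [rho] of [M + th] is a two-sided inverse on [B]. Its columns at
    [A] and at [E] are the maps [r] and [ta] required by [delete_step]. *)
Lemma delete_completed (E : {set 'I_N}) (th : 'M[R]_N) : t = 0%N ->
  stable to E -> E \subset B -> equivariant_mx to th ->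
  (forall x y, th x y != 0 ->
    [/\ x \in E, y \in B & 'C[y | to]%g = 'C[x | to]%g]) ->
  (forall u : 'rV[R]_N,
    (forall x, u 0 x != 0 -> x \in A :|: E /\ 'C[x | to]%g = H) ->
    u *m (M + th) = 0 -> u = 0) ->
  (forall v : 'rV[R]_N, type_vec C H t v -> exists2 u : 'rV[R]_N,
    (forall x, u 0 x != 0 -> x \in A :|: E /\ 'C[x | to]%g = H) &
    v = u *m (M + th)) ->
  exists D : bcx R to,
  homotopy_equivalent (real F C) (real F D) /\
  forall x, D x = if x \in A :|: (B :\: E) then 0%N else C x.
Proof.
move=> t0 sE EB thJ thP inj surj.
have tA := type_cells_isotropy t.+1; have tB := type_cells_isotropy t.
have tAE : isotropy_type to H (A :|: E).
  split; first exact: stableU tA.1 sE.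
  by move=> x; rewrite in_setU => /orP[/tA.2 //|/(subsetP EB)/tB.2].
pose Psi := M + th.
have PsiJ : equivariant_mx to Psi.
  by move=> g x y; rewrite mxE incidence_equivariant thJ [RHS]mxE.
have PsiP x y : Psi x y != 0 ->
    [/\ x \in A :|: E, y \in B & 'C[y | to]%g = 'C[x | to]%g].
  rewrite in_setU.
  move=> /neq0_add[/incidence_neq0[-> yB ->]|/thP[-> yB ->]]; rewrite ?orbT; split=> //.
have [|||rho [rhoJ rhoP Mrho]] := equivariant_left_inverse pid tAE PsiJ.
- by move=> x y /PsiP[].
- exact: inj.
- move=> c v u c0 uP e; have [|u' u'P ->] := surj v; last by exists u'.
  move=> y vy.
  have : (u *m Psi) 0 y != 0 by rewrite -e mxE mulf_neq0.
  move=> /neq0_mul[x [/uP[_ xH] /PsiP[_ /type_cellsP[yt _] ->]]].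
  by split.
pose e := prj R E.
have brho : b *m rho *m Psi = b.
  rewrite -[RHS]mulmx1 -mulmxA; apply: rows_eq.
  - move=> g x y; rewrite !mxE (reindex_inj (act_inj to g)).
    by apply: eq_bigr => z _; rewrite rhoJ PsiJ.
  - by move=> g x y; rewrite !mxE (inj_eq (act_inj to g)).
  move=> y z yB yH.
  have [|u uP uE] := surj (delta_mx 0 y).
    move=> x; rewrite mxE eqxx /=; case: (x =P y) => [->|]; rewrite ?eqxx // => _.
    by case/type_cellsP: yB.
  have uAE : u *m prj R (A :|: E) = u.
    apply/rowP => x; rewrite mul_mx_diag !mxE.
    have [->|/uP[-> _]] := eqVneq (u 0 x) 0; first by rewrite mul0r.
    by rewrite mulr1.
  have : delta_mx 0 y *m (rho *m Psi) = delta_mx 0 y :> 'rV[R]_N.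
    by rewrite uE -/Psi mulmxA -(mulmxA u Psi rho) Mrho uAE.
  move=> /(congr1 (fun X : 'rV[R]_N => X 0 z)).
  by rewrite -rowE [LHS]mxE => ->; rewrite !mxE eqxx eq_sym.
have adm (X : 'M[R]_N) : equivariant_mx to X ->
    (forall x y, X x y != 0 -> 'C[x | to]%g = 'C[y | to]%g) -> admissible to X.
  by move=> XJ XP; split=> // x y /XP ->.
have pA : p *m prj R (A :|: E) = p.
  by rewrite prjI (finset.setIidPl (finset.subsetUl _ _)).
have eA : e *m prj R (A :|: E) = e.
  by rewrite prjI (finset.setIidPl (finset.subsetUr _ _)).
have pM : p *m M = M by apply: prj_mull_id => x y /incidence_neq0[].
have eth : e *m th = th by apply: prj_mull_id => x y /thP[].
have Mb : M *m b = M by apply: prj_mulr_id => x y /incidence_neq0[].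
have thb : th *m b = th by apply: prj_mulr_id => x y /thP[].
have pe : p *m e = 0.
  rewrite prjI -(prj0 R N); congr prj; apply/setP => x; rewrite in_setI [RHS]inE.
  by apply/negP => /andP[xA /(subsetP EB)]; exact: AB xA.
have ep : e *m p = 0 by rewrite prjI finset.setIC -prjI pe.
have pth : p *m th = 0 by rewrite -eth mulmxA pe mul0mx.
have eM : e *m M = 0 by rewrite -pM mulmxA ep mul0mx.
have pPsi : p *m Psi = M by rewrite mulmxDr pM pth addr0.
have ePsi : e *m Psi = th by rewrite mulmxDr eM eth add0r.
have Mrho' : M *m rho = p by rewrite -pPsi -mulmxA Mrho pA.
have thrho : th *m rho = e by rewrite -ePsi -mulmxA Mrho eA.
pose r := b *m rho *m p; pose ta := b *m rho *m e.
have rhoP' (U : {set 'I_N}) : stable to U -> admissible to (b *m rho *m prj R U).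
  move=> sU; apply: adm => [g x y|x y].
    by rewrite !prj_mulr !prj_mull sU tB.1 rhoJ.
  by move=> /neq0_prjr[_ /neq0_prjl[_ /rhoP[_ ->]]].
apply: (@delete_step _ _ _ _ _ C A B E tA.1 tB.1 sE r th ta) => //.
- by move=> x /type_cellsP[->]; rewrite t0.
- by move=> x /type_cellsP[->]; rewrite t0.
- exact: rhoP' tA.1.
- by apply: adm => // x y /thP[_ _ ->].
- exact: rhoP'.
- by rewrite /r !mulmxA prj_id.
- by rewrite /r -!mulmxA prj_id.
- by rewrite /ta !mulmxA prj_id.
- by rewrite /ta -!mulmxA prj_id.
- by rewrite /r !mulmxA -/M Mrho' prj_id.
- by rewrite /r !mulmxA thb thrho ep.
- by rewrite /ta !mulmxA thb thrho prj_id.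
- by rewrite /ta !mulmxA -/M Mrho' pe.
- have -> : r *m d *m b = b *m rho *m M by rewrite /r /incidence !mulmxA.
  by rewrite /ta -(mulmxA (b *m rho)) eth -mulmxDr.
Qed.

End Step.

(** * Completing the incidence matrix in degree one *)

Section Selection.

Variables (R : idomainType) (N : nat).
Implicit Types (S : {set 'I_N}).

Definition sel S : 'M[R]_(#|S|, N) := \matrix_(i, x) (enum_val i == x)%:R.

Lemma sel_tr S : sel S *m (sel S)^T = 1%:M.
Proof.
apply/matrixP => i j; rewrite !mxE (bigD1 (enum_val i)) //= !mxE eqxx mul1r.
rewrite (inj_eq enum_val_inj) eq_sym big1 ?addr0 // => x xi.
by rewrite !mxE eq_sym (negPf xi) mul0r.
Qed.

Lemma tr_sel S : (sel S)^T *m sel S = prj R S.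
Proof.
apply/matrixP => x y; rewrite prjE mxE.
have [xS|xS] := boolP (x \in S); last first.
  rewrite big1 ?andbF // => i _; rewrite !mxE.
  case: (enum_val i =P x) => [e|_]; last by rewrite mul0r.
  by rewrite -e enum_valP in xS.
rewrite (bigD1 (enum_rank_in xS x)) //= !mxE enum_rankK_in // eqxx mul1r andbT.
rewrite big1 ?addr0 // => i; rewrite !mxE.
case: (enum_val i =P x) => [e /eqP ni|_ _]; last by rewrite mul0r.
by case: ni; apply: enum_val_inj; rewrite enum_rankK_in.
Qed.

Lemma supp_prj S (v : 'rV[R]_N) : (forall x, v 0 x != 0 -> x \in S) <-> v *m prj R S = v.
Proof.
split=> [vS|<- x]; last by move=> /neq0_mul[z [_]]; rewrite prjE; case: (z =P x) => [->|_]; case: (_ \in S); rewrite ?eqxx.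
apply/rowP => x; rewrite mul_mx_diag !mxE.
have [->|/vS ->] := eqVneq (v 0 x) 0; first by rewrite mul0r.
by rewrite mulr1.
Qed.

End Selection.

Section Completion.

Variables (gT : finGroupType) (R : idomainType).
Variables (N : nat) (to : {action gT &-> 'I_N}) (H : {group gT}).
Implicit Types (x y z : 'I_N) (A B E : {set 'I_N}).

Definition stab_part A := [set x in A | 'C[x | to]%g == H :> {set gT}].

Lemma stab_partP A x : reflect (x \in A /\ 'C[x | to]%g = H) (x \in stab_part A).
Proof. by rewrite inE; apply: (iffP andP) => -[xA /eqP]. Qed.

Definition supp_in A (v : 'rV[R]_N) := forall x, v 0 x != 0 -> x \in A.

Lemma supp_inD A u v : supp_in A u -> supp_in A v -> supp_in A (u + v).
Proof. by move=> uA vA x /neq0_add[/uA|/vA]. Qed.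

Lemma supp_inZ A a v : supp_in A v -> supp_in A (a *: v).
Proof. by move=> vA x; rewrite mxE mulf_eq0 negb_or => /andP[_ /vA]. Qed.

Lemma norm_stab x g : 'C[x | to]%g = H -> ('C[to x g | to]%g = H <-> g \in 'N(H)%g).
Proof.
move=> xH; rewrite astab1_to xH; split=> [e|/normP //].
exact/normP.
Qed.

(** N(H) permutes the points of isotropy exactly [H] with all stabilizers equal to [H], so each of
    its orbits there has as many points as the index. *)
Lemma index_dvd A : isotropy_type to H A -> (#|'N(H) : H|%g %| #|stab_part A|)%N.
Proof.
move=> [sA tA].
have acts : [acts 'N(H)%g, on stab_part A | to].
  apply/subsetP => g gN; rewrite !inE /=; apply/subsetP => x /stab_partP[xA xH].
  by rewrite inE; apply/stab_partP; rewrite sA; split=> //; apply/norm_stab.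
rewrite -(acts_sum_card_orbit acts); apply: dvdn_sum => T /imsetP[x /stab_partP[_ xH] ->].
rewrite card_orbit; set K := ('C_ _[_ | _])%g.
have -> : K = H :> {set gT}; last by [].
by rewrite /K xH; apply/finset.setIidPr; apply: normG.
Qed.

Variables (A B : {set 'I_N}) (M r : 'M[R]_N).
Hypotheses (tA : isotropy_type to H A) (tB : isotropy_type to H B).
Hypothesis AB : forall x, x \in A -> x \in B -> False.
Hypothesis MJ : equivariant_mx to M.
Hypothesis MP : forall x y, M x y != 0 ->
  [/\ x \in A, y \in B & 'C[y | to]%g = 'C[x | to]%g].
Hypothesis rJ : equivariant_mx to r.
Hypothesis Mr : M *m r = prj R A.

(* The rows th of the cells E complete the injective matrix M to a basis. *)
Definition completion E (th : 'M[R]_N) : Prop :=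
  [/\ stable to E, E \subset B & equivariant_mx to th] /\
  [/\ forall x y, th x y != 0 ->
        [/\ x \in E, y \in B & 'C[y | to]%g = 'C[x | to]%g],
      forall u : 'rV[R]_N,
        (forall x, u 0 x != 0 -> x \in A :|: E /\ 'C[x | to]%g = H) ->
        u *m (M + th) = 0 -> u = 0
    & forall v : 'rV[R]_N, supp_in (stab_part B) v -> exists2 u : 'rV[R]_N,
        (forall x, u 0 x != 0 -> x \in A :|: E /\ 'C[x | to]%g = H) &
        v = u *m (M + th)].

Local Notation SA := (stab_part A).
Local Notation SB := (stab_part B).

Let M_supp u : supp_in SA u -> supp_in SB (u *m M).
Proof.
move=> uA y /neq0_mul[x [/uA/stab_partP[_ xH] /MP[_ yB yx]]].
by apply/stab_partP; rewrite yx.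
Qed.

Let M_inj u : supp_in SA u -> u *m M = 0 -> u = 0.
Proof.
move=> uA e; have /supp_prj <- : forall x, u 0 x != 0 -> x \in A.
  by move=> x /uA/stab_partP[].
by rewrite -Mr mulmxA e mul0mx.
Qed.

Lemma completion0 : (forall v : 'rV[R]_N, supp_in SB v ->
    exists2 u : 'rV[R]_N, supp_in SA u & v = u *m M) ->
  completion finset.set0 0.
Proof.
move=> surj; split; split.
- by move=> x g; rewrite !inE.
- exact: finset.sub0set.
- by move=> g x y; rewrite !mxE.
- by move=> x y; rewrite mxE eqxx.
- move=> u uP; rewrite addr0; apply: M_inj => x /uP[].
  by rewrite finset.setU0 => xA xH; apply/stab_partP.
- move=> v /surj[u uA ->]; exists u; rewrite ?addr0 // => x /uA/stab_partP[].
  by rewrite finset.setU0.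
Qed.

Variables (b0 u0 : 'rV[R]_N).
Hypotheses (b0P : supp_in SB b0) (u0P : supp_in SB u0).
Hypothesis gen : forall v : 'rV[R]_N, supp_in SB v ->
  exists (c a : R) (w : 'rV[R]_N), supp_in SA w /\ v = c *: b0 + a *: u0 + w *m M.
Hypothesis free : forall (c a : R) (w : 'rV[R]_N), supp_in SA w ->
  c *: b0 + a *: u0 = w *m M -> c = 0 /\ a = 0.

(** [b0], [u0] and the rows of [M] at [SA] form a basis of the vectors supported on [SB]; bases over
    a commutative ring have equal size. Here 2 is the rank of H_0 of a 0-sphere. *)
Lemma card_stab_part : (#|SB| = 2 + #|SA|)%N.
Proof.
pose D : 'M[R]_(1 + 1 + #|SA|, N) := col_mx (col_mx b0 u0) (sel R SA *m M).
have mulD c a (w : 'rV_#|SA|) : row_mx (row_mx c a) w *m D =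
    c 0 0 *: b0 + a 0 0 *: u0 + w *m sel R SA *m M.
  rewrite !mul_row_col -mulmxA; congr (_ + _ + _).
    by rewrite {1}[c]mx11_scalar mul_scalar_mx.
  by rewrite {1}[a]mx11_scalar mul_scalar_mx.
have selA (w : 'rV_#|SA|) : supp_in SA (w *m sel R SA).
  by apply/supp_prj; rewrite -tr_sel -mulmxA (mulmxA (sel R SA)) sel_tr mul1mx.
have [P PE] : exists P : 'M_(#|SB|, 1 + 1 + #|SA|), P *m D = sel R SB.
  have rowP j : exists z : 'rV_(1 + 1 + #|SA|), z *m D = row j (sel R SB).
    have [|c [a [w [wA e]]]] := gen (v := row j (sel R SB)).
      move=> x; rewrite !mxE; case: (enum_val j =P x) => [<-|]; rewrite ?eqxx // => _.
      exact: enum_valP.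
    exists (row_mx (row_mx c%:M a%:M) (w *m (sel R SA)^T)).
    rewrite mulD -(mulmxA w) tr_sel e !mxE !mulr1n; congr (_ + _ *m _).
    exact/supp_prj.
  exists (\matrix_(j < #|SB|) sval (cid (rowP j))).
  by apply/row_matrixP => j; rewrite row_mul rowK; exact: svalP (cid (rowP j)).
have DS : D *m prj R SB = D.
  have sB v : supp_in SB v -> v *m prj R SB = v by move/supp_prj.
  rewrite !mul_col_mx !sB //; congr col_mx.
  by apply/row_matrixP => i; rewrite !row_mul sB // rowE; apply/M_supp/selA.
have PD1 : P *m (D *m (sel R SB)^T) = 1%:M by rewrite mulmxA PE sel_tr.
have DP1 : D *m (sel R SB)^T *m P = 1%:M.
  have inj (z : 'rV_(1 + 1 + #|SA|)) : z *m D = 0 -> z = 0.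
    rewrite -[z]hsubmxK -[lsubmx z]hsubmxK mulD.
    set c := lsubmx (lsubmx z); set a := rsubmx _; set w := rsubmx z => e.
    have [||c0 a0] := free (c := c 0 0) (a := a 0 0) (w := - (w *m sel R SA)).
    - by rewrite -scaleN1r; apply/supp_inZ/selA.
    - by apply/eqP; rewrite mulNmx -addr_eq0 e.
    move: e; rewrite c0 a0 !scale0r !add0r => /(M_inj (selA _)).
    move=> /(congr1 (mulmx^~ (sel R SA)^T)) /=.
    rewrite -mulmxA sel_tr mulmx1 mul0mx => ->.
    by rewrite [c]mx11_scalar [a]mx11_scalar c0 a0 !raddf0 !row_mx0.
  apply/eqP; rewrite -subr_eq0; apply/eqP/row_matrixP => i; rewrite row0.
  apply: inj; rewrite -row_mul mulmxBl mul1mx -(mulmxA _ P) PE -mulmxA tr_sel DS.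
  by rewrite subrr row0.
by apply/eqP; rewrite eqn_leq (mulmx1_min DP1) (mulmx1_min PD1).
Qed.

Lemma index_stab_part : (#|'N(H) : H|%g == 1)%N || (#|'N(H) : H|%g == 2)%N.
Proof.
have := index_dvd tB; rewrite card_stab_part dvdn_addl ?(index_dvd tA) //.
by rewrite (dvdn_divisors _ (isT : (0 < 2)%N)) !inE.
Qed.

Let supp_fixH v y h : supp_in SB v -> h \in H -> v 0 (to y h) = v 0 y.
Proof.
move=> vB hH; have hN : h \in 'N(H)%g by apply: (subsetP (normG H)).
have [yH|yH] := pselect ('C[y | to]%g = H).
  by have -> : to y h = y by apply/astab1P; rewrite yH.
have out z : 'C[z | to]%g <> H -> v 0 z = 0.
  by move=> zH; apply/eqP/negPn/negP => /vB/stab_partP[].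
rewrite !out // => e; case: yH.
have := norm_stab h^-1%g e; rewrite actK => -[_]; apply.
by rewrite groupV.
Qed.

(** The base points are chosen by [extend_rows], so at a given point of isotropy [H] the row is
    known only up to some [g] in N(H). *)
Lemma orbit_rows E (w : 'M[R]_N) : stable to E -> E \subset B ->
  (forall z, supp_in SB (row z w)) ->
  exists th : 'M[R]_N, [/\ equivariant_mx to th,
    forall x y, th x y != 0 ->
      [/\ x \in E, y \in B & 'C[y | to]%g = 'C[x | to]%g]
    & forall x, x \in E -> 'C[x | to]%g = H -> exists z g,
        [/\ z \in E, 'C[z | to]%g = H, g \in 'N(H)%g, to z g = x
          & forall y, th x y = w z (to y g^-1%g)]].
Proof.
move=> sE EB wB.
have tE : isotropy_type to H E by split=> // x /(subsetP EB)/tB.2.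
have [|th [thJ [base [gam [bg thE]]]]] := @extend_rows _ _ _ to H E w tE.
  by move=> z y h _ _ hH; have := supp_fixH y (wB z) hH; rewrite !mxE.
exists th; split=> // [x y|x xE xH].
  rewrite thE; case: ifP => [xE|]; last by rewrite eqxx.
  have [bE bH bx] := bg x xE => wy.
  have /wB/stab_partP[yB] : row (base x) w 0 (to y (gam x)^-1%g) != 0 by rewrite mxE.
  rewrite astab1_to => yH; rewrite tB.1 in yB; split=> //.
  have := astab1_to to (base x) (gam x).
  by rewrite bx bH -yH -conjsgM mulVg conjsg1 => ->.
have [bE bH bx] := bg x xE.
exists (base x), (gam x); split=> // [|y]; last by rewrite thE xE.
by apply/(norm_stab _ bH); rewrite bx.
Qed.

(** When N(H) = H, every orbit contains at most one point of isotropy exactly [H], so two such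
    points of [B] lie in different orbits; one orbit gets the row [b0], the other [u0]. *)
Lemma completion1 : #|'N(H) : H|%g = 1%N -> exists E th, completion E th.
Proof.
move=> i1; have NH : 'N(H)%g = H.
  by apply/eqP; rewrite eqEsubset normG andbT -indexg_eq1 i1.
have : (1 < #|SB|)%N by rewrite card_stab_part.
case/card_gt1P => y1 [y2 [/stab_partP[y1B y1H] /stab_partP[y2B y2H] y12]].
pose E := orbit to [set: gT] y1 :|: orbit to [set: gT] y2.
have EP x : x \in E <-> exists g, x = to y1 g \/ x = to y2 g.
  rewrite inE; split=> [/orP[]/imsetP[g _ ->]|[g [->|->]]].
  - by exists g; left.
  - by exists g; right.
  - by rewrite mem_orbit // inE.
  - by rewrite [X in _ || X]mem_orbit ?orbT // inE.
have fixN x g : 'C[x | to]%g = H -> g \in 'N(H)%g -> to x g = x.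
  by move=> xH; rewrite NH => gH; apply/astab1P; rewrite xH.
have EH x : x \in E -> 'C[x | to]%g = H -> x = y1 \/ x = y2.
  move=> /EP[g [->|->]] xH; [left|right]; apply: fixN => //.
    exact/(norm_stab _ y1H).
  exact/(norm_stab _ y2H).
have sE : stable to E.
  move=> x g; apply/idP/idP => /EP[h e]; apply/EP.
    exists (h * g^-1)%g; rewrite !actM.
    by case: e => <-; rewrite actK; [left|right].
  by exists (h * g)%g; rewrite !actM; case: e => ->; [left|right].
have EB : E \subset B.
  by apply/subsetP => x /EP[g [->|->]]; rewrite tB.1.
pose w : 'M[R]_N := \matrix_(z, y) if z == y1 then b0 0 y else u0 0 y.
have [|th [thJ thP thE]] := @orbit_rows E w sE EB.
  by move=> z y; rewrite !mxE; case: ifP => _; [exact: b0P|exact: u0P].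
have row_th x : x \in E -> 'C[x | to]%g = H -> row x th = if x == y1 then b0 else u0.
  move=> xE xH; have [z [g [zE zH gN zx e]]] := thE x xE xH.
  rewrite fixN // in zx; rewrite zx in e; rewrite NH in gN.
  apply/rowP => y; rewrite mxE e mxE.
  by case: eqP => _; rewrite supp_fixH // groupV.
have y1E : y1 \in E by apply/EP; exists 1%g; left; rewrite act1.
have y2E : y2 \in E by apply/EP; exists 1%g; right; rewrite act1.
have th1 : row y1 th = b0 by rewrite row_th // eqxx.
have th2 : row y2 th = u0 by rewrite row_th // eq_sym (negPf y12).
have M0 y : y \in B -> row y M = 0.
  move=> yB; apply/rowP => z; rewrite !mxE; apply/eqP/negPn/negP.
  by move=> /MP[yA _ _]; exact: AB yA yB.
exists E, th; split; split=> //.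
- move=> u uP; rewrite mulmxDr.
  pose uA := u *m prj R A.
  have uAP : supp_in SA uA.
    by move=> x; rewrite /uA => /neq0_prjr[xA /uP[_ xH]]; apply/stab_partP.
  have -> : u *m M = uA *m M.
    by rewrite -mulmxA prj_mull_id // => x y /MP[].
  have -> : u *m th = u 0 y1 *: b0 + u 0 y2 *: u0.
    apply/rowP => y; rewrite !mxE (bigD1 y1) //= (bigD1 y2) 1?eq_sym //=.
    rewrite -th1 -th2 ![row _ th 0 y]mxE addrA big1 ?addr0 // => x /andP[x1 x2].
    have [->|/uP[_ xH]] := eqVneq (u 0 x) 0; first by rewrite mul0r.
    have [->|/thP[xE _ _]] := eqVneq (th x y) 0; first by rewrite mulr0.
    by case: (EH x xE xH) => e; rewrite e eqxx in x1 x2.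
  rewrite addrC => e.
  have [||c0 a0] := free (c := u 0 y1) (a := u 0 y2) (w := - uA).
  + by rewrite -scaleN1r; apply: supp_inZ.
  + by apply/eqP; rewrite mulNmx -addr_eq0 e.
  move: e; rewrite c0 a0 !scale0r !add0r => /(M_inj uAP) uA0.
  apply/rowP => x; rewrite mxE; apply/eqP/negPn/negP => ux.
  have [] := uP x ux; rewrite in_setU => /orP[xA _|xE xH].
    have := congr1 (fun v : 'rV[R]_N => v 0 x) uA0.
    by rewrite /uA prj_mulr xA mulr1 mxE => e; rewrite e eqxx in ux.
  by case: (EH x xE xH) => e; rewrite e ?c0 ?a0 eqxx in ux.
- move=> v /gen[c [a [w' [wA ->]]]].
  exists (c *: delta_mx 0 y1 + a *: delta_mx 0 y2 + w').
    have dl z x : (delta_mx 0 z : 'rV[R]_N) 0 x != 0 -> x = z.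
      by rewrite mxE eqxx /=; case: (x =P z) => // _; rewrite eqxx.
    move=> x /neq0_add[/neq0_add[]|].
    + rewrite mxE mulf_eq0 negb_or => /andP[_ /dl ->].
      by rewrite in_setU y1E orbT.
    + rewrite mxE mulf_eq0 negb_or => /andP[_ /dl ->].
      by rewrite in_setU y2E orbT.
    + by move=> /wA/stab_partP[xA xH]; rewrite in_setU xA.
  have wth : w' *m th = 0.
    apply/rowP => y; rewrite [RHS]mxE; apply/eqP/negPn/negP.
    move=> /neq0_mul[x [/wA/stab_partP[xA _] /thP[/(subsetP EB) xB _ _]]].
    exact: AB xA xB.
  rewrite mulmxDr !mulmxDl -!scalemxAl -!rowE th1 th2 !M0 // wth.
  by rewrite !scaler0 !add0r addr0 addrC.
Qed.

(** * Index two: vectors as modules over R[C_2] *)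

Section IndexTwo.

Hypothesis i2 : #|'N(H) : H|%g = 2%N.

Lemma index2_coset : exists2 w, w \in 'N(H)%g & w \notin H /\
  forall g, g \in 'N(H)%g -> g \in H \/ (g * w^-1)%g \in H.
Proof.
have /subsetPn[w wN wH] : ~~ ('N(H)%g \subset H).
  by apply/negP; rewrite -indexg_eq1 i2.
exists w => //; split=> // g gN.
have e : [set (H :* 1)%g; (H :* w)%g] = rcosets H 'N(H)%g.
  apply/eqP; rewrite eqEcard; apply/andP; split.
    by apply/subsetP => X /set2P[] ->; apply/rcosetsP; [exists 1%g|exists w].
  rewrite -[#|rcosets _ _|]/(#|'N(H) : H|%g) i2 cards2.
  suff -> : (H :* 1)%g != (H :* w)%g by [].
  by apply: contra wH => /eqP; rewrite rcoset1 => ->; rewrite rcoset_refl.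
have : (H :* g)%g \in rcosets H 'N(H)%g by apply/rcosetsP; exists g.
rewrite -e => /set2P[] eg; [left|right].
  by have := rcoset_refl H g; rewrite eg rcoset1.
by rewrite -mem_rcoset -eg rcoset_refl.
Qed.

Variable w : gT.
Hypotheses (wN : w \in 'N(H)%g) (wH : w \notin H).
Hypothesis coset_w : forall g, g \in 'N(H)%g -> g \in H \/ (g * w^-1)%g \in H.

Local Notation s x := (to x w).

Let s_stab x : 'C[x | to]%g = H -> 'C[s x | to]%g = H.
Proof. by move=> xH; apply/(norm_stab _ xH). Qed.

Let s_fix x h : 'C[x | to]%g = H -> h \in H -> to x h = x.
Proof. by move=> xH hH; apply/astab1P; rewrite xH. Qed.

Let ss x : 'C[x | to]%g = H -> s (s x) = x.
Proof.
move=> xH; rewrite -actM; apply: s_fix => //.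
have [//|] := coset_w (groupM wN wN).
by rewrite mulgK => wH'; case/negP: wH.
Qed.

Let s_neq x : 'C[x | to]%g = H -> s x <> x.
Proof. by move=> xH /astab1P; rewrite xH; apply/negP. Qed.

(* Choosing one cell in each pair {x, s x} makes the functions on the type-H part
   of A' a free module over R[C_2], C_2 = N(H)/H. *)
Definition half A' : {set 'I_N} := [set x in stab_part A' | (x < s x)%N].

Let half_stab A' x : x \in half A' -> x \in stab_part A'.
Proof. by rewrite inE => /andP[]. Qed.

Let halfH A' x : x \in half A' -> 'C[x | to]%g = H.
Proof. by move=> /half_stab/stab_partP[]. Qed.

Let s_part A' x : isotropy_type to H A' -> (s x \in stab_part A') = (x \in stab_part A').
Proof.
move=> [sA' _]; apply/stab_partP/stab_partP; rewrite sA' => -[xA xH]; split=> //.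
  by have := norm_stab w^-1%g xH; rewrite actK => -[_]; apply; rewrite groupV.
exact: s_stab.
Qed.

Lemma sum_half (T : Type) (idx : T) (op : Monoid.com_law idx) A' (f : 'I_N -> T) :
  isotropy_type to H A' ->
  \big[op/idx]_(x in stab_part A') f x =
  \big[op/idx]_(x in half A') op (f x) (f (s x)).
Proof.
move=> tA'; rewrite (bigID (fun x : 'I_N => (x < s x)%N)) /= big_split /=.
congr (op _ _); first by apply: eq_bigl => x; rewrite [RHS]inE.
rewrite (reindex_inj (act_inj to w)); apply: eq_bigl => x.
rewrite s_part // [in RHS]inE; case xA: (x \in stab_part A') => //=.
have xH : 'C[x | to]%g = H by case/stab_partP: xA.
rewrite ss // -leqNgt leq_eqVlt; case: eqP => // /ord_inj e.
by case: (s_neq xH).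
Qed.

Lemma card_half A' : isotropy_type to H A' ->
  #|stab_part A'| = (2 * #|half A'|)%N.
Proof.
move=> tA'; rewrite -sum1_card sum_half // (eq_bigr (fun=> 2%N)) //.
by rewrite sum_nat_const mulnC.
Qed.

Lemma gring2_sum (I : Type) (q : seq I) (f g : I -> R) :
  \sum_(i <- q) ((f i, g i) : gring2 R) = (\sum_(i <- q) f i, \sum_(i <- q) g i).
Proof.
by elim: q => [|i q IH]; rewrite ?big_nil // !big_cons IH.
Qed.

(** Coordinates over R[C_2] with respect to the basis [half A']: the entries at [x] and at [s x] are
    one coefficient. *)
Definition hat A' (v : 'rV[R]_N) : 'rV[gring2 R]_#|half A'| :=
  \row_j (v 0 (enum_val j), v 0 (s (enum_val j))).

Definition hatm A1 A2 (X : 'M[R]_N) : 'M[gring2 R]_(#|half A1|, #|half A2|) :=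
  \matrix_(i, j) (X (enum_val i) (enum_val j), X (enum_val i) (s (enum_val j))).

Lemma hat_mul A1 A2 v (X : 'M[R]_N) : isotropy_type to H A1 ->
  supp_in (stab_part A1) v -> equivariant_mx to X ->
  hat A2 (v *m X) = hat A1 v *m hatm A1 A2 X.
Proof.
move=> tA1 vA XJ.
have E z : (v *m X) 0 z =
    \sum_(i < #|half A1|) (v 0 (enum_val i) * X (enum_val i) z +
       v 0 (s (enum_val i)) * X (s (enum_val i)) z).
  rewrite mxE (bigID (mem (stab_part A1))) /= [X in _ + X]big1 ?addr0.
    by rewrite sum_half // big_enum_val.
  by move=> x; have [->|/vA ->] := eqVneq (v 0 x) 0; first rewrite mul0r.
apply/rowP => j; rewrite [RHS]mxE mxE.
under [RHS]eq_bigr => i _ do rewrite !mxE /=.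
rewrite gring2_sum !E; congr pair; apply: eq_bigr => i _ /=;
  set x := enum_val i; set z := enum_val j.
  have zH : 'C[z | to]%g = H by apply: halfH (enum_valP j).
  by rewrite -[in X in _ + _ * X](ss zH) XJ.
by rewrite XJ.
Qed.

Lemma hatm_mul A1 A2 A3 (X Y : 'M[R]_N) : isotropy_type to H A2 ->
  (forall x, x \in half A1 -> supp_in (stab_part A2) (row x X)) ->
  equivariant_mx to Y -> hatm A1 A3 (X *m Y) = hatm A1 A2 X *m hatm A2 A3 Y.
Proof.
move=> tA2 XA YJ; apply/row_matrixP => i; rewrite row_mul.
have hr A' (Z : 'M[R]_N) : row i (hatm A1 A' Z) = hat A' (row (enum_val i) Z).
  by apply/rowP => j; rewrite !mxE.
by rewrite !hr row_mul; apply: hat_mul => //; apply: XA; apply: enum_valP.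
Qed.

Lemma hat_inj A' v : isotropy_type to H A' -> supp_in (stab_part A') v ->
  hat A' v = 0 -> v = 0.
Proof.
move=> tA' vA v0.
have h x : x \in half A' -> v 0 x = 0 /\ v 0 (s x) = 0.
  move=> xA; have := congr1 (fun u : 'rV[gring2 R]_ _ => u 0 (enum_rank_in xA x)) v0.
  by rewrite !mxE enum_rankK_in // => -[].
apply/rowP => x; rewrite mxE; apply/eqP/negPn/negP => vx.
have xA := vA x vx; have /stab_partP[_ xH] := xA.
have [lt|le] := ltnP x (s x).
  by move: vx; rewrite (h x _).1 ?eqxx // inE xA.
move: vx; rewrite -[x](ss xH) (h (s x) _).2 ?eqxx // inE s_part // xA ss //.
by rewrite ltn_neqAle le andbT; apply/eqP => /ord_inj; apply: s_neq.
Qed.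

Lemma hat_surj A' (k : 'rV[gring2 R]_#|half A'|) : isotropy_type to H A' ->
  exists2 v, supp_in (stab_part A') v & hat A' v = k.
Proof.
move=> tA'.
pose k' (x : 'I_N) : gring2 R :=
  if [pick j | enum_val j == x] is Some j then k 0 j else 0.
have k'E j : k' (enum_val j) = k 0 j.
  rewrite /k'; case: pickP => [i /eqP/enum_val_inj -> //|/(_ j)].
  by rewrite eqxx.
exists (\row_x if x \in half A' then (k' x).1 else
               if s x \in half A' then (k' (s x)).2 else 0).
  move=> x; rewrite mxE; case: ifP => [/half_stab //|_].
  by case: ifP => [/half_stab|_]; rewrite ?eqxx // s_part.
apply/rowP => j; rewrite !mxE; have jA := enum_valP j.
have jH := halfH jA; rewrite jA ss // jA k'E.
have -> : (s (enum_val j) \in half A') = false.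
  apply/negP; move: jA; rewrite !inE ss // => /andP[_ lt] /andP[_ gt].
  by have := ltn_trans lt gt; rewrite ltnn.
by case: (k 0 j).
Qed.

(** Over R[C_2] the complement of the image of [M] has rank [#|half B| - #|half A| = 1], and
    [rank_one_complement] shows it to be free on [c]. One free orbit of N(H)/H suffices to carry
    [c], written as an R-vector [c0]. *)
Lemma completion2 : exists E th, completion E th.
Proof.
have cardB : #|half B| = (#|half A| + 1)%N.
  have := card_stab_part; rewrite !card_half //; lia.
have MhR : hatm A B M *m hatm B A r = 1%:M.
  rewrite -hatm_mul //; last first.
    move=> x xA z; rewrite mxE => /MP[_ zB zx]; apply/stab_partP.
    by rewrite zx (halfH xA).
  rewrite Mr; apply/matrixP => i j; rewrite [LHS]mxE !prjE [RHS]mxE.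
  have /half_stab/stab_partP[iA _] := enum_valP i.
  rewrite iA !andbT (inj_eq enum_val_inj).
  have -> : (enum_val i == s (enum_val j)) = false.
    apply/eqP => e; have := enum_valP i; have := enum_valP j.
    have jH := halfH (enum_valP j).
    rewrite e !inE ss // => /andP[_ lt] /andP[_ gt].
    by have := ltn_trans lt gt; rewrite ltnn.
  by case: eqP.
have [t [c [tcE ct]]] := rank_one_complement cardB MhR.
(* [c = c t c = c (1 - r M)] is killed by [r] as [M r = 1]. Multiplying a relation between the rows
   of [M] and [c] by [r] thus isolates the coefficients of [M]. *)
have cr : c *m hatm B A r = 0.
  have : c *m (1%:M - hatm B A r *m hatm A B M) *m hatm B A r = 0.
    by rewrite mulmxBr mulmxBl mulmx1 -!mulmxA MhR mulmx1 subrr.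
  by rewrite tcE mulmxA ct mul1mx.
have [c0 c0B c0E] := hat_surj c tB.
have : (0 < #|SB|)%N by rewrite card_stab_part.
case/card_gt0P => y0 /stab_partP[y0B y0H].
pose E := orbit to [set: gT] y0.
have EP x : x \in E <-> exists g, x = to y0 g.
  split=> [/imsetP[g _ ->]|[g ->]]; first by exists g.
  by rewrite mem_orbit // inE.
have sE : stable to E.
  move=> x g; apply/idP/idP => /EP[h e]; apply/EP.
    by exists (h * g^-1)%g; rewrite actM -e actK.
  by exists (h * g)%g; rewrite actM -e.
have EB : E \subset B.
  by apply/subsetP => x /EP[g ->]; rewrite tB.1.
pose W : 'M[R]_N := \matrix_(z, y) c0 0 y.
have [|th [thJ thP thE]] := @orbit_rows E W sE EB.
  by move=> z y; rewrite !mxE; apply: c0B.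
have throw x : x \in E -> 'C[x | to]%g = H ->
    (forall y, 'C[y | to]%g = H -> th x y = c0 0 y) \/
    (forall y, 'C[y | to]%g = H -> th x y = c0 0 (s y)).
  move=> xE xH; have [z [g [_ zH gN _ e]]] := thE x xE xH.
  have [gH|gH] := coset_w gN; [left|right] => y yH; rewrite e mxE.
    by rewrite s_fix // groupV.
  have -> : g^-1%g = (w^-1 * (g * w^-1)^-1)%g by rewrite invMg invgK mulKg.
  rewrite actM [LHS](supp_fixH _ c0B) ?groupV //.
  by have -> : to y w^-1%g = s y by rewrite -{1}(ss yH) actK.
(* The row at [y0] is [c0] or its translate by [w]; [x1] is the one of [y0], [s y0] at which it is
   [c0]. *)
have [x1 [x1E x1H th1]] : exists x1, [/\ x1 \in E, 'C[x1 | to]%g = H &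
    forall y, 'C[y | to]%g = H -> th x1 y = c0 0 y].
  have y0E : y0 \in E by apply/EP; exists 1%g; rewrite act1.
  have [h|h] := throw y0 y0E y0H; first by exists y0.
  exists (s y0); rewrite sE; split=> // [|y yH]; first exact: s_stab.
  by rewrite -{1}(ss yH) thJ h ?ss //; apply: s_stab.
have th2 y : 'C[y | to]%g = H -> th (s x1) y = c0 0 (s y).
  by move=> yH; rewrite -{1}(ss yH) thJ th1 //; apply: s_stab.
have EH x : x \in E -> 'C[x | to]%g = H -> x = x1 \/ x = s x1.
  move=> /EP[g ->]; have /EP[h e] := x1E.
  have -> : to y0 g = to x1 (h^-1 * g)%g by rewrite actM e actK.
  move=> /(norm_stab _ x1H)/coset_w[gH|gH]; [left|right].
    exact: s_fix.
  by rewrite -[(h^-1 * g)%g](mulgKV w) actM (s_fix x1H gH).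
have hat_th (u : 'rV[R]_N) : (forall x, u 0 x != 0 -> x \in A :|: E /\ 'C[x | to]%g = H) ->
    hat B (u *m th) = ((u 0 x1, u 0 (s x1)) : gring2 R) *: c.
  move=> uP.
  have E' y : 'C[y | to]%g = H ->
      (u *m th) 0 y = u 0 x1 * c0 0 y + u 0 (s x1) * c0 0 (s y).
    move=> yH; rewrite mxE (bigD1 x1) //= (bigD1 (s x1)) /=; last exact/eqP/s_neq.
    rewrite th1 // th2 // addrA big1 ?addr0 // => x /andP[/eqP x1' /eqP x2'].
    have [->|/uP[_ xH]] := eqVneq (u 0 x) 0; first by rewrite mul0r.
    have [->|/thP[xE _ _]] := eqVneq (th x y) 0; first by rewrite mulr0.
    by case: (EH x xE xH).
  apply/rowP => j; rewrite -c0E [LHS]mxE.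
  have jH := halfH (enum_valP j).
  rewrite !E' ?ss //; last exact: s_stab.
  rewrite !mxE.
  by congr pair => /=; rewrite addrC.
have hatM u : supp_in SA u -> hat B (u *m M) = hat A u *m hatm A B M.
  by move=> uA; apply: hat_mul.
have hatD (u v : 'rV[R]_N) : hat B (u + v) = hat B u + hat B v.
  by apply/rowP => j; rewrite !mxE.
have hat0 A' : hat A' 0 = 0 by apply/rowP => j; rewrite !mxE.
have AE x : x \in A -> x \in E -> False by move=> xA /(subsetP EB); exact: AB.
exists E, th; split; split=> //.
- move=> u uP; rewrite mulmxDr.
  pose uA := u *m prj R A.
  have uAP : supp_in SA uA.
    by move=> x; rewrite /uA => /neq0_prjr[xA /uP[_ xH]]; apply/stab_partP.
  have -> : u *m M = uA *m M.
    by rewrite -mulmxA prj_mull_id // => x y /MP[].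
  move=> /(congr1 (hat B)); rewrite hatD hat0 hatM // hat_th // => e.
  have uA0 : uA = 0.
    apply: (hat_inj tA uAP).
    have := congr1 (mulmx^~ (hatm B A r)) e.
    by rewrite /= mulmxDl -mulmxA MhR mulmx1 -scalemxAl cr scaler0 addr0 mul0mx.
  have [k1 k2] : u 0 x1 = 0 /\ u 0 (s x1) = 0.
    move: e; rewrite uA0 hat0 mul0mx add0r => /(congr1 (mulmx^~ t)) /=.
    rewrite -scalemxAl ct mul0mx => /matrixP/(_ 0 0); rewrite !mxE eqxx mulr1.
    by case.
  apply/rowP => x; rewrite mxE; apply/eqP/negPn/negP => ux.
  have [] := uP x ux; rewrite in_setU => /orP[xA _|xE xH].
    have := congr1 (fun v : 'rV[R]_N => v 0 x) uA0.
    by rewrite /uA prj_mulr xA mulr1 mxE => e'; rewrite e' eqxx in ux.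
  by case: (EH x xE xH) => e'; rewrite e' ?k1 ?k2 eqxx in ux.
(* The coordinates come from [1 = r M + t c]: the part on [A] is [v r], and the coefficient of [c]
   is [k = v t]. *)
- move=> v vB.
  have [a aA aE] := hat_surj (hat B v *m hatm B A r) tA.
  pose k : gring2 R := (hat B v *m t) 0 0.
  pose u1 : 'rV[R]_N := k.1 *: delta_mx 0 x1 + k.2 *: delta_mx 0 (s x1).
  have u1E x : u1 0 x != 0 -> x \in E /\ 'C[x | to]%g = H.
    have dl z : (delta_mx 0 z : 'rV[R]_N) 0 x != 0 -> x = z.
      by rewrite mxE eqxx /=; case: (x =P z) => // _; rewrite eqxx.
    move=> /neq0_add[]; rewrite mxE mulf_eq0 negb_or => /andP[_ /dl ->] //.
    by rewrite sE; split=> //; apply: s_stab.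
  have u1P x : u1 0 x != 0 -> x \in A :|: E /\ 'C[x | to]%g = H.
    by move=> /u1E[xE xH]; rewrite in_setU xE orbT.
  have u1k : (u1 0 x1, u1 0 (s x1)) = k.
    have n1 : (s x1 == x1) = false by apply/eqP/s_neq.
    rewrite !mxE !eqxx n1 eq_sym n1 /= !mulr1 !mulr0 addr0 add0r.
    by case: (k).
  clearbody u1.
  have aP x : a 0 x != 0 -> x \in A :|: E /\ 'C[x | to]%g = H.
    by move=> /aA/stab_partP[xA xH]; rewrite in_setU xA.
  have uP x : (a + u1) 0 x != 0 -> x \in A :|: E /\ 'C[x | to]%g = H.
    by move=> /neq0_add[/aP|/u1P].
  exists (a + u1) => //.
  have u1M : u1 *m M = 0.
    apply/rowP => y; rewrite [RHS]mxE; apply/eqP/negPn/negP.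
    by move=> /neq0_mul[x [/u1E[xE _] /MP[xA _ _]]]; exact: AE xA xE.
  have ath : a *m th = 0.
    apply/rowP => y; rewrite [RHS]mxE; apply/eqP/negPn/negP.
    by move=> /neq0_mul[x [/aA/stab_partP[xA _] /thP[xE _ _]]]; exact: AE xA xE.
  have thB : supp_in SB (u1 *m th).
    move=> y /neq0_mul[x [/u1E[xE xH] /thP[_ yB yx]]].
    by apply/stab_partP; rewrite yx.
  rewrite mulmxDr !mulmxDl u1M ath addr0 add0r.
  apply/eqP; rewrite -subr_eq0; apply/eqP; apply: (hat_inj tB).
    apply: supp_inD => //; rewrite -scaleN1r; apply: supp_inZ.
    by apply: supp_inD => //; apply: M_supp.
  rewrite -scaleN1r hatD.
  have hatN (z : 'rV[R]_N) : hat B (-1 *: z) = - hat B z.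
    by apply/rowP => j; rewrite !mxE !mulN1r.
  rewrite hatN hatD hatM // hat_th // u1k aE -mulmxA.
  have <- : hat B v *m t *m c = k *: c.
    by rewrite [hat B v *m t]mx11_scalar mul_scalar_mx.
  by rewrite -mulmxA -mulmxDr -tcE (addrC (hatm B A r *m _)) subrK mulmx1 subrr.
Qed.

End IndexTwo.

Lemma completion_exists : exists E th, completion E th.
Proof.
have /orP[/eqP|/eqP i2] := index_stab_part; first exact: completion1.
have [w wN [wH coset_w]] := index2_coset i2.
exact: completion2 wN wH coset_w.
Qed.

End Completion.

(** * Tightening *)

Section Tighten.

Variables (gT : finGroupType) (R : idomainType) (F : {set {group gT}}).
Variables (N : nat) (to : {action gT &-> 'I_N}) (n : {group gT} -> int).
Implicit Types (K L H : {group gT}) (x y z : 'I_N) (C D : bcx R to).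

Hypothesis pid : is_PID R.
Hypothesis stabF : forall x, ('C[x | to])%G \in F.
Hypothesis mono : monotone n.
Hypothesis join : forall K L M, K \in F -> L \in F -> M \in F ->
  K \subset L -> K \subset M -> n K = n L -> n K = n M -> -1 < n K ->
  (L <*> M)%G \in F /\ n (L <*> M)%G = n K.

(** If [P] is nonempty, [M] is already onto and [E] is empty. If [P] is empty, all chains over [H]
    are of type [H], and [m <= t = 0] makes [n H = 0], so the basis of H_0 from [sf_basis0] is what
    the completion needs. *)
Lemma delete_top C H (m t : nat) : sphere_facts F n C ->
  H \in F -> n H = m%:Z -> (m <= t)%N ->
  (forall x, H \proper 'C[x | to]%g -> (0 < C x)%N ->
    (C x)%:Z <= n ('C[x | to])%G + 1) ->
  (forall x, 'C[x | to]%g = H -> C x <> t.+3) -> t = 0%N ->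
  exists D : bcx R to, homotopy_equivalent (real F C) (real F D) /\
    forall x, (D x = 0%N \/ D x = C x) /\
              (x \in type_cells C H t.+1 -> D x = 0%N).
Proof.
move=> facts HF nH mt tight top t0.
have [r [rJ rP Mr]] := incidence_left_inverse facts pid stabF mono join HF nH mt tight top.
pose A := type_cells C H t.+1; pose B := type_cells C H t.
have tA : isotropy_type to H A := type_cells_isotropy C H t.+1.
have tB : isotropy_type to H B := type_cells_isotropy C H t.
have vecP i (v : 'rV[R]_N) : type_vec C H i v <-> supp_in (stab_part to H (type_cells C H i)) v.
  split=> vH x.
    by move=> /vH[xi xH]; apply/stab_partP; split=> //; apply: mem_type_cells.
  by move=> /vH/stab_partP[/type_cellsP[xi _] xH].
have AB x : x \in A -> x \in B -> False.
  by move=> /type_cellsP[e1 _] /type_cellsP[e2 _]; move: e1; rewrite e2; lia.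
pose M := incidence C H t.
suff [E [th [[sE EB thJ] [thP inj surj]]]] : exists E th, completion to H A B M E th.
  have [|D [CD DP]] := delete_completed pid HF nH mt t0 sE EB thJ thP inj.
    by move=> v /vecP/surj.
  exists D; split=> // x; rewrite DP in_setU -/A.
  case xA: (x \in A) => /=; first by split; [left|].
  by split=> //; case: ifP => _; [left|right].
have MJ : equivariant_mx to M by exact: incidence_equivariant.
have MP x y : M x y != 0 -> [/\ x \in A, y \in B & 'C[y | to]%g = 'C[x | to]%g].
  exact: incidence_neq0.
have [P0|P0] := eqVneq (same_dim_overgroups F n H) finset.set0; last first.
  exists finset.set0, 0; apply: (completion0 (r := r)) => // v /vecP vH.
  have [u uH uE] := top_cells_surj facts stabF mono join HF nH mt tight t0 P0 vH.
  exists u; first exact/vecP.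
  apply/rowP => y; rewrite (incidenceE HF nH mt) //; case: eqP => [/uE //|yH].
  by apply/eqP/negPn/negP => /vH[_].
have m0 : m = 0%N by lia.
have up i (v : 'rV[R]_N) : (0 <= i)%N -> v \in xsupp C i H -> type_vec C H i v.
  move=> i0; apply: (no_upper_typeH stabF mono join HF nH mt tight P0).
  by rewrite t0.
have dn i (v : 'rV[R]_N) : type_vec C H i v -> v \in xsupp C i H.
  by move=> vH; apply/xsuppP => x /vH[-> ->].
have wM (w : 'rV[R]_N) : w \in xsupp C 1 H -> w *m bd C = w *m M.
  move=> wP; have wH := up _ _ isT wP.
  have wH' : type_vec C H t.+1 w by rewrite t0.
  have wdH := up _ _ isT (xsupp_bd wP).
  apply/rowP => y; rewrite [RHS](incidenceE HF nH mt) //; case: eqP => // yH.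
  by apply/eqP/negPn/negP => /wdH[_].
have [b [u [bP uP gen free]]] := sf_basis0 facts HF (etrans nH (congr1 _ m0)).
have vecP0 (v : 'rV[R]_N) : v \in xsupp C 0 H <-> supp_in (stab_part to H B) v.
  rewrite /B t0; split=> [/(up _ _ isT)/vecP|/vecP/dn] //.
have vecP1 (v : 'rV[R]_N) : v \in xsupp C 1 H <-> supp_in (stab_part to H A) v.
  rewrite /A t0; split=> [/(up _ _ isT)/vecP|/vecP/dn] //.
apply: (completion_exists tA tB AB MJ MP rJ Mr (b0 := b) (u0 := u)).
- exact/vecP0.
- exact/vecP0.
- move=> v /vecP0/gen[c [a [w [wP ->]]]]; exists c, a, w; rewrite -wM //.
  by split=> //; apply/vecP1.
- by move=> c a w /vecP1 wP e; apply: (free c a w) => //; rewrite wM.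
Qed.

Variables (X : rgcx R F) (eps : rghom (X 0%N) (rg_const R F)).
Hypothesis sphX : sphere_like n eps.
Hypothesis resX : forall (K L : orbit_obj F) (f : gmap K L), n L = n K ->
  forall i, res_homology_inj X f i /\ res_homology_surj X f i.

Lemma facts_of_he C : homotopy_equivalent X (real F C) -> sphere_facts F n C.
Proof.
move=> XC; have [f [g [fg gf]]] := XC.
apply: (sphere_facts_real (sphere_like_he fg gf sphX)) => K L h nKL i.
have [inj surj] := resX h nKL i; split.
  exact: res_homology_inj_he XC inj.
exact: res_homology_surj_he XC surj.
Qed.

(** Subtraction is truncated, so only grades above n + 1 contribute. In [tighten] cells that are not
    discarded have [n >= 0], where the absolute value is n + 1 itself. *)
Definition excess C := (\sum_x (C x - `|(n ('C[x | to])%G + 1)%R|))%N.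

Lemma excess_lt C D y : (forall x, D x <= C x)%N ->
  (D y + 2 <= C y \/ D y = 0)%N -> (`|(n ('C[y | to])%G + 1)%R| < C y)%N ->
  (excess D < excess C)%N.
Proof.
move=> DC Dy Cy; rewrite /excess (bigD1 y) //= [X in (_ < X)%N](bigD1 y) //=.
rewrite -addSn; apply: leq_add; first by lia.
by apply: leq_sum => x _; apply: leq_sub2r.
Qed.

Lemma tighten C : homotopy_equivalent X (real F C) ->
  (forall x, (0 < C x)%N -> 0 <= n ('C[x | to])%G) ->
  exists D, homotopy_equivalent X (real F D) /\
    forall x, (0 < D x)%N -> (D x)%:Z <= n ('C[x | to])%G + 1.
Proof.
have [k] := ubnP (excess C); elim: k C => // k IH C Ck XC pos.
pose bad x := (0 < C x)%N && ~~ ((C x)%:Z <= n ('C[x | to])%G + 1).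
have [[x0 bx0]|nb] := pselect (exists x, bad x); last first.
  exists C; split=> // x x0; apply: contrapT => nx; apply: nb; exists x.
  by rewrite /bad x0; apply/negP.
have [x1 bx1 x1max] := arg_maxnP (fun x => #|('C[x | to])%g|) bx0.
pose H := ('C[x1 | to])%G.
have Px1 : [pred x | ('C[x | to]%g == H :> {set gT})] x1 by rewrite inE.
have [y yH ymax] := arg_maxnP (fun x => C x) Px1.
have {}yH : 'C[y | to]%g = H by apply/eqP.
have /andP[x1pos x1bad] := bx1.
have [m nH] : exists m : nat, n H = m%:Z.
  by exists `|n H|%N; rewrite gez0_abs // pos.
have CyE : (m.+1 < C y)%N.
  apply: leq_trans (ymax x1 Px1).
  move: x1bad; rewrite -/H -[n _]/(n H) nH; lia.
(* Grade [t + 2] means that [y] has degree [t + 1], as in the analysis of offending cells. *)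
pose t := (C y).-2.
have yt : C y = t.+2 by rewrite /t; lia.
have mt : (m <= t)%N by lia.
have HF : H \in F by exact: stabF.
have facts := facts_of_he XC.
have tight x : H \proper 'C[x | to]%g -> (0 < C x)%N ->
    (C x)%:Z <= n ('C[x | to])%G + 1.
  move=> Hx xpos; apply: contrapT => /negP nx.
  have bx : bad x by rewrite /bad xpos.
  have le : (#|('C[x | to])%g| <= #|('C[x1 | to])%g|)%N := x1max x bx.
  by have := leq_trans (proper_card Hx) le; rewrite ltnn.
have top x : 'C[x | to]%g = H -> C x <> t.+3.
  move=> xH xt; have : (C x <= C y)%N by apply: ymax; rewrite inE xH.
  by rewrite xt yt ltnn.
have yA : y \in type_cells C H t.+1 by apply: mem_type_cells.
have nyE : (`|(n ('C[y | to])%G + 1)%R|)%N = m.+1.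
  have -> : ('C[y | to])%G = H by apply: val_inj.
  by rewrite nH -[m.+1]addn1.
suff [D [CD DP DA]] : exists D, [/\ homotopy_equivalent (real F C) (real F D),
    forall x, (D x <= C x)%N & (D y + 2 <= C y \/ D y = 0)%N].
  apply: (IH D).
  - have lt : (excess D < excess C)%N by apply: (excess_lt DP DA); rewrite nyE; lia.
    exact: leq_trans lt Ck.
  - exact: homotopy_equivalent_trans XC CD.
  - by move=> x xD; apply: pos; apply: leq_trans (DP x).
have [t0|[e te]] : t = 0%N \/ exists e, t = e.+1.
- by case: (t) => [|e]; [left|right; exists e].
- have [D [CD DP]] := delete_top facts HF nH mt tight top t0.
  exists D; split=> // [x|]; last by right; apply: (DP y).2.
  by have [[->|->] _] := DP x.
- have [D [CD DP]] := fold_top facts pid stabF mono join HF nH mt tight top te.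
  exists D; split=> // [x|]; last by left; rewrite DP yA; lia.
  by rewrite DP; case: ifP => // /type_cellsP[-> _]; lia.
Qed.

End Tighten.

(** * Based complexes *)

Section FreeModules.

Variables (gT : finGroupType) (R : idomainType) (F : {set {group gT}}).
Variables (N : nat) (to : {action gT &-> 'I_N}).
Implicit Types (x y z : 'I_N) (dg : grading to) (K L : orbit_obj F).

Local Notation orbR := (@rg_orb gT R F).

Section Cells.

Variables (dg : grading to) (i : nat) (J : Type) (h : J -> orbit_obj F).
Variable cell : forall j, orb (h j) -> 'I_N.
Hypothesis cellJ : forall j g (y : orb (h j)),
  cell (oact g y) = to (cell y) g^-1%g.
Hypothesis cell_inj : forall j, injective (@cell j).
Hypothesis cell_disj : forall j (y : orb (h j)) j' (y' : orb (h j')),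
  cell y = cell y' -> j = j'.
Hypothesis cellP : forall x, dg x = i.+1 <-> exists j (y : orb (h j)), cell y = x.

Let cell_fixed (K : {group gT}) j (y : orb (h j)) :
  K \subset 'C[cell y | to]%g <-> [forall k in K, oact k y == y].
Proof.
split=> [/subsetP Kc|/forall_inP Ky].
  apply/forall_inP => k kK; apply/eqP.
  have /Kc/astab1P : (k^-1)%g \in K by rewrite groupV.
  by rewrite -cellJ => /cell_inj.
apply/subsetP => k kK; apply/astab1P.
have /Ky/eqP e : (k^-1)%g \in K by rewrite groupV.
by rewrite -[in RHS]e cellJ invgK.
Qed.

Let coords_finite K (v : xsp R dg i K) : finite_set
  [set j | [ffun y : fixpt (h j) K => xval v 0 (cell (val y)) : R^o] != 0]%classic.
Proof.
have fin : finite_set ((fun j => cell (obase (h j))) @^-1` classical_sets.setT)%classic.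
  apply: finite_preimage; last exact: finite_finset.
  by move=> j j' _ _; exact: cell_disj.
exact: sub_finite_set fin.
Qed.

Definition coords K (v : xsp R dg i K) : rg_dsum (orbR \o h) K :=
  @DSum _ _ (fun j => orbR (h j) K)
    (fun j => [ffun y : fixpt (h j) K => xval v 0 (cell (val y)) : R^o])
    (coords_finite v).

Lemma coords_linear K : linear (@coords K).
Proof.
by move=> a u v; apply: dsumP => j /=; apply/ffunP => y; rewrite !ffunE !mxE.
Qed.

HB.instance Definition _ K := GRing.isLinear.Build R (xsp R dg i K)
  (rg_dsum (orbR \o h) K) _ (@coords K) (@coords_linear K).

Lemma coords_nat K L (f : gmap K L) (v : xsp R dg i L) :
  coords (xres f v) = rg_res (rg_dsum (orbR \o h)) f (coords v).
Proof.
have [a fE] := gmap_base f.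
apply: dsumP => j /=; apply/ffunP => y; rewrite !ffunE.
rewrite -[vact _ _ _]/(xval (xres f v)) (xresE _ fE) mxE.
have yE : to (cell (val y)) a = cell (oact a^-1%g (val y)) by rewrite cellJ invgK.
rewrite yE.
have [yL|yL] := boolP [forall k in L, oact k (oact a^-1%g (val y)) == oact a^-1%g (val y)].
  rewrite (big_pred1 (FixPt yL)) ?ffunE // => x.
  apply/eqP/eqP => e; apply: val_inj.
    by rewrite /= -e (fixmapE _ fE) -oactM mulVg oact1.
  by rewrite (fixmapE _ fE) e /= -oactM mulgV oact1.
rewrite big1 => [|x /eqP xy].
  apply: (xsupp0 (xspP v)); rewrite negb_and; apply/orP; right.
  by apply: contra yL => /cell_fixed.
case/negP: yL; rewrite -xy (fixmapE _ fE) -oactM mulVg oact1.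
exact: (valP x).
Qed.

Lemma coords_bij K : bijective (@coords K).
Proof.
pose P x := exists t : {j : J & fixpt (h j) K}, cell (val (projT2 t)) = x.
pose inv (w : rg_dsum (orbR \o h) K) : 'rV[R]_N := \row_x
  if pselect (P x) is left e then
    (w (projT1 (sval (cid e))) : {ffun _ -> R^o}) (projT2 (sval (cid e))) else 0.
have invE w j (y : fixpt (h j) K) : inv w 0 (cell (val y)) = (w j : {ffun _ -> R^o}) y.
  rewrite mxE; case: pselect => [e|[]]; last by exists (existT _ j y).
  case: (cid e) => -[j' y'] /= yy; have jj := cell_disj yy.
  by subst j'; have -> : y' = y by apply/val_inj/cell_inj.
have inv0 w x : ~ P x -> inv w 0 x = 0.
  by move=> nP; rewrite mxE; case: pselect.
have PP x : dg x = i.+1 -> K \subset 'C[x | to]%g -> P x.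
  move=> /cellP[j [y <-]] /cell_fixed yK.
  by exists (existT _ j (FixPt yK)).
have invP w : inv w \in xsupp dg i K.
  apply/xsuppP => x ix; have [[[j y] /= <-]|/(inv0 w) e] := pselect (P x); last first.
    by rewrite e eqxx in ix.
  split; first by apply/cellP; exists j, (val y).
  by apply/cell_fixed; apply: (valP y).
exists (fun w => XSp (invP w)) => [v|w].
  apply: xval_inj => /=; apply/rowP => x.
  have [[[j y] /= <-]|nP] := pselect (P x); first by rewrite invE /= ffunE.
  rewrite inv0 //; apply/esym/(xsupp0 (xspP v)); apply/negP => /andP[/eqP dx Kx].
  exact: nP (PP x dx Kx).
by apply: dsumP => j /=; apply/ffunP => y; rewrite ffunE invE.
Qed.

(** The points of degree [i] are the disjoint union of the orbits G/h(j). The inverse in [cellJ]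
    turns the left action on cosets into a right action. *)
Lemma xmod_iso_dsum : rg_iso (xmod R F dg i) (rg_dsum (orbR \o h)).
Proof.
exists (@RGHom _ _ _ (xmod R F dg i) (rg_dsum (orbR \o h))
  (fun K : orbit_obj F =>
     @coords K : {linear xsp R dg i K -> rg_dsum (orbR \o h) K}) coords_nat).
exact: coords_bij.
Qed.

End Cells.

Hypothesis stabF : forall x, ('C[x | to])%G \in F.

Lemma xmod_free dg i : rg_free (xmod R F dg i).
Proof.
pose base x := odflt x [pick z | z \in orbit to [set: gT] x].
have baseP x : exists g, base x = to x g.
  rewrite /base; case: pickP => [z /imsetP[g _ ->]|_]; first by exists g.
  by exists 1%g; rewrite act1.
have baseJ x g : base (to x g) = base x.
  rewrite /base.
  have e : (fun z => z \in orbit to [set: gT] (to x g)) =1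
           (fun z => z \in orbit to [set: gT] x).
    move=> z; apply/imsetP/imsetP => -[a _ ->].
      by exists (g * a)%g; rewrite ?inE ?actM.
    by exists (g^-1 * a)%g; rewrite ?inE // actM actK.
  rewrite (eq_pick e); case: pickP => // /(_ x)/negP[].
  exact: orbit_refl.
pose J := {x : 'I_N | (base x == x) && (dg x == i.+1)}.
pose h (j : J) : orbit_obj F := OrbitObj (stabF (val j)).
pose cell (j : J) (y : orb (h j)) := to (val j) (repr (val y))^-1%g.
have cellE j a : cell j (oact a (obase (h j))) = to (val j) a^-1%g.
  rewrite /cell; set b := repr _.
  have /oact_base_in : oact b (obase (h j)) = oact a (obase (h j)) by rewrite oact_repr.
  by move=> /astab1P /= e; rewrite -[in RHS]e -actM mulgK.
exists J, h; apply: (@xmod_iso_dsum dg i J h cell).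
- by move=> j g y; rewrite -{1}[y]oact_repr -oactM cellE invMg actM.
- move=> j y y'; rewrite -{2}[y]oact_repr -{2}[y']oact_repr /cell => e.
  set a := repr _ in e *; set b := repr _ in e *.
  have ab : (b^-1 * a)%g \in h j.
    by apply/astab1P; rewrite actM -e actKV.
  by rewrite -[a](mulKVg b) oactM oact_base.
- move=> j y j' y' e; apply: val_inj.
  have /andP[/eqP <- _] := valP j; have /andP[/eqP <- _] := valP j'.
  by have := congr1 base e; rewrite /cell !baseJ.
- move=> x; split=> [dx|[j [y <-]]]; last first.
    by rewrite /cell gradeJ; have /andP[_ /eqP] := valP j.
  have [g bx] := baseP x.
  have jP : (base (base x) == base x) && (dg (base x) == i.+1).
    by rewrite {1}bx baseJ eqxx bx gradeJ dx eqxx.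
  exists (Sub (base x) jP), (oact g (obase _)).
  by rewrite cellE /= bx actK.
Qed.

Lemma gmap_incl K L : K \subset L ->
  exists f : gmap K L, gapp f (obase K) = oact 1%g (obase L).
Proof.
by move=> KL; apply: gmap_exists => k kK; rewrite conjg1 (subsetP KL).
Qed.

Lemma delta_xsupp dg i (K : {group gT}) x : dg x = i.+1 -> K \subset 'C[x | to]%g ->
  (delta_mx 0 x : 'rV[R]_N) \in xsupp dg i K.
Proof.
move=> dx Kx; apply/xsuppP => y; rewrite mxE eqxx /=.
by case: (y =P x) => [->|_] //; rewrite eqxx.
Qed.

Lemma xsupp_zero dg i (K : {group gT}) : (0 : 'rV[R]_N) \in xsupp dg i K.
Proof. by apply/xsuppP => y; rewrite mxE eqxx. Qed.

Lemma xval_sum dg i (K : {group gT}) (I : Type) (q : seq I) (v : I -> xsp R dg i K) :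
  xval (\sum_(j <- q) v j) = \sum_(j <- q) xval (v j).
Proof. by elim: q => [|j q IH]; rewrite ?big_nil // !big_cons -IH. Qed.

(** The generator at [x] is the point itself over its own isotropy group. With a generator for every
    point, not just one per orbit, inclusions of subgroups suffice and the coefficients are the
    entries of [y]. *)
Lemma xmod_fg dg i : rg_fg (xmod R F dg i).
Proof.
pose k (x : 'I_N) : orbit_obj F := OrbitObj (stabF x).
have eP x : exists v : xsp R dg i (k x),
    dg x = i.+1 -> xval v = delta_mx 0 x.
  have [dx|dx] := eqVneq (dg x) i.+1; last first.
    by exists (XSp (xsupp_zero dg i (k x))) => e; rewrite e eqxx in dx.
  by exists (XSp (delta_xsupp dx (subxx _))).
exists N, k, (fun x => sval (cid (eP x))) => K y.
pose c (x : 'I_N) (f : gmap K (k x)) : R :=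
  if pselect (exists f : gmap K (k x), gapp f (obase K) = oact 1%g (obase (k x)))
  is left e then (f == sval (cid e))%:R * xval y 0 x else 0.
exists c; apply: xval_inj.
rewrite xval_sum; apply/rowP => z; rewrite summxE (bigD1 z) //=.
have inner x : xval (\sum_(f : gmap K (k x)) c x f *: rg_res (xmod R F dg i) f (sval (cid (eP x)))) =
    xval y 0 x *: delta_mx 0 x.
  rewrite xval_sum; have [y0|y0] := eqVneq (xval y 0 x) 0.
    rewrite y0 scale0r big1 // => f _; rewrite /c.
    by case: pselect => [e|_]; rewrite ?y0 ?mulr0 scale0r.
  have /xsuppP/(_ x y0)[dx Kx] := xspP y.
  rewrite /c; case: pselect => [e|[]]; last exact: (@gmap_incl K (k x)).
  case: (cid e) => f0 f0E /=; rewrite (bigD1 f0) //= eqxx mul1r big1 ?addr0.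
    rewrite -[vact _ _ _]/(xval (xres f0 _)) (xresE _ f0E) vact1.
    by rewrite (svalP (cid (eP x)) dx).
  by move=> f /negPf ->; rewrite mul0r scale0r.
rewrite inner mxE mxE !eqxx mulr1 big1 ?addr0 // => x xz.
by rewrite inner mxE mxE eqxx eq_sym (negPf xz) mulr0.
Qed.

Lemma real_free (C : bcx R to) : rgcx_free (real F C).
Proof. by move=> i; exact: xmod_free. Qed.

Lemma real_finite (C : bcx R to) : rgcx_finite (real F C).
Proof.
split; last by move=> i; exact: xmod_fg.
exists (\max_x C x) => i iC K v; apply: xval_inj; apply/rowP => x.
rewrite mxE; apply/eqP/negPn/negP; have /xsuppP vP := xspP v => /vP[xi _].
have : (C x <= i)%N by apply: leq_trans iC; exact: (leq_bigmax x).
by rewrite xi ltnn.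
Qed.

Hypothesis F1 : 1%G \in F.

(* Restricting to the trivial group embeds each value of [xmod] into the free
   R-module on all points, so a natural map is determined there by a matrix. *)
Lemma rghom_mx dg dg' i j (T : rghom (xmod R F dg i) (xmod R F dg' j)) :
  exists M : 'M[R]_N, [/\ admissible to M,
    forall x y, M x y != 0 -> dg x = i.+1 /\ dg' y = j.+1
    & forall K (v : xsp R dg i K), xval (T K v) = xval v *m M].
Proof.
pose O : orbit_obj F := OrbitObj F1.
have dP x : (if dg x == i.+1 then delta_mx 0 x else 0 : 'rV[R]_N) \in xsupp dg i O.
  case: ifP => [/eqP dx|_]; last exact: xsupp_zero.
  by apply: delta_xsupp => //; exact: sub1G.
pose d x : xsp R dg i O := XSp (dP x).
pose M := \matrix_(x, y) xval (T O (d x)) 0 y.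
have resT K (v : xsp R dg i K) :
    exists2 v' : xsp R dg i O, xval v' = xval v & xval (T K v) = xval (T O v').
  have [f fE] := @gmap_incl O K (sub1G _).
  exists (xres f v); first by rewrite (xresE _ fE) vact1.
  have := rg_nat T f v => /= ->.
  by rewrite -[RHS]/(xval (xres f (T K v))) (xresE _ fE) vact1.
have TM K (v : xsp R dg i K) : xval (T K v) = xval v *m M.
  have [v' v'E ->] := resT K v; rewrite -v'E.
  have -> : v' = \sum_x xval v' 0 x *: d x.
    apply: xval_inj.
    rewrite xval_sum; apply/rowP => y; rewrite summxE (bigD1 y) //= mxE.
    case: eqP => [_|dy]; last first.
      rewrite mxE mulr0 add0r big1 => [|x xy].
        by apply: (xsupp0 (xspP v')); rewrite negb_and; apply/orP; left; apply/eqP.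
      by rewrite mxE; case: ifP => _; rewrite !mxE ?mulr0 // eqxx eq_sym (negPf xy) mulr0.
    rewrite mxE !eqxx mulr1 big1 ?addr0 // => x xy.
    by rewrite mxE; case: ifP => _; rewrite !mxE ?mulr0 // eqxx eq_sym (negPf xy) mulr0.
  rewrite linear_sum !xval_sum mulmx_suml; apply: eq_bigr => x _.
  rewrite linearZ /= -scalemxAl; congr (_ *: _).
  case: (eqVneq (dg x) i.+1) => [dx|dx].
    by rewrite -rowE; apply/rowP => y; rewrite !mxE.
  have -> : d x = 0 by apply: xval_inj; rewrite /= (negPf dx).
  by rewrite linear0 mul0mx.
have Mrow x : dg x = i.+1 -> xval (T O (d x)) = row x M.
  by move=> dx; apply/rowP => y; rewrite !mxE.
have Msupp x y : M x y != 0 -> dg x = i.+1 /\ dg' y = j.+1.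
  move=> Mxy; have /xsuppP := xspP (T O (d x)) => /(_ y).
  rewrite mxE in Mxy => /(_ Mxy)[-> _]; split=> //.
  apply: contraNeq Mxy => dx.
  have -> : d x = 0 by apply: xval_inj; rewrite /= (negPf dx).
  by rewrite linear0 mxE.
exists M; split=> //; split=> [g x y|x y Mxy].
  have [dx|dx] := eqVneq (dg x) i.+1; last first.
    have M0 z z' : dg z != i.+1 -> M z z' = 0.
      by move=> dz; apply: contra_neq_eq dz => /Msupp[].
    by rewrite !M0 // gradeJ.
  have [|f fE] := @gmap_exists _ O O g.
    by move=> k /set1P ->; rewrite conj1g.
  have Mx z z' : dg z = i.+1 -> M z z' = xval (T O (d z)) 0 z'.
    by move=> _; rewrite mxE.
  have dgx : dg (to x g) = i.+1 by rewrite gradeJ.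
  have e : xres f (d (to x g)) = d x.
    apply: xval_inj; rewrite (xresE _ fE) /= dx dgx !eqxx.
    by apply/rowP => z; rewrite !mxE (inj_eq (act_inj to g)).
  have h : xval (T O (d x)) = vact to g (xval (T O (d (to x g)))).
    rewrite -(xresE _ fE) -e.
    exact: (congr1 (@xval _ _ _ _ _ _ _) (rg_nat T f (d (to x g)))).
  by rewrite !Mx // h [RHS]mxE.
(* Over the isotropy group [K] of [x] the point [x] is a chain, so its image is supported on
   [K]-fixed points. *)
have [dx dy] := Msupp x y Mxy; pose K : orbit_obj F := OrbitObj (stabF x).
have /xsuppP/(_ y) := xspP (T K (XSp (delta_xsupp dx (subxx _)))).
by rewrite TM /= -rowE mxE => /(_ Mxy)[].
Qed.

End FreeModules.

Section IsoHomotopy.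

Variables (gT : finGroupType) (R : comNzRingType) (F : {set {group gT}}).

Definition rg_zero_hom (M N : rgmod R F) : rghom M N.
Proof. by exists (fun K => \0 : {linear M K -> N K}) => K L h x /=; rewrite linear0. Defined.

Lemma homotopy_equivalent_iso (C D : rgcx R F) (f : rgcx_map C D)
  (g : rgcx_map D C) : (forall i K, cancel (f i K) (g i K)) ->
  (forall i K, cancel (g i K) (f i K)) -> homotopy_equivalent C D.
Proof.
move=> fK gK; exists f, g.
by split; exists (fun i => rg_zero_hom _ _) => K; split=> [x|i x] /=;
  rewrite ?fK ?gK subrr linear0 ?addr0.
Qed.

End IsoHomotopy.

Section BasedComplex.

Variables (gT : finGroupType) (R : idomainType) (F : {set {group gT}}).
Variables (N : nat) (to : {action gT &-> 'I_N}) (dg : grading to).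
Hypothesis stabF : forall x, ('C[x | to])%G \in F.
Hypothesis F1 : 1%G \in F.

Lemma based_complex (C : rgcx R F) : (forall i, rg_iso (C i) (xmod R F dg i)) ->
  exists D : bcx R to, homotopy_equivalent C (real F D) /\ forall x, D x = dg x.
Proof.
move=> iso.
have isoP i : exists f : rghom (C i) (xmod R F dg i) * rghom (xmod R F dg i) (C i),
    (forall K, cancel (f.1 K) (f.2 K)) /\ (forall K, cancel (f.2 K) (f.1 K)).
  by have [f /rg_inverse[g fg]] := iso i; exists (f, g).
pose f i := (sval (cid (isoP i))).1; pose g i := (sval (cid (isoP i))).2.
have fK i K : cancel (f i K) (g i K) := (svalP (cid (isoP i))).1 K.
have gK i K : cancel (g i K) (f i K) := (svalP (cid (isoP i))).2 K.
pose T i : rghom (xmod R F dg i.+1) (xmod R F dg i) :=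
  rg_comp (g i.+1) (rg_comp (rgc_d C i) (f i)).
have MP i := rghom_mx stabF F1 (T i).
pose M i := sval (cid (MP i)).
have Madm i : admissible to (M i) by have [] := svalP (cid (MP i)).
have Msupp i x y : M i x y != 0 -> dg x = i.+2 /\ dg y = i.+1.
  by have [_ H _] := svalP (cid (MP i)); exact: H.
have MT i K v : xval (T i K v) = xval v *m M i.
  by have [_ _ H] := svalP (cid (MP i)); exact: H.
(* For grades 0 and 1 the index is truncated to 0, which is harmless: the nonzero rows of [M 0] have
   grade 2. *)
pose d : 'M[R]_N := \matrix_(x, y) M (dg x).-2 x y.
have dM i x y : dg x = i.+2 -> d x y = M i x y by rewrite mxE => ->.
have dsupp x y : d x y != 0 -> exists i, dg x = i.+2 /\ dg y = i.+1.
  by rewrite mxE => /Msupp; exists (dg x).-2.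
have dm : mor dg dg 1 d.
  split; first split.
  - by move=> k x y; rewrite !mxE gradeJ (Madm _).1.
  - by move=> x y; rewrite mxE => /(Madm _).2.
  - by move=> x y /dsupp[i [-> ->]]; split=> //; lia.
have vd i K (v : xsp R dg i.+1 K) : xval v *m d = xval v *m M i.
  apply/rowP => y; rewrite !mxE; apply: eq_bigr => x _.
  have [->|v0] := eqVneq (xval v 0 x) 0; first by rewrite !mul0r.
  by have /xsuppP/(_ x v0)[dx _] := xspP v; rewrite (dM i).
have d2 : d *m d = 0.
  apply/matrixP => x y; rewrite [RHS]mxE; apply/eqP/negPn/negP => xy.
  have /neq0_mul[z [/dsupp[i [dx dz]] /dsupp[j [dz' _]]]] := xy.
  have ij : i = j.+1 by move: dz; rewrite dz' => -[].
  subst i; pose K : orbit_obj F := OrbitObj (stabF x).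
  pose v : xsp R dg j.+2 K := XSp (delta_xsupp R dx (subxx _)).
  have : xval v *m d *m d = 0.
    rewrite vd -MT vd -MT (_ : T _ _ _ = 0) //.
    by rewrite /T /= fK rgc_dd linear0.
  move=> /(congr1 (fun u : 'rV[R]_N => u 0 y)).
  by rewrite -mulmxA /= -rowE mxE [RHS]mxE => e; rewrite e eqxx in xy.
pose D := BCx dm d2.
exists D; split=> //.
have fc i (K : orbit_obj F) (x : C i.+1 K) :
    f i K (rgc_d C i K x) = rgc_d (real F D) i K (f i.+1 K x).
  by apply: xval_inj; rewrite /= vd -MT /T /= fK.
have gc i (K : orbit_obj F) (x : real F D i.+1 K) :
    g i K (rgc_d (real F D) i K x) = rgc_d C i K (g i.+1 K x).
  by apply: (can_inj (fK i K)); rewrite gK fc gK.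
exact: (@homotopy_equivalent_iso _ _ _ _ _ (@RGCxMap _ _ _ C (real F D) f fc)
  (@RGCxMap _ _ _ (real F D) C g gc) fK gK).
Qed.

End BasedComplex.

Section FiniteFree.

Variables (gT : finGroupType) (R : idomainType) (F : {set {group gT}}).
Implicit Types (K L : orbit_obj F) (M : rgmod R F).

Local Notation orbR := (@rg_orb gT R F).

Lemma dsum_orb_unit (I : Type) (h : I -> orbit_obj F) (j0 : I) :
  exists w : rg_dsum (orbR \o h) (h j0), w j0 <> 0.
Proof.
have bP : [forall k in h j0, oact k (obase (h j0)) == obase (h j0)].
  by apply/forall_inP => k kH; rewrite oact_base.
pose Q j (y : fixpt (h j) (h j0)) :=
  existT (fun j => fixpt (h j) (h j0)) j y = existT _ j0 (FixPt bP).
have fin : finite_set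
    [set j | [ffun y => if `[< Q j y >] then 1 else 0 : R^o] != 0 :> {ffun _ -> R^o}]%classic.
  apply: (@sub_finite_set _ _ [set j0]%classic); last exact: finite_set1.
  move=> j /= jn; apply: contrapT => jj; case/eqP: jn.
  apply/ffunP => y; rewrite !ffunE; case: asboolP => // e.
  by case: jj; exact: (congr1 (@projT1 _ _) e).
exists (@DSum _ _ (fun j => orbR (h j) (h j0)) _ fin) => /= /ffunP/(_ (FixPt bP)).
by rewrite !ffunE; case: asboolP => [_ /eqP|[]//]; rewrite oner_eq0.
Qed.

(** Each index lies in the support of some generator; otherwise that coordinate would vanish on all
    values of the module, contrary to [dsum_orb_unit]. There are finitely many generators, each of
    finite support. *)
Lemma fg_free_finite M (I : Type) (h : I -> orbit_obj F) :
  rg_fg M -> rg_iso M (rg_dsum (orbR \o h)) ->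
  exists k (e : 'I_k -> I), bijective e.
Proof.
move=> [m [k [x gen]]] [f fb]; have [g [fK gK]] := rg_inverse fb.
have cover j0 : exists a, f (k a) (x a) j0 <> 0.
  apply: contrapT => nx; have [w wj] := dsum_orb_unit h j0.
  apply: wj; rewrite -[w]gK; have [c ->] := gen _ (g _ w).
  rewrite linear_sum /=.
  have sumE (J : Type) (q : seq J) (v : J -> rg_dsum (orbR \o h) (h j0)) :
      (\sum_(a <- q) v a) j0 = \sum_(a <- q) v a j0.
    by elim: q => [|a q IH]; rewrite ?big_nil // !big_cons -IH.
  rewrite sumE big1 // => a _; rewrite linear_sum sumE big1 // => u _.
  rewrite linearZ /= rg_nat /=.
  have -> : f (k a) (x a) j0 = 0 by apply: contrapT => n0; apply: nx; exists a.
  by rewrite linear0 scaler0.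
have fin : finite_set [set: {classic I}]%classic.
  apply: (@sub_finite_set _ _ (\bigcup_(a in [set: 'I_m]) [set j | f (k a) (x a) j != 0])%classic).
    by move=> j _; have [a /eqP na] := cover j; exists a.
  apply: bigcup_finite => [|a _]; first exact: finite_finset.
  exact: dsum_finite.
have /finite_seqP[s sE] := fin.
have sall j : j \in undup s.
  by rewrite mem_undup; have : [set: {classic I}]%classic j by []; rewrite sE.
exists (size (undup s)), (fun a => tnth (in_tuple (undup s)) a).
have lt j : (index j (undup s) < size (undup s))%N by rewrite index_mem.
exists (fun j => Ordinal (lt j)) => [a|j].
  by apply: val_inj => /=; rewrite (tnth_nth (tnth (in_tuple (undup s)) a)) index_uniq // undup_uniq.
by rewrite (tnth_nth j) /= nth_index.
Qed.

Section Reindex.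

Variables (I J : Type) (e : J -> I).
Hypothesis eb : bijective e.

Section Value.

Variable V : I -> lmodType R.

Let pull_finite (w : dsum V) : finite_set [set a | w (e a) != 0]%classic.
Proof.
apply: (@finite_preimage _ _ [set j | w j != 0]%classic e); last exact: dsum_finite.
by move=> a b _ _; exact: (bij_inj eb).
Qed.

Definition pull (w : dsum V) : dsum (V \o e) :=
  @DSum _ _ (V \o e) (fun a => w (e a)) (pull_finite w).

Lemma pull_linear : linear pull.
Proof. by move=> a u v; apply: dsumP => j. Qed.

HB.instance Definition _ := GRing.isLinear.Build R (dsum V) (dsum (V \o e)) _
  pull pull_linear.

Lemma pull_bij : bijective pull.
Proof.
have [e' eK e'K] := eb.
have esurj j : exists a, e a = j by exists (e' j).
have ext (w : dsum (V \o e)) j :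
    exists v : V j, forall a (ea : e a = j), v = eq_rect _ (fun j => V j) (w a) _ ea.
  have [a <-] := esurj j; exists (w a) => b ea; have ba := bij_inj eb ea; subst b.
  by rewrite (Prop_irrelevance ea erefl).
pose push w j := sval (cid (ext w j)).
have pushE w a : push w (e a) = w a.
  exact: (svalP (cid (ext w (e a))) a erefl).
have fin w : finite_set [set j | push w j != 0]%classic.
  apply: (@sub_finite_set _ _ (e' @^-1` [set a | w a != 0])%classic).
    move=> j /=; have [a <-] := esurj j; rewrite pushE.
    by have : e' (e a) = a by []; move: (e' (e a)) => b ->.
  apply: finite_preimage; last exact: dsum_finite.
  by move=> a b _ _; exact: (can_inj e'K).
exists (fun w => DSum (fin w)) => w; apply: dsumP => j /=.
  by have [a <-] := esurj j; exact: pushE.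
exact: pushE.
Qed.

End Value.

Variable h : I -> orbit_obj F.

Lemma dsum_reindex : rg_iso (rg_dsum (orbR \o h)) (rg_dsum (orbR \o (h \o e))).
Proof.
have nat K L (f : gmap K L) (w : rg_dsum (orbR \o h) L) :
    pull (rg_res (rg_dsum (orbR \o h)) f w) =
    rg_res (rg_dsum (orbR \o (h \o e))) f (pull w).
  by apply: dsumP.
exists (@RGHom _ _ _ (rg_dsum (orbR \o h)) (rg_dsum (orbR \o (h \o e)))
  (fun K => @pull (fun j => orbR (h j) K) :
     {linear rg_dsum (orbR \o h) K -> rg_dsum (orbR \o (h \o e)) K}) nat).
by move=> K; exact: pull_bij.
Qed.

End Reindex.

Lemma finite_free M : rg_fg M -> rg_free M ->
  exists k (h : 'I_k -> orbit_obj F), rg_iso M (rg_dsum (orbR \o h)).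
Proof.
move=> fg [I [h iso]]; have [k [e eb]] := fg_free_finite fg iso.
by exists k, (h \o e); apply: rg_iso_trans iso (dsum_reindex eb h).
Qed.

Hypothesis famF : is_family F.

(** The orbits of all degrees are put into one G-set. Degrees from [N0] on contribute none, because
    a free module with a summand is nonzero. Isotropy groups are conjugates of the groups
    [h i j]. *)
Lemma finite_free_cells (C : rgcx R F) : rgcx_finite C -> rgcx_free C ->
  exists N (to : {action gT &-> 'I_N}) (dg : grading to),
    (forall x, ('C[x | to])%G \in F) /\
    forall i, rg_iso (C i) (xmod R F dg i).
Proof.
move=> [[N0 zero] fg] fr.
have ex i := finite_free (fg i) (fr i).
pose k i := sval (cid (ex i)).
pose h i : 'I_(k i) -> orbit_obj F := sval (cid (svalP (cid (ex i)))).
have iso i : rg_iso (C i) (rg_dsum (orbR \o h i)) := svalP (cid (svalP (cid (ex i)))).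
have empty i : (N0 <= i)%N -> 'I_(k i) -> False.
  move=> iN j; have [w wj] := dsum_orb_unit (h i) j.
  have [f /rg_inverse[g [_ gK]]] := iso i.
  by apply: wj; rewrite -[w]gK (zero i iN _ (g _ w)) linear0.
pose idx := {i : 'I_N0 & 'I_(k i)}.
pose T : finType := {c : idx & orb (h (tag c) (tagged c))}.
pose mk (i : 'I_N0) (j : 'I_(k i)) (y : orb (h i j)) : T :=
  Tagged (fun c : idx => orb (h (tag c) (tagged c)))
    (i := Tagged (fun i : 'I_N0 => 'I_(k i)) j) y.
pose tact (t : T) (g : gT) : T :=
  Tagged (fun c : idx => orb (h (tag c) (tagged c))) (oact g^-1%g (tagged t)).
have tact1 t : tact t 1%g = t.
  by case: t => c y; rewrite /tact /= invg1 oact1.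
have tactM t a b : tact t (a * b)%g = tact (tact t a) b.
  by rewrite /tact /= invMg oactM.
pose act (x : 'I_#|T|) (g : gT) : 'I_#|T| := enum_rank (tact (enum_val x) g).
have act1 : act^~ 1%g =1 id by move=> x; rewrite /act tact1 enum_valK.
have actM x : act_morph act x.
  by move=> a b; rewrite /act enum_rankK tactM.
pose to : {action gT &-> 'I_#|T|} := TotalAction act1 actM.
pose grd (x : 'I_#|T|) : nat := (tag (tag (enum_val x))).+1.
have grdJ x g : grd (to x g) = grd x.
  by rewrite /grd /= /act enum_rankK.
pose dg : grading to := Grading grdJ.
have [_ Fconj Fsub] := famF.
exists #|T|, to, dg; split.
  move=> x; case xE : (enum_val x) => [c y].
  have HF : (h (tag c) (tagged c) :^ (repr (val y))^-1)%G \in F.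
    by apply: Fconj; exact: (valP (h (tag c) (tagged c))).
  apply: Fsub HF _; apply/subsetP => g /astab1P /= gx.
  have := congr1 enum_val gx; rewrite /act enum_rankK xE => /eqP.
  rewrite /tact /= eq_Tagged /= => /eqP.
  set a := repr _ => e.
  pose b := obase (h (tag c) (tagged c)).
  have ya : y = oact a b by rewrite oact_repr.
  have : oact (g^-1 * a)%g b = oact a b by rewrite oactM -ya.
  move=> /oact_base_in; rewrite invMg invgK -mulgA => aH.
  by rewrite mem_conjgV conjgE.
move=> i; have [iN|iN] := ltnP i N0; last first.
  apply: rg_iso_trans (iso i) _; apply: rg_iso_sym.
  have no (j : 'I_(k i)) : False := empty i iN j.
  apply: (@xmod_iso_dsum _ _ _ _ _ dg i _ (h i) (fun j => match no j with end)).
  - by move=> j; case: (no j).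
  - by move=> j; case: (no j).
  - by move=> j; case: (no j).
  - move=> x; split=> [[xi]|[j]]; last by case: (no j).
    by have := ltn_ord (tag (tag (enum_val x))); rewrite xi ltnNge iN.
apply: rg_iso_trans (iso i) _; apply: rg_iso_sym.
pose cell (j : 'I_(k i)) (y : orb (h i j)) : 'I_#|T| :=
  enum_rank (mk (Ordinal iN) j y).
have tagI : injective (Tagged (fun i : 'I_N0 => 'I_(k i)) (i := Ordinal iN)).
  by move=> j j' /eqP; rewrite eq_Tagged => /eqP.
apply: (@xmod_iso_dsum _ _ _ _ _ dg i _ (h i) cell).
- move=> j g y; rewrite /cell /= /act enum_rankK /tact /= invgK.
  by congr enum_rank.
- by move=> j y y' /enum_rank_inj/eqP; rewrite eq_Tagged => /eqP.
- move=> j y j' y' /enum_rank_inj/(congr1 tag) /= => e.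
  exact: tagI.
- move=> x; split=> [[]|[j [y <-]]]; last by rewrite /= /grd enum_rankK.
  rewrite -[x]enum_valK enum_rankK; case: (enum_val x) => [[[i' iN'] j] y] /= ii.
  subst i'; rewrite (bool_irrelevance iN' iN) in j y *.
  by exists j, y.
Qed.

End FiniteFree.

(** * Dimension functions *)

Section Dimension.

Variables (gT : finGroupType) (R : comNzRingType) (F : {set {group gT}}).
Implicit Types (C : rgcx R F) (K : orbit_obj F).

Lemma dim_at_eq C K (d : nat) : ~ mod_zero (C d K) ->
  (forall e, (d < e)%N -> mod_zero (C e K)) -> dim_at C K = d%:Z.
Proof.
move=> nz above; rewrite /dim_at.
set P := (X in xget _ X); have Pd : P d%:Z by exists d.
have [d' [-> nz' above']] : P (xget (-1) P) by apply: xgetPex; exists d%:Z.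
congr Posz; apply/eqP; rewrite eqn_leq; apply/andP; split.
  by rewrite leqNgt; apply/negP => /above.
by rewrite leqNgt; apply/negP => /above'.
Qed.

Lemma dim_at_none C K : (forall i, mod_zero (C i K)) -> dim_at C K = -1.
Proof.
move=> z; rewrite /dim_at; apply: xgetPN => m -[d [_ nz _]].
exact: nz (z d).
Qed.

(** A natural number cannot be the default value -1 of [xget]. *)
Lemma dim_at_nonneg C K i : dim_at C K = i%:Z -> ~ mod_zero (C i K).
Proof.
rewrite /dim_at; set P := (X in xget _ X).
have [[m Pm]|nP] := pselect (exists m, P m).
  have [d [-> nz _]] : P (xget (-1) P) by apply: xgetPex; exists m.
  by case=> <-.
by rewrite xgetPN // => m Pm; apply: nP; exists m.
Qed.

Lemma dim_at_ge C K i : rgcx_finite C -> ~ mod_zero (C i K) ->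
  (i%:Z <= dim_at C K)%R.
Proof.
move=> [[N0 zero] _] nz.
have [d [nzd above]] : exists d, ~ mod_zero (C d K) /\
    forall e, (d < e)%N -> mod_zero (C e K).
  have ex : exists d, `[< ~ mod_zero (C d K) >] by exists i; apply/asboolP.
  have bound d : `[< ~ mod_zero (C d K) >] -> (d <= N0)%N.
    move=> /asboolP nzd; rewrite leqNgt; apply/negP => /ltnW/zero/(_ K).
    exact: nzd.
  case: (ex_maxnP ex bound) => d /asboolP nzd dmax; exists d; split=> // e de.
  by apply: contrapT => nze; have := dmax e (asboolT nze); rewrite leqNgt de.
rewrite (dim_at_eq nzd above) lez_nat leqNgt; apply/negP => di.
exact: nz (above i di).
Qed.

Lemma free_projective (M : rgmod R F) : rg_free M -> rg_projective M.
Proof.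
move=> fM; pose Z : rgmod R F := rg_dsum (fun v : void => match v with end).
exists Z, M; split=> //.
have lin (K : orbit_obj F) : linear (fun x : M K => (x, 0) : (M K * Z K)%type).
  by move=> a x y; congr pair; apply: dsumP; case.
pose f (K : orbit_obj F) : {linear M K -> rg_sum2 M Z K} :=
  HB.pack (fun x : M K => (x, 0) : rg_sum2 M Z K)
    (GRing.isLinear.Build R (M K) (rg_sum2 M Z K) _ _ (lin K)).
have nat (K L : orbit_obj F) (h : gmap K L) (x : M L) :
    f K (rg_res M h x) = rg_res (rg_sum2 M Z) h (f L x).
  by congr pair; apply: dsumP; case.
exists (RGHom nat) => K; exists (fun x : rg_sum2 M Z K => x.1) => [x //|[x z]].
by congr pair; apply: dsumP; case.
Qed.

End Dimension.

Section Main.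

Variables (gT : finGroupType) (F : {set {group gT}}) (R : idomainType).
Variable n : {group gT} -> int.
Hypothesis famF : is_family F.
Hypothesis suppn : supported_on F n.

Let F1 : 1%G \in F.
Proof.
have [/set0Pn[H HF] _ Fsub] := famF.
by apply: Fsub HF _; exact: sub1G.
Qed.

Lemma based_of_finite_free (C : rgcx R F) : rgcx_finite C -> rgcx_free C ->
  exists N (to : {action gT &-> 'I_N}) (D : bcx R to),
    [/\ forall x, ('C[x | to])%G \in F,
        homotopy_equivalent C (real F D) &
        forall i, rg_iso (C i) (xmod R F D i)].
Proof.
move=> fin fr; have [N [to [dg [stabF iso]]]] := finite_free_cells famF fin fr.
have [D [CD DE]] := based_complex stabF F1 iso.
exists N, to, D; split=> // i.
have [f fb] := iso i.
have dgE : (D : grading to) = dg.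
  case: (bdg D) DE => d1 p1; case: dg {iso f fb} => d2 p2 /= e.
  have {}e : d1 = d2 by apply: functional_extensionality_dep.
  by subst d2; rewrite (Prop_irrelevance p1 p2).
by rewrite dgE.
Qed.

Lemma iso_zero M M' (K : orbit_obj F) : @rg_iso _ R F M M' ->
  mod_zero (M K) -> mod_zero (M' K).
Proof.
move=> [f /rg_inverse[g [_ gK]]] z v.
by rewrite -[v]gK (z (g K v)) linear0.
Qed.

Lemma xmod_zeroP N (to : {action gT &-> 'I_N}) (dg : grading to) i (K : orbit_obj F) :
  mod_zero (xmod R F dg i K) <->
  (forall x, dg x = i.+1 -> K \subset 'C[x | to]%g -> False).
Proof.
split=> [z x dx Kx|H v].
  have := congr1 (@xval _ _ _ _ _ _ _) (z (XSp (delta_xsupp R dx Kx))).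
  move=> /rowP/(_ x); rewrite !mxE !eqxx => /eqP.
  by rewrite oner_eq0.
apply: xval_inj; apply/rowP => x; rewrite mxE; apply/eqP/negPn/negP.
by have /xsuppP vP := xspP v; move=> /vP[/H].
Qed.

(** Tightness bounds [Dim] by [n], since a [K]-fixed cell has degree at most n of its isotropy
    group, hence at most [n K] by monotonicity. Nonzero homology in degree [n K] gives the other
    inequality. *)
Lemma tight_replacement (C : rgcx R F) : is_PID R ->
  rgcx_finite C -> rgcx_free C -> algebraic_homotopy_representation n C ->
  exists D : rgcx R F,
    [/\ homotopy_equivalent C D, rgcx_finite D, rgcx_free D & n =1 Dim D].
Proof.
move=> pid fin fr [_ sph mono res join].
have [eps epsS nK] := homology_sphere_like sph.
have [N [to [C0 [stabF CC0 iso]]]] := based_of_finite_free fin fr.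
have resC (K L : orbit_obj F) (f : gmap K L) : n L = n K ->
    forall i, res_homology_inj C f i /\ res_homology_surj C f i.
  by move=> nKL; apply/homology_iso_res; exact: res.
(* A cell [x] makes the complex nonzero at its own isotropy group, which excludes the value -1
   there. *)
have pos x : (0 < C0 x)%N -> 0 <= n ('C[x | to])%G.
  move=> x0; have [n1 z] := nK (OrbitObj (stabF x)).
  have [|nx] := leP 0 (n ('C[x | to])%G) => //.
  have xE : C0 x = (C0 x).-1.+1 by rewrite prednK.
  have nE : n ('C[x | to])%G = -1 by move: n1 nx => /=; lia.
  by have /iso_zero/(_ (z nE _))/xmod_zeroP/(_ x xE (subxx _)) := iso (C0 x).-1.
have [D [CD tightD]] := tighten pid stabF mono join epsS resC CC0 pos.
exists (real F D); split=> //; try exact: real_free; try exact: real_finite.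
move=> K; rewrite /Dim; case: insubP => [K' _ K'E|KF]; last exact: suppn.
have tight i x : D x = i.+1 -> K' \subset 'C[x | to]%g -> i%:Z <= n K'.
  move=> xi Kx; have := tightD x; rewrite xi => /(_ isT).
  have : n ('C[x | to])%G <= n K' by apply: mono; exists 1%g; rewrite conjsg1.
  lia.
rewrite -K'E; have [n1 _] := nK K'.
have [nE|[m nE]] : n K' = -1 \/ exists m : nat, n K' = m%:Z.
- case: (n K') n1 => [m _|m]; first by right; exists m.
  by rewrite NegzE => m0; left; lia.
- rewrite nE dim_at_none // => i; apply/xmod_zeroP => x xi /(tight i x xi).
  by rewrite nE; lia.
have [f [g [fg gf]]] := CD.
rewrite nE (dim_at_eq (d := m)) //.
  have [v v0] := sphere_nonzero (sphere_like_he fg gf epsS) (esym nE).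
  by move=> /(_ v).
by move=> e me; apply/xmod_zeroP => x xe /(tight e x xe); rewrite nE; lia.
Qed.

(** * From n = Dim D to the conditions of an algebraic homotopy representation *)

Section Converse.

Variables (C D : rgcx R F).
Hypotheses (sph : homology_sphere n C) (CD : homotopy_equivalent C D).
Hypotheses (finD : rgcx_finite D) (freeD : rgcx_free D) (dimD : n =1 Dim D).

Lemma representation_of_tight : rgcx_finite C -> rgcx_free C ->
  algebraic_homotopy_representation n C.
Proof.
move=> finC freeC.
have [epsC epsCS nK] := homology_sphere_like sph.
have [N [to [Z [stabF DZ iso]]]] := based_of_finite_free finD freeD.
have CZ := homotopy_equivalent_trans CD DZ.
have [f0 [g0 [fg gf]]] := CZ.
have [eps S] : exists eps, sphere_like n (C := real F Z) eps.
  by eexists; exact: sphere_like_he fg gf epsCS.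
have dimK (K : orbit_obj F) : n K = dim_at D K.
  rewrite dimD /Dim; case: insubP => [K' _ e|]; last by rewrite (valP K).
  by congr dim_at; apply: val_inj.
have tight (K : orbit_obj F) i x : Z x = i.+1 -> K \subset 'C[x | to]%g ->
    i%:Z <= n K.
  move=> xi Kx; rewrite dimK; apply: dim_at_ge => // z.
  by have /xmod_zeroP/(_ x xi Kx) := iso_zero (iso i) z.
have zero (K : orbit_obj F) i (v : real F Z i K) : n K < i%:Z -> v = 0.
  move=> ni; apply/xmod_zeroP: v => x xi Kx.
  by have := tight K i x xi Kx; rewrite leNgt ni.
have nonzero (K : orbit_obj F) (i : nat) : n K = i%:Z ->
    exists x, Z x = i.+1 /\ K \subset 'C[x | to]%g.
  move=> nE; apply: contrapT => no.
  have := dim_at_nonneg (etrans (esym (dimK K)) nE); apply.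
  apply: (iso_zero (rg_iso_sym (iso i))); apply/xmod_zeroP => x xi Kx.
  by apply: no; exists x.
have ge1 H : -1 <= n H.
  have [HF|HF] := boolP (H \in F); last by rewrite suppn.
  exact: (nK (OrbitObj HF)).1.
have mono : monotone n.
  move=> H K [g HK]; have [KF|KF] := boolP (K \in F); last by rewrite (suppn KF).
  have [nE|[i nE]] : n K = -1 \/ exists i : nat, n K = i%:Z.
  - have := ge1 K; case: (n K) => [i _|i]; first by right; exists i.
    by rewrite NegzE => m0; left; lia.
  - by rewrite nE.
  (* A [K]-fixed cell of degree [n K] has a translate fixed by [H], so [n H] is at least this
     degree. *)
  have [x [xi Kx]] := nonzero (OrbitObj KF) i nE.
  have [_ Fconj Fsub] := famF.
  have HF : H \in F.
    have := Fconj _ g^-1%g (Fsub _ _ KF HK).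
    by congr (_ \in F); apply: val_inj => /=; rewrite conjsgK.
  rewrite nE; apply: (tight (OrbitObj HF) i (to x g^-1%g)); first by rewrite gradeJ.
  rewrite astab1_to -sub_conjg ?conjsgK //.
  by apply: subset_trans HK Kx.
have epsR (K L : orbit_obj F) (f : gmap K L) (x : real F Z 0%N L) :
    eps K (rg_res (real F Z 0%N) f x) = eps L x.
  by rewrite rg_nat.
have top_eq (K : orbit_obj F) i (w : real F Z i.+1 K) : n K = i%:Z -> w = 0.
  by move=> nE; apply: zero; rewrite nE; lia.
have surj (K L : orbit_obj F) (f : gmap K L) i : n L = n K ->
    res_homology_surj (real F Z) f i.
  move=> nKL y yc.
  (* Homology is unreduced, so in degree 0 a multiple of a chain of augmentation 1 over [L] is split
     off first; the rest is a reduced cycle. *)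
  have [x0 [x0c x0a]] : exists x0 : real F Z i L, is_cycle x0 /\
      aug_cycle eps (y - rg_res (real F Z i) f x0).
    case: i y yc => [|i] y yc.
      have [nE|n0] := ltP (n K) 0.
        exists 0; split; first by rewrite /is_cycle linear0.
        by rewrite (zero K 0%N y nE) linear0 subr0; exact: linear0.
      have [SL _ _] := S.2 L; have [|b bP] := SL; first by rewrite nKL; lia.
      exists ((eps K y : R) *: b); split=> //.
      rewrite /aug_cycle /= linearB /= epsR linearZ /= bP.
      by rewrite -[_ *: _]/(_ * 1) mulr1 subrr.
    exists 0; split; first by rewrite /is_cycle linear0.
    by rewrite linear0 subr0; exact: aug_cycleS.
  have [ni|ni] := pselect (i%:Z = n K); last first.
    have [_ SK _] := S.2 K; have [w wE] := SK _ _ x0a ni.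
    by exists x0, w; split=> //; rewrite wE addrC subrK.
  have [_ _ SK] := S.2 K; have [_ _ SL] := S.2 L.
  have [u [uc ugen _]] := SK i ni.
  have [v [vc _ vfree]] := SL i (etrans ni (esym nKL)).
  have [a [w yE]] := ugen _ x0a.
  have rvc : aug_cycle eps (rg_res (real F Z i) f v).
    have vcyc := aug_cycleP S.1 vc.
    case: i {ugen vfree yE yc y x0 x0c x0a u uc w ni} v vc vcyc => [|i] v vc vcyc.
      by rewrite /aug_cycle /= epsR.
    by apply: aug_cycleS => //; apply: cycle_res.
  have [r [w' rE]] := ugen _ rvc.
  rewrite (top_eq _ _ w (esym ni)) linear0 addr0 in yE.
  rewrite (top_eq _ _ w' (esym ni)) linear0 addr0 in rE.
  have [g gE] := gmap_base f.
  have rE' : vact to g (xval v) = r *: xval u.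
    by have := congr1 (@xval _ _ _ _ _ _ _) rE; rewrite -[LHS]/(xval (xres f v)) (xresE _ gE).
  (* As a vector, [u] has a preimage under restriction; the question is whether it lives over [L].
     Since [r *: t = v] with [r] nonzero in a domain, [t] has the support of [v], so it does. *)
  pose t := vact to g^-1%g (xval u).
  have rt : r *: t = xval v.
    by rewrite /t -linearZ /= -rE' -vactM mulVg vact1.
  have r0 : r != 0.
    apply/eqP => r0; have : (1 : R) = 0.
      apply: (vfree 1 0); rewrite scale1r linear0; apply: xval_inj.
      by rewrite -rt r0 scale0r.
    by move/eqP; rewrite oner_eq0.
  have tP : t \in xsupp Z i L.
    apply/xsuppP => x tx; have /xsuppP := xspP v; apply.
    by rewrite -rt mxE mulf_neq0.
  have tc : is_cycle (XSp tP : real F Z i L).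
    apply/is_cycle_real; apply/eqP.
    have /is_cycle_real := aug_cycleP S.1 vc.
    by rewrite -rt -scalemxAl => /eqP; rewrite scalemx_eq0 (negPf r0).
  exists (x0 + a *: (XSp tP : real F Z i L)), 0; split.
    by apply: cycleD => //; apply: cycleZ.
  rewrite linear0 addr0 linearD linearZ /=.
  have -> : xres f (XSp tP) = u.
    apply: xval_inj; rewrite (xresE _ gE) /= /t.
    by rewrite -vactM mulgV vact1.
  by rewrite -yE addrC subrK.
have inj (K L : orbit_obj F) (f : gmap K L) i : n L = n K ->
    res_homology_inj (real F Z) f i.
  move=> nKL x xc w e.
  (* In the top degree there are no boundaries, and restriction is injective on vectors. In other
     degrees a reduced cycle is a boundary. *)
  have [ni|ni] := pselect (i%:Z = n K).
    have [g gE] := gmap_base f.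
    exists 0; rewrite linear0; apply: xval_inj.
    have := congr1 (@xval _ _ _ _ _ _ _) e.
    rewrite (top_eq _ _ w (esym ni)) linear0 -[LHS]/(xval (xres f x)) (xresE _ gE).
    move=> /(congr1 (vact to g^-1%g)); rewrite -vactM mulVg vact1 => ->.
    by rewrite linear0.
  have xa : aug_cycle eps x.
    case: i x xc w e ni => [|i] x xc w e ni; last exact: aug_cycleS.
    by rewrite /aug_cycle /= -(epsR _ _ f) e S.1.
  have [_ SL _] := S.2 L; have [|w' <-] := SL _ _ xa; first by rewrite nKL.
  by exists w'.
split=> //.
- by split=> // i; apply: free_projective.
- move=> K L f nKL; apply/homology_iso_res => i; split.
    exact: res_homology_inj_he (homotopy_equivalent_sym CZ) (inj K L f i nKL).
  exact: res_homology_surj_he (homotopy_equivalent_sym CZ) (surj K L f i nKL).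
move=> K L M KF LF MF KL KM nKL nKM nK0.
pose K' : orbit_obj F := OrbitObj KF.
have [i nE] : exists i : nat, n K' = i%:Z.
  by exists `|n K|%N; rewrite gez0_abs //; move: nK0; lia.
have [_ _ SK] := S.2 K'; have [u [uc _ ufree]] := SK i (esym nE).
(* The generator [u] is homologous to a restriction from [L']; without boundaries in this degree it
   is equal to it, hence supported on [L']-fixed cells. *)
have fixu L' (LF' : L' \in F) : K \subset L' -> n K = n L' -> xval u \in xsupp Z i L'.
  move=> KL' nKL'; pose L0 : orbit_obj F := OrbitObj LF'.
  have [f fE] := @gmap_incl _ _ K' L0 KL'.
  have [x [w [_ uE]]] := surj K' L0 f i (esym nKL') u (aug_cycleP S.1 uc).
  rewrite uE (top_eq _ _ w nE) linear0 addr0.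
  by rewrite -[xval _]/(xval (xres f x)) (xresE _ fE) vact1; exact: xspP.
have /xsuppP uL := fixu L LF KL nKL; have /xsuppP uM := fixu M MF KM nKM.
have [x ux] : exists x, xval u 0 x != 0.
  apply: contrapT => no; have : (1 : R) = 0.
    apply: (ufree 1 0); rewrite scale1r linear0; apply: xval_inj.
    apply/rowP => x; rewrite mxE; apply/eqP/negPn/negP => ux.
    by apply: no; exists x.
  by move/eqP; rewrite oner_eq0.
have [[xi Lx] [_ Mx]] := (uL x ux, uM x ux).
have Jx : (L <*> M)%G \subset 'C[x | to]%g by rewrite join_subG Lx.
have [_ _ Fsub] := famF.
have JF : (L <*> M)%G \in F by exact: Fsub (stabF x) Jx.
split=> //; apply/eqP; rewrite eq_le; apply/andP; split.
  rewrite nKL; apply: mono; exists 1%g; rewrite conjsg1.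
  exact: joing_subl.
by rewrite -[n K]/(n K') nE; exact: (tight (OrbitObj JF) i x xi Jx).
Qed.

End Converse.

End Main.

Theorem theoremA (gT : finGroupType) (F : {set {group gT}}) (R : idomainType)
  (n : {group gT} -> int) (C : rgcx R F) :
  is_family F ->
  is_PID R ->
  conj_invariant n ->
  supported_on F n ->
  rgcx_finite C ->
  rgcx_free C ->
  homology_sphere n C ->
  (exists D : rgcx R F,
     [/\ homotopy_equivalent C D, rgcx_finite D, rgcx_free D & n =1 Dim D])
  <-> algebraic_homotopy_representation n C.
Proof.
move=> famF pid _ suppn finC freeC sph; split.
  move=> [D [CD finD freeD dimD]].
  by apply (representation_of_tight famF suppn sph CD finD freeD dimD finC freeC).
exact: tight_replacement.
Qed.
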